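(* Let $X_i=g(\varepsilon_{i-s};\,s\in\mathbb{Z}^d)$, $i\in\mathbb{Z}^d$, be the real random field described in the context, with marginal density $f$ and physical dependence coefficients $\delta_i=\delta_{i,2}$, and let $f_n$ be the kernel density estimator built from the regions $\Lambda_n$, the bandwidths $b_n$ and the kernel $K$. Assume: (i) $b_n\to0$ and $|\Lambda_n|\to\infty$ such that $|\Lambda_n|b_n\to\infty$ as $n\to\infty$; (ii) $\sum_{i\in\mathbb{Z}^d}|i|^{5d/2}\,\delta_i<\infty$; (iii) the marginal density $f$ is positive, continuous and bounded; (iv) $K$ is Lipschitz, $\int_{\mathbb{R}}K(u)\,du=1$, $\int_{\mathbb{R}}|K(u)|\,du<\infty$ and $\int_{\mathbb{R}}K^2(u)\,du<\infty$; (v) for every $i\in\mathbb{Z}^d\setminus\{0\}$ the pair $(X_0,X_i)$ has a joint density $f_{0,i}$, and there exists $\kappa>0$ such that $\sup_{(x,y)\in\mathbb{R}^2,\,i\in\mathbb{Z}^d\setminus\{0\}}f_{0,i}(x,y)\leq\kappa$. Then for every positive integer $k$ and any distinct points $x_1,\dots,x_k\in\mathbb{R}$, the random vector $$(|\Lambda_n|b_n)^{1/2}\left(f_n(x_1)-\mathbb{E}f_n(x_1),\dots,f_n(x_k)-\mathbb{E}f_n(x_k)\right)^{\top}$$ converges in law, as $n\to\infty$, to $\mathcal{N}(0,\Gamma)$, where $\Gamma$ is the diagonal $k\times k$ matrix with diagonal elements $\gamma_{ii}=f(x_i)\int_{\mathbb{R}}K^2(u)\,du$.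
   Context: Let $d\ge1$ be an integer, $(\varepsilon_j)_{j\in\mathbb{Z}^d}$ i.i.d. real random variables, $g$ a measurable function on $\mathbb{R}^{\mathbb{Z}^d}$, and $X_i=g(\varepsilon_{i-s};\,s\in\mathbb{Z}^d)$ for $i\in\mathbb{Z}^d$; the $X_i$ have a common marginal density $f$. For $i=(i_1,\dots,i_d)\in\mathbb{Z}^d$, $|i|=\max_{1\le k\le d}|i_k|$. For a finite set $\Lambda$, $|\Lambda|$ is its cardinality. Physical dependence measure: let $(\varepsilon'_j)_{j\in\mathbb{Z}^d}$ be an i.i.d. copy of $(\varepsilon_j)_{j\in\mathbb{Z}^d}$ (independent of it), $\varepsilon^*_j=\varepsilon_j$ for $j\neq0$ and $\varepsilon^*_0=\varepsilon'_0$, and $X_i^*=g(\varepsilon^*_{i-s};\,s\in\mathbb{Z}^d)$. For $p>0$ and $X_i\in\mathbb{L}^p$, set $\delta_{i,p}=\|X_i-X_i^*\|_p$, and write $\delta_i=\delta_{i,2}$ (so $X_i\in\mathbb{L}^2$ is assumed whenever $\delta_i$ is used). Estimator: $(\Lambda_n)_{n\ge1}$ is a sequence of finite nonempty subsets of $\mathbb{Z}^d$, $(b_n)_{n\ge1}$ a sequence of positive reals, $K:\mathbb{R}\to\mathbb{R}$ a kernel, and $$f_n(x)=\frac{1}{|\Lambda_n|b_n}\sum_{i\in\Lambda_n}K\left(\frac{x-X_i}{b_n}\right),\quad x\in\mathbb{R}.$$ *)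

(* Defs.v *)
From HB Require Import structures.
From mathcomp Require Import all_boot all_order all_algebra finmap.
From mathcomp Require Import all_classical all_reals all_analysis.

Set Implicit Arguments.
Unset Strict Implicit.
Unset Printing Implicit Defensive.

Import Order.TTheory GRing.Theory Num.Theory.
Import numFieldNormedType.Exports.

Local Open Scope classical_set_scope.
Local Open Scope ring_scope.

Notation lattice d := 'rV[int]_d.

Definition lnorm (d : nat) (i : lattice d) : nat := (\max_(k < d) `|i ord0 k|)%N.

(* R^(Z^d) with the product sigma-algebra, i.e. the one generated by the
   coordinate maps. *)
Definition cylinders (R : realType) (d : nat) : set (set (lattice d -> R)) :=
  [set A | exists j : lattice d, exists2 B : set R,
     measurable B & A = [set e : lattice d -> R | B (e j)]].

Notation configs R d := (g_sigma_algebraType (@cylinders R d)).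

Definition sample_path (R : realType) (d : nat) (T : Type)
    (eps : lattice d -> T -> R) (w : T) : configs R d := fun j => eps j w.

Section laws.
Context (disp : measure_display) (T : measurableType disp) (R : realType).
Variable P : probability T R.

Definition mutually_independent (I : choiceType) (Y : I -> T -> R) : Prop :=
  forall (J : {fset I}) (B : I -> set R), (forall j, measurable (B j)) ->
    P (\bigcap_(j in [set` J]) (Y j @^-1` B j)) =
    (\prod_(j <- J) fine (P (Y j @^-1` B j)))%:E.

Definition identically_distributed (I : Type) (Y : I -> T -> R) : Prop :=
  forall (i j : I) (B : set R), measurable B ->
    P (Y i @^-1` B) = P (Y j @^-1` B).

Definition iid (I : choiceType) (Y : I -> T -> R) : Prop :=
  mutually_independent Y /\ identically_distributed Y.

Definition independent_copy (disp' : measure_display)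
    (S : measurableType disp') (Y Y' : T -> S) : Prop :=
  (forall A : set S, measurable A -> P (Y' @^-1` A) = P (Y @^-1` A)) /\
  (forall A B : set S, measurable A -> measurable B ->
     P (Y @^-1` A `&` Y' @^-1` B) = (P (Y @^-1` A) * P (Y' @^-1` B))%E).

Definition has_density (disp' : measure_display) (S : measurableType disp')
    (nu : set S -> \bar R) (Y : T -> S) (f : S -> R) : Prop :=
  [/\ measurable_fun [set: S] f, (forall s, 0 <= f s) &
      forall A : set S, measurable A ->
        P (Y @^-1` A) = (\int[nu]_(s in A) (f s)%:E)%E].

End laws.

Definition shift_field (R : realType) (d : nat) (T : Type)
    (g : configs R d -> R) (eps : lattice d -> T -> R) (i : lattice d) (w : T)
    : R := g (fun s => eps (i - s) w).

Definition swap0 (R : realType) (d : nat) (T : Type)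
    (eps eps' : lattice d -> T -> R) (j : lattice d) : T -> R :=
  if j == 0 then eps' j else eps j.

Definition phys_dep (disp : measure_display) (T : measurableType disp)
    (R : realType) (P : probability T R) (d : nat) (g : configs R d -> R)
    (eps eps' : lattice d -> T -> R) (p : R) (i : lattice d) : \bar R :=
  'N[P]_p%:E [ (fun w =>
    (shift_field g eps i w - shift_field g (swap0 eps eps') i w)%R%:E) ]%E.

Definition kernel_density (R : realType) (d : nat) (T : Type)
    (X : lattice d -> T -> R) (L : {fset (lattice d)}) (b : R) (K : R -> R)
    (x : R) (w : T) : R :=
  (#|` L|%:R * b)^-1 * \sum_(i <- L) K ((x - X i w) / b).

Notation borel S := (g_sigma_algebraType (@open S)).

(* N(m, v) with variance v; the library's [normal_prob m s] takes the standard
   deviation and is not the Dirac mass at m when s = 0. *)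
Definition gauss_law (R : realType) (m v : R) : set R -> \bar R :=
  if v == 0 then dirac m else normal_prob m (Num.sqrt v).

(* The law N(m, G) on R^k, G possibly singular: every linear form a^T z has
   law N(a^T m, a^T G a). *)
Definition is_multinormal (R : realType) (k : nat)
    (nu : probability (borel 'cV[R]_k) R) (m : 'cV[R]_k) (G : 'M[R]_k) : Prop :=
  [/\ G^T = G, (forall a : 'cV[R]_k, 0 <= (a^T *m G *m a) ord0 ord0) &
      forall (a : 'cV[R]_k) (B : set R), measurable B ->
        nu [set z : 'cV[R]_k | B ((a^T *m z) ord0 ord0)] =
        gauss_law ((a^T *m m) ord0 ord0) ((a^T *m G *m a) ord0 ord0) B].

Definition cvg_in_law (disp : measure_display) (T : measurableType disp)
    (R : realType) (P : probability T R) (S : ptopologicalType)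
    (Z : nat -> T -> S) (nu : probability (borel S) R) : Prop :=
  forall h : S -> R, continuous h -> (exists M : R, forall z, `|h z| <= M) ->
    (\int[P]_w (h (Z n w))%:E)%E @[n --> \oo] -->
    (\int[nu]_z (h z)%:E)%E.

(* Main.v *)
(** Characteristic functions and tightness reduce the claim to one linear form,
    that is to the normalized sum of the Phi(X_i) with
    Phi(t) = sum_l a_l K((x_l - t) / b_n): a continuous function is uniformly
    close on a cube to a trigonometric polynomial, by Bernstein polynomials in
    the variables (1 + sin(c z_l)) / 2.

    In Phi(X_i) the innovations at distance more than m from i are frozen at
    deterministic values.  If tau bounds the sum of the dependence coefficients
    of Phi(X) beyond m, this costs 2 tau in L2 at each site, and the Efron-Stein
    inequality shows that the whole sum changes by O(m^d tau |Lambda_n|^(1/2)).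
    The frozen field is 2m-dependent; for its normalized sum S the function
    w(l) = E cos(l S + beta) satisfies w' = - l v w up to a small error
    (Stein's method), so w(1) is close to cos(beta) exp(- v / 2).  Here v is close
    to E Phi(X_0)^2 / b_n, which converges to sum_l a_l^2 f(x_l) int K^2: the
    cross terms vanish because the x_l are distinct and K tends to 0 at infinity.

    The radius m is the largest one for which m^d b_n stays below a constant;
    hypothesis (ii) is what makes m^d tau b_n^(-1/2) small for this choice. *)

Require Import Defs.
From HB Require Import structures.
From mathcomp Require Import all_boot all_order all_algebra finmap.
From mathcomp Require Import all_classical all_reals all_analysis.
From mathcomp Require Import measurable_realfun.
From mathcomp Require Import ring lra zify.
Import Order.TTheory GRing.Theory Num.Theory.
Import numFieldNormedType.Exports.
Local Open Scope classical_set_scope.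
Local Open Scope ring_scope.
Set Implicit Arguments.
Unset Strict Implicit.
Unset Printing Implicit Defensive.

(** * Bounded expectations *)

(** The exponent 5d/2 comes from a balance of scales. [Phi] has a Lipschitz constant of order 1/b_n,
    so with q = (m+1)^d the influences beyond m sum to at most r b_n^(-1) q^(-5/2) up to a constant,
    where r is as small as desired once m is large. Efron-Stein multiplies this by the q coordinates
    of a block and the normalization by b_n^(-1/2): the error is r (q b_n)^(-3/2). Near pairs,
    controlled by the bounded joint densities, cost q b_n. Holding q b_n near a small constant
    settles the second error, and r, chosen after that constant, the first.

    Freezing at deterministic values, instead of conditioning on the near innovations, keeps the
    modified functional explicit, measurable and bounded by the same constant. Summing the L2 errors
    of the sites would lose a factor |Lambda_n|^(1/2), which is why a variance inequality is needed.
    It concerns functions of infinitely many coordinates; the passage from finitely many is made by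
    approximating indicators of measurable sets, without martingales. A Lipschitz integrable kernel
    is bounded and tends to 0 at infinity, so all the functionals are bounded. *)

Section bounded_measurable.
Context (R : realType) (disp : measure_display) (T : measurableType disp).
Implicit Types F G : T -> R.

(** Expectations are only taken of bounded functions: integrability is then automatic, and the class
    is closed under sums, products and composition with measurable maps. *)
Definition bmeas F :=
  measurable_fun [set: T] F /\ exists M : R, forall w, `|F w| <= M.

Lemma bmeas_cst (c : R) : bmeas (fun=> c).
Proof. by split; [exact: measurable_cst | exists `|c|]. Qed.

Lemma bmeasD F G : bmeas F -> bmeas G -> bmeas (fun w => F w + G w).
Proof.
move=> [mF [M FM]] [mG [N GN]]; split; first exact: measurable_funD.
by exists (M + N) => w; rewrite (le_trans (ler_normD _ _))// lerD.
Qed.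

Lemma bmeasM F G : bmeas F -> bmeas G -> bmeas (fun w => F w * G w).
Proof.
move=> [mF [M FM]] [mG [N GN]]; split; first exact: measurable_funM.
by exists (M * N) => w; rewrite normrM ler_pM.
Qed.

Lemma bmeasN F : bmeas F -> bmeas (fun w => - F w).
Proof.
move=> [mF [M FM]]; split; first exact: measurableT_comp.
by exists M => w; rewrite normrN.
Qed.

Lemma bmeasB F G : bmeas F -> bmeas G -> bmeas (fun w => F w - G w).
Proof. by move=> bF bG; exact/bmeasD/bmeasN. Qed.

Lemma bmeas_norm F : bmeas F -> bmeas (fun w => `|F w|).
Proof.
move=> [mF [M FM]]; split; first exact: measurableT_comp.
by exists M => w; rewrite normr_id.
Qed.

Lemma bmeasX F n : bmeas F -> bmeas (fun w => F w ^+ n).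
Proof.
move=> [mF [M FM]]; split; first exact: measurable_funX.
by exists (M ^+ n) => w; rewrite normrX lerXn2r ?nnegrE// (le_trans _ (FM w)).
Qed.

Lemma bmeas_sum I (r : seq I) (p : pred I) (F : I -> T -> R) :
  (forall i, bmeas (F i)) -> bmeas (fun w => \sum_(i <- r | p i) F i w).
Proof.
move=> bF; elim: r => [|i r IH].
  by under eq_fun do rewrite big_nil; exact: bmeas_cst.
under eq_fun do rewrite big_cons.
by case: (p i) => //; exact: bmeasD.
Qed.

Lemma bmeas_cos F : measurable_fun [set: T] F -> bmeas (fun w => cos (F w)).
Proof.
move=> mF; split; last by exists 1 => w; rewrite ler_norml cos_geN1 cos_le1.
apply: measurableT_comp => //.
by apply: continuous_measurable_fun; exact: continuous_cos.
Qed.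

Lemma bmeas_sin F : measurable_fun [set: T] F -> bmeas (fun w => sin (F w)).
Proof.
move=> mF; split; last by exists 1 => w; rewrite ler_norml sin_geN1 sin_le1.
apply: measurableT_comp => //.
by apply: continuous_measurable_fun; exact: continuous_sin.
Qed.

End bounded_measurable.

Lemma bmeas_comp (R : realType) (d d' : measure_display) (S : measurableType d)
    (T : measurableType d') (th : S -> T) (F : T -> R) :
  measurable_fun [set: S] th -> bmeas F -> bmeas (fun s => F (th s)).
Proof.
move=> mth [mF [M FM]]; split; first exact: measurableT_comp.
by exists M.
Qed.

Ltac bm := repeat first [assumption | apply: bmeas_cst | apply: bmeasX
  | apply: bmeasB | apply: bmeasD | apply: bmeasN | apply: bmeasM
  | apply: bmeas_norm | (apply: bmeas_sum => ?)
  | match goal with H : forall _, bmeas _ |- _ => apply: H end].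

Section expectation_bounded.
Context (R : realType) (disp : measure_display) (T : measurableType disp).
Variable P : probability T R.
Implicit Types F G : T -> R.

(** The [fine] part of an extended integral, hence 0 when that integral is infinite; [bmeas] in the
    rules below guards against this. *)
Definition Ex F : R := Rintegral P [set: T] F.

Lemma bmeas_integrable F : bmeas F -> P.-integrable [set: T] (EFin \o F).
Proof.
move=> [mF [M FM]]; apply: measurable_bounded_integrable => //.
  by apply: (le_lt_trans (probability_le1 P measurableT)); rewrite ltry.
exists M; split; first exact: num_real.
by move=> t Mt w _; apply: le_trans (FM w) (ltW Mt).
Qed.

Lemma EFin_Ex F : bmeas F -> (Ex F)%:E = (\int[P]_w (F w)%:E)%E.
Proof.
by move=> bF; rewrite /Ex /Rintegral fineK// integrable_fin_num// bmeas_integrable.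
Qed.

Lemma Ex_cst (c : R) : Ex (fun=> c) = c.
Proof.
transitivity (c * fine (P [set: T])); first exact: Rintegral_cst.
by rewrite probability_setT mulr1.
Qed.

Lemma eq_Ex F G : (forall w, F w = G w) -> Ex F = Ex G.
Proof. by move=> FG; apply: eq_Rintegral => w _; exact: FG. Qed.

Lemma ExD F G : bmeas F -> bmeas G -> Ex (fun w => F w + G w) = Ex F + Ex G.
Proof. by move=> bF bG; rewrite /Ex RintegralD//; exact: bmeas_integrable. Qed.

Lemma ExB F G : bmeas F -> bmeas G -> Ex (fun w => F w - G w) = Ex F - Ex G.
Proof. by move=> bF bG; rewrite /Ex RintegralB//; exact: bmeas_integrable. Qed.

Lemma ExZl F (c : R) : bmeas F -> Ex (fun w => c * F w) = c * Ex F.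
Proof. by move=> bF; rewrite /Ex RintegralZl//; exact: bmeas_integrable. Qed.

Lemma ExZr F (c : R) : bmeas F -> Ex (fun w => F w * c) = Ex F * c.
Proof. by move=> bF; rewrite /Ex RintegralZr//; exact: bmeas_integrable. Qed.

Lemma ExN F : bmeas F -> Ex (fun w => - F w) = - Ex F.
Proof.
by move=> bF; rewrite -mulN1r -ExZl//; apply: eq_Ex => w; rewrite mulN1r.
Qed.

Lemma Ex_sum I (r : seq I) (p : pred I) (F : I -> T -> R) :
  (forall i, bmeas (F i)) ->
  Ex (fun w => \sum_(i <- r | p i) F i w) = \sum_(i <- r | p i) Ex (F i).
Proof.
move=> bF; elim: r => [|i r IH].
  by under eq_Ex do rewrite big_nil; rewrite big_nil Ex_cst.
under eq_Ex do rewrite big_cons.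
rewrite big_cons; case: (p i) => //; rewrite ExD ?IH//.
exact: bmeas_sum.
Qed.

Lemma Ex_le F G : bmeas F -> bmeas G -> (forall w, F w <= G w) -> Ex F <= Ex G.
Proof.
by move=> bF bG FG; apply: le_Rintegral => //; exact: bmeas_integrable.
Qed.

Lemma Ex_ge0 F : (forall w, 0 <= F w) -> 0 <= Ex F.
Proof. by move=> F0; apply: Rintegral_ge0. Qed.

Lemma Ex_norm F : bmeas F -> `|Ex F| <= Ex (fun w => `|F w|).
Proof. by move=> bF; apply: le_normr_Rintegral => //; exact: bmeas_integrable. Qed.

Lemma Ex_le_cst F (c : R) : bmeas F -> (forall w, F w <= c) -> Ex F <= c.
Proof. by move=> bF Fc; rewrite -(Ex_cst c) Ex_le//; exact: bmeas_cst. Qed.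

Lemma Ex_indic (d : measure_display) (S : measurableType d) (th : T -> S)
    (A : set S) : measurable_fun [set: T] th -> measurable A ->
  Ex (fun w => \1_A (th w)) = fine (P (th @^-1` A)).
Proof.
move=> mth mA; rewrite /Ex /Rintegral.
rewrite (_ : (fun w => _) = (fun w => (\1_(th @^-1` A) w)%:E)).
  by rewrite integral_indic ?setIT// -[X in measurable X]setTI; exact: mth.
apply/funext => w; rewrite !indicE; congr (nat_of_bool _)%:R%:E.
Qed.

Definition L2 F : R := Num.sqrt (Ex (fun w => F w ^+ 2)).

Lemma L2_ge0 F : 0 <= L2 F. Proof. exact: sqrtr_ge0. Qed.

Lemma L2_sqr F : L2 F ^+ 2 = Ex (fun w => F w ^+ 2).
Proof. by rewrite sqr_sqrtr// Ex_ge0// => w; exact: sqr_ge0. Qed.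

(** Optimize [2 |F G| <= s F^2 + s^-1 G^2] over [s > 0]; the optimum is [s = L2 G / L2 F]. *)
Lemma Ex_cauchy_schwarz F G : bmeas F -> bmeas G ->
  Ex (fun w => `|F w * G w|) <= L2 F * L2 G.
Proof.
move=> bF bG.
have bFG : bmeas (fun w => `|F w * G w|) by exact/bmeas_norm/bmeasM.
have amgm (s : R) : 0 < s ->
    2 * Ex (fun w => `|F w * G w|) <= s * L2 F ^+ 2 + s^-1 * L2 G ^+ 2.
  move=> s0; rewrite !L2_sqr -!ExZl//; try exact: bmeasX.
  rewrite -ExD; try by apply: bmeasM; [exact: bmeas_cst|exact: bmeasX].
  apply: Ex_le.
  - by apply: bmeasM => //; exact: bmeas_cst.
  - by apply: bmeasD; apply: bmeasM; [exact: bmeas_cst|exact: bmeasX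
      |exact: bmeas_cst|exact: bmeasX].
  move=> w; rewrite normrM -(real_normK (num_real (F w))).
  rewrite -(real_normK (num_real (G w))).
  set x := `|F w|; set y := `|G w|.
  have -> : s * x ^+ 2 + s^-1 * y ^+ 2 = s^-1 * (s * x - y) ^+ 2 + 2 * (x * y).
    by field; rewrite gt_eqF.
  by rewrite lerDr mulr_ge0 ?sqr_ge0// invr_ge0 ltW.
set e := Ex _ in amgm *.
have e0 : 0 <= e by apply: Ex_ge0.
have := L2_ge0 F; have := L2_ge0 G; rewrite !le0r.
set a := L2 F in amgm *; set c := L2 G in amgm *.
case: (ltrP 0 e) => [e_gt0|]; last first.
  by move=> ele0 _ _; rewrite (le_trans ele0)// mulr_ge0// L2_ge0.
case/orP=> [/eqP c0|c0]; case/orP => [/eqP a0|a0].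
- by have := amgm 1 ltr01; rewrite a0 c0; lra.
(* With one norm equal to zero there is no optimal [s]; this one keeps the surviving term below [e],
   so that [2 e <= e]. *)
- rewrite c0 mulr0; have s0 : 0 < e / (a ^+ 2 + 1).
    by rewrite divr_gt0// ltr_wpDl// sqr_ge0.
  have := amgm _ s0; rewrite c0.
  have : e / (a ^+ 2 + 1) * a ^+ 2 <= e.
    rewrite mulrAC -mulrA ger_pMr// ler_pdivrMr ?mul1r ?lerDl//.
    by rewrite ltr_wpDl// sqr_ge0.
  lra.
- rewrite a0 mul0r; have s0 : 0 < (c ^+ 2 + 1) / e.
    by rewrite divr_gt0// ltr_wpDl// sqr_ge0.
  have := amgm _ s0; rewrite a0 invf_div.
  have : e / (c ^+ 2 + 1) * c ^+ 2 <= e.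
    rewrite mulrAC -mulrA ger_pMr// ler_pdivrMr ?mul1r ?lerDl//.
    by rewrite ltr_wpDl// sqr_ge0.
  lra.
- have := amgm (c / a) (divr_gt0 c0 a0).
  have -> : c / a * a ^+ 2 + (c / a)^-1 * c ^+ 2 = 2 * (a * c).
    by field; rewrite !gt_eqF.
  by rewrite ler_pM2l.
Qed.

Lemma Ex_norm_le_L2 F : bmeas F -> Ex (fun w => `|F w|) <= L2 F.
Proof.
move=> bF; have := Ex_cauchy_schwarz bF (bmeas_cst _ 1).
rewrite [X in _ * X]/L2; under eq_Ex do rewrite mulr1.
by under [X in Num.sqrt X]eq_Ex do rewrite expr1n; rewrite Ex_cst sqrtr1 mulr1.
Qed.

Lemma L2D F G : bmeas F -> bmeas G -> L2 (fun w => F w + G w) <= L2 F + L2 G.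
Proof.
move=> bF bG; rewrite -(@ler_pXn2r _ 2)// ?nnegrE ?addr_ge0 ?L2_ge0//.
rewrite sqrrD !L2_sqr.
have -> : Ex (fun w => (F w + G w) ^+ 2) =
    Ex (fun w => F w ^+ 2) + 2 * Ex (fun w => F w * G w) + Ex (fun w => G w ^+ 2).
  by rewrite -ExZl -?ExD//; [apply: eq_Ex => w; ring|bm..].
rewrite lerD2r lerD2l -[leRHS]mulr_natl ler_pM2l//.
apply: le_trans (ler_norm _) _; apply: le_trans (Ex_norm (bmeasM bF bG)) _.
exact: Ex_cauchy_schwarz.
Qed.

Lemma eq_L2 F G : (forall w, F w ^+ 2 = G w ^+ 2) -> L2 F = L2 G.
Proof. by move=> FG; rewrite /L2 (eq_Ex FG). Qed.

Lemma L2B F G : bmeas F -> bmeas G -> L2 (fun w => F w - G w) <= L2 F + L2 G.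
Proof.
move=> bF bG; rewrite -(@eq_L2 (fun w => - G w) G) => [|w]; last exact: sqrrN.
exact: L2D bF (bmeasN bG).
Qed.

Lemma L2_sum (I : eqType) (r : seq I) (F : I -> T -> R) :
  (forall i, bmeas (F i)) ->
  L2 (fun w => \sum_(i <- r) F i w) <= \sum_(i <- r) L2 (F i).
Proof.
move=> bF; elim: r => [|i r IH].
  rewrite big_nil (@eq_L2 _ (fun=> 0)) => [|w]; last by rewrite big_nil.
  by rewrite /L2 expr0n Ex_cst sqrtr0.
rewrite big_cons (@eq_L2 _ (fun w => F i w + \sum_(j <- r) F j w)) => [|w].
  by apply: le_trans (L2D _ _) _ => //; [exact: bmeas_sum|rewrite lerD2l].
by rewrite big_cons.
Qed.

Lemma L2Zl F (c : R) : bmeas F -> L2 (fun w => c * F w) = `|c| * L2 F.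
Proof.
move=> bF; rewrite /L2; under eq_Ex do rewrite exprMn.
by rewrite ExZl; [rewrite sqrtrM ?sqr_ge0// sqrtr_sqr|exact: bmeasX].
Qed.

End expectation_bounded.

(** * Configurations and independent copies *)

(** [cylinders] over an arbitrary index type, since the doubled index [I * bool] of a field and its
    copy is needed too. At [lattice d] the two are convertible. *)
Definition cyls (R : realType) (I : choiceType) : set (set (I -> R)) :=
  [set A | exists j : I, exists2 B : set R,
     measurable B & A = [set e : I -> R | B (e j)]].

Notation conf R I := (g_sigma_algebraType (@cyls R I)).

Section configurations.
Context (R : realType) (I : choiceType).

Definition fcyl (s : seq I) (B : I -> set R) : set (conf R I) :=
  [set e | forall j, j \in s -> B j (e j)].

Lemma measurable_conf (d : measure_display) (S : measurableType d)
    (th : S -> conf R I) :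
  (forall j, measurable_fun [set: S] (fun s => th s j)) ->
  measurable_fun [set: S] th.
Proof.
move=> mth; have H := @measurability _ _ S (conf R I) setT th (@cyls R I) erefl.
by apply: H => _ [_ [j [B mB ->]] <-]; exact: mth.
Qed.

Lemma measurable_coord (j : I) :
  measurable_fun [set: conf R I] (fun e : conf R I => e j).
Proof.
move=> _ B mB; rewrite setTI; apply: sub_sigma_algebra.
by exists j, B.
Qed.

Lemma measurable_fcyl s B : (forall j, measurable (B j)) -> measurable (fcyl s B).
Proof.
move=> mB; elim: s => [|j s IH].
  by rewrite (_ : fcyl _ _ = setT)//; apply/seteqP; split.
rewrite (_ : fcyl _ _ = [set e : conf R I | B j (e j)] `&` fcyl s B).
  by apply: measurableI => //; rewrite -[X in measurable X]setTI; exact: measurable_coord.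
apply/seteqP; split=> [e H|e [H1 H2] i].
  by split; [apply: H; rewrite mem_head|move=> i si; apply: H; rewrite inE si orbT].
by rewrite inE => /predU1P[->//|]; exact: H2.
Qed.

(** The finite cylinders form a pi-system that generates the product sigma-algebra: two of them
    intersect in a cylinder over the union of the index lists, with [setT] for missing
    constraints. *)
Lemma fcyl_measure_unique (mu nu : {measure set (conf R I) -> \bar R}) :
  (mu setT < +oo)%E ->
  (forall s B, uniq s -> (forall j, measurable (B j)) ->
     mu (fcyl s B) = nu (fcyl s B)) ->
  forall A, measurable A -> mu A = nu A.
Proof.
move=> muT munu.
pose G := [set A | exists s B, [/\ uniq s, forall j : I, measurable (B j : set R)
                                 & A = fcyl s B]].
have GT : G setT.
  exists [::], (fun=> setT); split=> //.
  by apply/seteqP; split.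
apply: (measure_unique G (fun=> setT)) => //.
- apply/seteqP; split.
    apply: smallest_sub; first exact: smallest_sigma_algebra.
    move=> _ [j [B mB ->]]; apply: sub_sigma_algebra.
    exists [:: j], (fun=> B); split=> //.
    apply/seteqP; split=> e /= H; last by apply: H; rewrite mem_head.
    by move=> i; rewrite inE => /eqP ->.
  apply: smallest_sub; first exact: sigma_algebra_measurable.
  by move=> _ [s [B [_ mB ->]]]; exact: measurable_fcyl.
- move=> _ _ [s [B [us mB ->]]] [t [C [ut mC ->]]].
  exists (undup (s ++ t)), (fun j => (if j \in s then B j else setT) `&`
     (if j \in t then C j else setT)); split; first exact: undup_uniq.
    by move=> j; apply: measurableI; case: ifP.
  apply/seteqP; split=> [e [H1 H2] j|e H].
    by move=> _; split; case: ifP => //; [move/H1|move/H2].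
  split=> j jn; have := H j; rewrite mem_undup mem_cat jn ?orbT/=.
    by move=> /(_ isT)[].
  by move=> /(_ isT)[].
- by apply/seteqP; split=> // x _; exists 0%N.
- by move=> _ [s [B [us mB ->]]]; exact: munu.
Qed.

End configurations.

Section laws.
Context (R : realType) (disp : measure_display) (T : measurableType disp).
Variable P : probability T R.

Definition rv_of (d : measure_display) (S : measurableType d) (th : T -> S)
    (mth : measurable_fun [set: T] th) : {RV P >-> S} :=
  HB.pack th (isMeasurableFun.Build _ _ _ _ th mth).

Lemma Ex_distribution (d : measure_display) (S : measurableType d) (th : T -> S)
    (mth : measurable_fun [set: T] th) (F : S -> R) : bmeas F ->
  Ex (distribution P (rv_of mth)) F = Ex P (F \o th).
Proof.
move=> bF; rewrite /Ex /Rintegral integral_distribution//.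
  by apply/measurable_EFinP; exact: bF.1.
apply: bmeas_integrable; exact: (bmeas_comp mth bF).
Qed.

Lemma Ex_eq_law (d : measure_display) (S : measurableType d) (th th' : T -> S)
    (F : S -> R) :
  measurable_fun [set: T] th -> measurable_fun [set: T] th' ->
  (forall A, measurable A -> P (th @^-1` A) = P (th' @^-1` A)) ->
  bmeas F -> Ex P (F \o th) = Ex P (F \o th').
Proof.
move=> mth mth' Pth bF; rewrite -(Ex_distribution mth)// -(Ex_distribution mth')//.
congr fine; apply: eq_measure_integral => A mA _; exact: Pth.
Qed.

Context (I : choiceType).

(** Independence and equality in law merged into one product formula for the finite-dimensional
    laws. Only values of [p] on measurable sets matter, so a plain function is enough. *)
Definition iid_law (p : set R -> R) (W : I -> T -> R) :=
  forall s B, uniq s -> (forall j, measurable (B j)) ->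
    P [set w | forall j, j \in s -> B j (W j w)] = (\prod_(j <- s) p (B j))%:E.

(** An injective relabelling of the coordinates leaves every finite cylinder probability unchanged,
    hence the law of the whole configuration. *)
Lemma Ex_relabel (p : set R -> R) (W : I -> T -> R) (pi pi' : I -> I)
    (F : conf R I -> R) :
  (forall j, measurable_fun [set: T] (W j)) -> iid_law p W ->
  cancel pi pi' -> bmeas F ->
  Ex P (fun w => F (fun j => W (pi j) w)) = Ex P (fun w => F (fun j => W j w)).
Proof.
move=> mW iW piK bF.
have mth : measurable_fun [set: T] (fun w => (fun j => W (pi j) w) : conf R I).
  exact: measurable_conf.
have mth' : measurable_fun [set: T] (fun w => (fun j => W j w) : conf R I).
  exact: measurable_conf.
apply: (Ex_eq_law mth mth') => //.
apply: (@fcyl_measure_unique _ _ (distribution P (rv_of mth))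
  (distribution P (rv_of mth'))).
  exact: le_lt_trans (probability_le1 (distribution P (rv_of mth)) measurableT) (ltry _).
move=> s B us mB.
transitivity (P [set w | forall j, j \in map pi s -> B (pi' j) (W j w)]).
  congr (P _); apply/seteqP; split=> w /= H j.
    by move=> /mapP[i si ->]; rewrite piK; exact: H.
  by move=> js; have := H (pi j); rewrite piK; apply; exact: map_f.
have -> := iW (map pi s) (fun j => B (pi' j)); last 2 first.
- by rewrite map_inj_uniq//; exact: can_inj piK.
- by move=> j; exact: mB.
rewrite big_map; under eq_bigr do rewrite piK.
exact: esym (iW _ _ us mB).
Qed.

End laws.

(** * An i.i.d. field together with an independent copy *)

Section iid_pair.
Context (R : realType) (disp : measure_display) (T : measurableType disp).
Variable P : probability T R.
Context (I : choiceType) (eps eps' : I -> T -> R).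
Hypothesis meps : forall j, measurable_fun [set: T] (eps j).
Hypothesis meps' : forall j, measurable_fun [set: T] (eps' j).

Let e w : conf R I := fun j => eps j w.
Let e' w : conf R I := fun j => eps' j w.

Let me_ : measurable_fun [set: T] e. Proof. exact: measurable_conf. Qed.
Let me'_ : measurable_fun [set: T] e'. Proof. exact: measurable_conf. Qed.

Lemma iid_law_of_iid (j0 : I) : iid P eps ->
  iid_law P (fun B => fine (P (eps j0 @^-1` B))) eps.
Proof.
move=> [ind idd] s B us mB.
have := ind [fset j in s]%fset B mB.
have ps : perm_eq (enum_fset [fset j in s]%fset) s.
  by apply: uniq_perm => // j; rewrite inE.
rewrite (perm_big _ ps)/=.
under [in X in _ = X]eq_bigr do rewrite (idd _ j0)//.
move=> <-; congr (P _); apply/seteqP; split=> w /= H j.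
  by rewrite /= !inE => js; exact: H.
by move=> js; apply: H; rewrite /= inE.
Qed.

Variable p : set R -> R.
Hypothesis iid_eps : iid_law P p eps.
Hypothesis copy : forall A B : set (conf R I), measurable A -> measurable B ->
  P (e @^-1` A `&` e' @^-1` B) = (P (e @^-1` A) * P (e @^-1` B))%E.

(** The field and its copy form a single i.i.d. field over [I * bool], in which exchanging the two
    at some sites is a mere relabelling. *)
Let W (x : I * bool) := if x.2 then eps' x.1 else eps x.1.

Let iid_W : iid_law P p W.
Proof.
move=> s B us mB.
pose sb b := [seq x.1 | x <- s & x.2 == b].
have usb b : uniq (sb b).
  rewrite map_inj_in_uniq ?filter_uniq// => -[x1 x2] [y1 y2].
  by rewrite !mem_filter/= => /andP[/eqP-> _] /andP[/eqP-> _] ->.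
transitivity (P (e @^-1` fcyl (sb false) (fun j => B (j, false)) `&`
                 e' @^-1` fcyl (sb true) (fun j => B (j, true)))).
  congr (P _); apply/seteqP; split=> [w H|w [H1 H2]].
    split=> j /mapP[[i b]]; rewrite mem_filter/= => /andP[/eqP -> si] ->.
      exact: (H (i, false)).
    exact: (H (i, true)).
  move=> [j b] js; case: b js => js.
    by apply: H2; apply/mapP; exists (j, true) => //; rewrite mem_filter.
  by apply: H1; apply/mapP; exists (j, false) => //; rewrite mem_filter.
rewrite copy; [|exact: measurable_fcyl|exact: measurable_fcyl].
rewrite iid_eps// iid_eps// -EFinM; congr (_%:E).
rewrite !big_map !big_filter [RHS](bigID (fun x : I * bool => x.2 == false))/=.
congr (_ * _); first by apply: eq_bigr => -[j b] /= /eqP ->.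
by apply: eq_big => -[j []].
Qed.

Definition mix (B : pred I) (a a' : conf R I) : conf R I :=
  fun j => if B j then a' j else a j.

Lemma measurable_mix (d : measure_display) (S : measurableType d)
    (B : pred I) (th th' : S -> conf R I) :
  measurable_fun [set: S] th -> measurable_fun [set: S] th' ->
  measurable_fun [set: S] (fun s => mix B (th s) (th' s)).
Proof.
move=> mth mth'; apply: measurable_conf => j; rewrite /mix.
by case: (B j); exact: (measurableT_comp (measurable_coord j)).
Qed.

Let pairing (a : conf R (I * bool)%type) : conf R I * conf R I :=
  (fun j => a (j, false), fun j => a (j, true)).

Let m_pairing : measurable_fun [set: conf R (I * bool)%type] pairing.
Proof.
by apply: measurable_fun_pair; apply: measurable_conf => j; exact: measurable_coord.
Qed.

(** Exchangeability: exchanging the field and the copy on [B] is an involution of [I * bool], so the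
    pair keeps its law. Every resampling identity below is an instance. *)
Lemma Ex_mix (B : pred I) (H : conf R I * conf R I -> R) : bmeas H ->
  Ex P (fun w => H (mix B (e w) (e' w), mix B (e' w) (e w))) =
  Ex P (fun w => H (e w, e' w)).
Proof.
move=> bH.
pose pi (x : I * bool) := if B x.1 then (x.1, ~~ x.2) else x.
have piK : cancel pi pi.
  by move=> [j b]; rewrite /pi/=; case Bj: (B j) => /=; rewrite Bj ?negbK.
have mW x : measurable_fun [set: T] (W x) by rewrite /W; case: (x.2).
have := Ex_relabel mW iid_W piK (bmeas_comp m_pairing bH).
rewrite /pairing /W /pi/= => <-; apply: eq_Ex => w; congr (H (_, _)); apply/funext => j.
  by rewrite /mix; case: (B j).
by rewrite /mix; case: (B j).
Qed.

(** Stationarity, jointly for the field and its copy. *)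
Lemma Ex_reindex (pi pi' : I -> I) (H : conf R I * conf R I -> R) :
  cancel pi pi' -> bmeas H ->
  Ex P (fun w => H ((e w) \o pi, (e' w) \o pi)) = Ex P (fun w => H (e w, e' w)).
Proof.
move=> piK bH.
pose rho (x : I * bool) := (pi x.1, x.2); pose rho' (x : I * bool) := (pi' x.1, x.2).
have rhoK : cancel rho rho' by move=> [j b]; rewrite /rho /rho'/= piK.
have mW x : measurable_fun [set: T] (W x) by rewrite /W; case: (x.2).
exact: (Ex_relabel mW iid_W rhoK (bmeas_comp m_pairing bH)).
Qed.

(** The pair has law [mu \x mu] with [mu] the law of [e], so the independent copy may be replaced by
    a second, outer draw of [e] itself. *)
Lemma Ex_fubini (H : conf R I * conf R I -> R) : bmeas H ->
  bmeas (fun w => Ex P (fun w' => H (e w', e w))) /\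
  Ex P (fun w => H (e w, e' w)) =
  Ex P (fun w => Ex P (fun w' => H (e w', e w))).
Proof.
move=> bH.
pose ee w := (e w, e' w).
have mee : measurable_fun [set: T] ee by exact: measurable_fun_pair.
pose mu := distribution P (rv_of P me_).
pose nu := distribution P (rv_of P mee).
have E A : measurable A -> (mu \x mu)%E A = nu A.
  by apply: product_measure_unique => A1 A2 mA1 mA2; exact: copy.
have iH : ((mu \x mu)%E).-integrable setT (EFin \o H) by exact: bmeas_integrable.
have bs a : bmeas (fun x => H (x, a)).
  split; last by have [_ [M HM]] := bH; exists M.
  apply: measurableT_comp; first exact: bH.1.
  by apply: measurable_fun_pair => //; exact: measurable_cst.
have bF : bmeas (fun a => Ex P (fun w' => H (e w', a))).
  have E1 a : Ex P (fun w' => H (e w', a)) = Ex mu (fun x => H (x, a)).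
    by rewrite Ex_distribution.
  split.
    have := measurable_fubini_G iH; rewrite /fubini_G => mG.
    apply/measurable_EFinP; apply: eq_measurable_fun mG => a _ /=.
    by rewrite E1 EFin_Ex//.
  have [_ [M HM]] := bH; exists M => a.
  have ba : bmeas (fun w' => H (e w', a)) by exact: (bmeas_comp me_ (bs a)).
  rewrite (le_trans (Ex_norm _ ba))// Ex_le_cst//.
  exact: bmeas_norm.
split; first exact: (bmeas_comp me_ bF).
rewrite -(Ex_distribution P mee bH) -[RHS](Ex_distribution P me_ bF).
transitivity (Ex (mu \x mu)%E H).
  by congr fine; apply: eq_measure_integral => A mA _; exact: esym (E A mA).
rewrite /Ex /Rintegral -integral21_prod_meas1//; congr fine.
apply: eq_integral => a _; rewrite /fubini_G.
have := Ex_distribution P me_ (bs a); rewrite /Ex /Rintegral => <-.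
exact: esym (EFin_Ex _ (bs a)).
Qed.

Lemma Ex_indep (F G : conf R I -> R) : bmeas F -> bmeas G ->
  Ex P (fun w => F (e w) * G (e' w)) = Ex P (F \o e) * Ex P (G \o e).
Proof.
move=> bF bG.
have bH : bmeas (fun z : conf R I * conf R I => F z.1 * G z.2).
  by apply: bmeasM; apply: bmeas_comp.
rewrite (Ex_fubini bH).2/= -ExZl; last exact: (bmeas_comp me_ bG).
apply: eq_Ex => w; rewrite ExZr//; exact: (bmeas_comp me_ bF).
Qed.

End iid_pair.

(** * Resampling coordinates and the Efron-Stein inequality *)

(** Layer cake: [h] times the number of levels [h, 2 h, ..., K h] not above [t] is within [h] of [t]
    as long as [t <= K h]. *)
Lemma staircase (R : realType) (K : nat) (h t : R) : 0 < h -> 0 <= t ->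
  Num.min (t - h) (K%:R * h) <= h * \sum_(k < K) (k.+1%:R * h <= t)%R%:R
    <= Num.min t (K%:R * h).
Proof.
move=> h0 t0; elim: K => [|K /andP[]].
  by rewrite big_ord0 mulr0 mul0r ge_min lexx orbT le_min t0 lexx.
rewrite big_ord_recr /= mulrDr.
set S := h * \sum_(i < K) _; rewrite -[K.+1%:R]natr1.
by case: (lerP ((K%:R + 1) * h) t) => Kt; rewrite ?mulr1 ?mulr0 !(le_min, ge_min) =>
  /orP[] H1 /andP[H2 H3]; apply/andP; split; try (apply/orP); try (apply/andP; split);
  nra.
Qed.

Lemma cvg_bigsum (R : realType) (I : Type) (r : seq I) (u : I -> nat -> R)
    (l : I -> R) : (forall i, u i n @[n --> \oo] --> l i) ->
  (\sum_(i <- r) u i n) @[n --> \oo] --> \sum_(i <- r) l i.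
Proof.
move=> ul; elim: r => [|i r IH].
  by rewrite big_nil; under eq_fun do rewrite big_nil; exact: cvg_cst.
by rewrite big_cons; under eq_fun do rewrite big_cons; exact: cvgD.
Qed.

Section mixing.
Context (R : realType) (disp : measure_display) (T : measurableType disp).
Variable P : probability T R.
Context (I : choiceType) (eps eps' : I -> T -> R).
Hypothesis meps : forall j, measurable_fun [set: T] (eps j).
Hypothesis meps' : forall j, measurable_fun [set: T] (eps' j).
Let e w : conf R I := fun j => eps j w.
Let e' w : conf R I := fun j => eps' j w.
Variable p : set R -> R.
Hypothesis iid_eps : iid_law P p eps.
Hypothesis copy : forall A B : set (conf R I), measurable A -> measurable B ->
  P (e @^-1` A `&` e' @^-1` B) = (P (e @^-1` A) * P (e @^-1` B))%E.

Let Exmix := Ex_mix meps meps' iid_eps copy.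

Let me_ : measurable_fun [set: T] e. Proof. exact: measurable_conf. Qed.
Let me'_ : measurable_fun [set: T] e'. Proof. exact: measurable_conf. Qed.

Let m_mix B : measurable_fun [set: T] (fun w => mix B (e w) (e' w)).
Proof. exact: measurable_mix. Qed.

Let bm_e (F : conf R I -> R) : bmeas F -> bmeas (fun w => F (e w)).
Proof. exact: bmeas_comp. Qed.
Let bm_mix B (F : conf R I -> R) : bmeas F -> bmeas (fun w => F (mix B (e w) (e' w))).
Proof. exact: bmeas_comp. Qed.

Let pm_fst : measurable_fun [set: conf R I * conf R I] fst.
Proof. exact: measurable_fst. Qed.
Let pm_mix B : measurable_fun [set: conf R I * conf R I]
  (fun z => mix B z.1 z.2).
Proof. exact: measurable_mix. Qed.

Let bm_fst (F : conf R I -> R) : bmeas F -> bmeas (fun z : conf R I * conf R I => F z.1).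
Proof. exact: bmeas_comp. Qed.
Let bm_pmix B (F : conf R I -> R) : bmeas F ->
  bmeas (fun z : conf R I * conf R I => F (mix B z.1 z.2)).
Proof. exact: bmeas_comp. Qed.

Lemma Ex_mix1 B (F : conf R I -> R) : bmeas F ->
  Ex P (fun w => F (mix B (e w) (e' w))) = Ex P (fun w => F (e w)).
Proof. by move=> bF; have := Exmix B (bm_fst bF). Qed.

Lemma Ex_swap (H : conf R I * conf R I -> R) : bmeas H ->
  Ex P (fun w => H (e' w, e w)) = Ex P (fun w => H (e w, e' w)).
Proof. by move=> bH; have := Exmix predT bH. Qed.

(** Resampling the coordinates outside [B] does not affect [F] and turns [G] into a function of the
    copy, so independence of the field and its copy applies. *)
Lemma Ex_indep_coord (B : pred I) (F G : conf R I -> R) :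
  bmeas F -> bmeas G ->
  (forall x y : conf R I, (forall j, B j -> x j = y j) -> F x = F y) ->
  (forall x y : conf R I, (forall j, ~~ B j -> x j = y j) -> G x = G y) ->
  Ex P (fun w => F (e w) * G (e w)) =
  Ex P (fun w => F (e w)) * Ex P (fun w => G (e w)).
Proof.
move=> bF bG FB GB.
rewrite -(Ex_indep meps meps' copy bF bG).
have bH : bmeas (fun z : conf R I * conf R I => F z.1 * G z.1).
  by apply: bmeasM; exact: bm_fst.
rewrite -(Exmix (predC B) bH) /=; apply: eq_Ex => w; congr (_ * _).
  by apply: FB => j Bj; rewrite /mix/= Bj.
by apply: GB => j Bj; rewrite /mix/= Bj.
Qed.

(** * Resampling finitely many coordinates *)

Section efron_stein.
Variable F : conf R I -> R.
Hypothesis bF : bmeas F.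

(** Exchange the field and the copy on [s]: resampling [j] after [s] has the same effect in law as
    resampling [j] alone. *)
Lemma L2_mix_step (j : I) (s : seq I) : j \notin s ->
  L2 P (fun w => F (mix (mem s) (e w) (e' w)) -
                 F (mix (mem (j :: s)) (e w) (e' w))) =
  L2 P (fun w => F (e w) - F (mix (pred1 j) (e w) (e' w))).
Proof.
move=> js; rewrite /L2; congr Num.sqrt.
have bH : bmeas (fun z : conf R I * conf R I => (F z.1 - F (mix (pred1 j) z.1 z.2)) ^+ 2).
  by bm; [exact: bm_fst|exact: bm_pmix].
rewrite -(Exmix (mem s) bH)/=; apply: eq_Ex => w; congr ((_ - F _) ^+ 2).
apply/funext => i; rewrite /mix /= inE; case: eqVneq => [->|//].
by rewrite (negbTE js).
Qed.

(** Coordinates are resampled one at a time, and each step has the norm of a single resampling. *)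
Lemma L2_mix_le (s : seq I) : uniq s ->
  L2 P (fun w => F (e w) - F (mix (mem s) (e w) (e' w))) <=
  \sum_(j <- s) L2 P (fun w => F (e w) - F (mix (pred1 j) (e w) (e' w))).
Proof.
elim: s => [_|j s IH /= /andP[js us]].
  rewrite big_nil (@eq_L2 _ _ _ P _ (fun=> 0)) => [|w].
    by rewrite /L2 expr0n Ex_cst sqrtr0.
  by rewrite [X in _ - F X](_ : _ = e w) ?subrr.
rewrite big_cons -(L2_mix_step js).
rewrite (@eq_L2 _ _ _ P _ (fun w => (F (mix (mem s) (e w) (e' w)) -
    F (mix (mem (j :: s)) (e w) (e' w))) +
   (F (e w) - F (mix (mem s) (e w) (e' w))))) => [|w]; last by congr (_ ^+ 2); ring.
apply: le_trans (L2D _ _ _) _; [|by bm; [exact: bm_e|exact: bm_mix]|].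
  by bm; exact: bm_mix.
by rewrite lerD2l IH.
Qed.

(** The core of Efron-Stein. In [E F (A - B)], with [A] and [B] before and after resampling [j],
    exchanging coordinate [j] swaps [A] and [B] and turns [F] into [Fj]; so the term is half of
    [E (F - Fj) (A - B)], where both factors have the norm of a single resampling. If [s] exhausted
    all coordinates, the left-hand side would be the variance. *)
Lemma Ex_mix_telescope (s : seq I) : uniq s ->
  Ex P (fun w => F (e w) * (F (e w) - F (mix (mem s) (e w) (e' w)))) <=
  2^-1 * \sum_(j <- s) L2 P (fun w => F (e w) - F (mix (pred1 j) (e w) (e' w))) ^+ 2.
Proof.
elim: s => [_|j s IH /= /andP[js us]].
  rewrite big_nil mulr0 (@eq_Ex _ _ _ P _ (fun=> 0)) ?Ex_cst// => w.
  by rewrite [X in _ - F X](_ : _ = e w) ?subrr ?mulr0.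
pose A w := F (mix (mem s) (e w) (e' w)).
pose B w := F (mix (mem (j :: s)) (e w) (e' w)).
pose Fj w := F (mix (pred1 j) (e w) (e' w)).
pose Fe w := F (e w).
have bA : bmeas A by exact: bm_mix.
have bB : bmeas B by exact: bm_mix.
have bFj : bmeas Fj by exact: bm_mix.
have bFe : bmeas Fe by exact: bm_e.
have -> : Ex P (fun w => F (e w) * (F (e w) - F (mix (mem (j :: s)) (e w) (e' w)))) =
  Ex P (fun w => Fe w * (Fe w - A w)) + Ex P (fun w => Fe w * (A w - B w)).
  by rewrite -ExD; [apply: eq_Ex => w; rewrite -mulrDr addrA subrK|bm..].
rewrite big_cons mulrDr addrC lerD//; last exact: IH.
have sw : Ex P (fun w => Fe w * (A w - B w)) = Ex P (fun w => Fj w * (B w - A w)).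
  pose H (z : conf R I * conf R I) := F z.1 *
     (F (mix (mem s) z.1 z.2) - F (mix (mem (j :: s)) z.1 z.2)).
  have bH : bmeas H by rewrite /H; bm; try exact: bm_fst; exact: bm_pmix.
  rewrite -(Exmix (pred1 j) bH) /H/=; apply: eq_Ex => w; congr (F _ * (F _ - F _)).
    apply/funext => i; rewrite /mix /= inE; case: eqVneq => [->|//].
    by rewrite (negbTE js).
  apply/funext => i; rewrite /mix /= inE; case: eqVneq => [->|//].
  by rewrite (negbTE js).
have -> : Ex P (fun w => Fe w * (A w - B w)) =
    2^-1 * Ex P (fun w => (Fe w - Fj w) * (A w - B w)).
  have -> : Ex P (fun w => (Fe w - Fj w) * (A w - B w)) =
      Ex P (fun w => Fe w * (A w - B w)) + Ex P (fun w => Fj w * (B w - A w)).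
    by rewrite -ExD; [apply: eq_Ex => w; ring|bm..].
  by rewrite -sw; lra.
rewrite ler_wpM2l ?invr_ge0//.
(* AM-GM, both squares having the same expectation *)
have st : L2 P (fun w => A w - B w) = L2 P (fun w => Fe w - Fj w) := L2_mix_step js.
have -> : L2 P (fun w => F (e w) - F (mix (pred1 j) (e w) (e' w))) ^+ 2 =
  2^-1 * Ex P (fun w => (Fe w - Fj w) ^+ 2) + 2^-1 * Ex P (fun w => (A w - B w) ^+ 2).
  by rewrite -!L2_sqr st /Fe /Fj; lra.
rewrite -!ExZl -?ExD; [|bm..].
apply: Ex_le; [bm..|] => w.
have := sqr_ge0 ((Fe w - Fj w) - (A w - B w)); nra.
Qed.

End efron_stein.

(** * Passage to infinitely many coordinates *)

Section exhaustion.
Variable bx : nat -> seq I.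
Hypothesis bx_uniq : forall N, uniq (bx N).
Hypothesis bx_mono : forall N M j, (N <= M)%N -> j \in bx N -> j \in bx M.
Hypothesis bx_exh : forall j, exists N, j \in bx N.

Let out N : pred I := fun j => j \notin bx N.

Let dist (F : conf R I -> R) N :=
  Ex P (fun w => `|F (e w) - F (mix (out N) (e w) (e' w))|).

Let dist_ge0 F N : 0 <= dist F N.
Proof. exact: Ex_ge0. Qed.

Let bm_dist (F : conf R I -> R) N : bmeas F ->
  bmeas (fun w => `|F (e w) - F (mix (out N) (e w) (e' w))|).
Proof. by move=> bF; bm; [exact: bm_e|exact: bm_mix]. Qed.

Let bm_indic (A : set (conf R I)) : measurable A -> bmeas (\1_A : conf R I -> R).
Proof.
move=> mA; split; first exact: measurable_indic.
by exists 1 => x; rewrite indicE; case: (_ \in _); rewrite ?normr0 ?normr1.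
Qed.

(** The sets whose indicator is asymptotically insensitive to resampling outside [bx N] form a
    sigma-algebra. It contains the cylinders, whose coordinate ends up inside [bx N]. *)
Let dist_indic_cvg (A : set (conf R I)) : measurable A ->
  dist (\1_A) N @[N --> \oo] --> 0.
Proof.
pose C := [set A : set (conf R I) | measurable A /\ dist (\1_A) N @[N --> \oo] --> 0].
move=> mA; have sC : <<s @cyls R I>> `<=` C; last by have [] := sC A mA.
apply: smallest_sub; last first.
  move=> _ [j [B mB ->]]; split.
    by apply: sub_sigma_algebra; exists j, B.
  have [N jN] := bx_exh j.
  apply: (@cvg_trans _ (0 @[_ --> \oo])); last exact: cvg_cst.
  apply: near_eq_cvg; near=> M; apply/esym.
  rewrite /dist (@eq_Ex _ _ _ P _ (fun=> 0)) ?Ex_cst// => w.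
  suff -> : \1_[set a : I -> R | B (a j)] (mix (out M) (e w) (e' w)) =
            \1_[set a : I -> R | B (a j)] (e w) :> R by rewrite subrr normr0.
  have E : mix (out M) (e w) (e' w) j = e w j.
    by rewrite /mix /out (bx_mono _ jN)//; near: M; exact: nbhs_infty_ge.
  rewrite !indicE; congr (nat_of_bool _)%:R.
  by apply/idP/idP; rewrite !inE /= E.
split.
- split=> //; apply: (@cvg_trans _ (0 @[_ --> \oo])); last exact: cvg_cst.
  apply: near_eq_cvg; near=> M; apply/esym.
  rewrite /dist (@eq_Ex _ _ _ P _ (fun=> 0)) ?Ex_cst// => w.
  by rewrite !indic0 subrr normr0.
- move=> B [mB dB]; rewrite setTD; split; first exact: measurableC.
  apply: cvg_trans dB; apply: near_eq_cvg; near=> M.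
  apply: eq_Ex => w; rewrite !indicE !in_setC.
  by do 2 case: (_ \in B); rewrite /= ?subrr ?subr0 ?sub0r ?normrN.
move=> A_ CA_; have mA_ k : measurable (A_ k : set (conf R I)) by have [] := CA_ k.
have mU : measurable (\bigcup_k A_ k : set (conf R I)) by exact: bigcupT_measurable.
split=> //; apply/cvgrPdist_lt => eta eta0.
pose B K : set (conf R I) := \big[setU/set0]_(k < K) A_ k.
have mB K : measurable (B K) by exact: bigsetU_measurable.
have PBU : (P \o (fun K => e @^-1` (B K))) K @[K --> \oo] --> P (e @^-1` (\bigcup_k A_ k)).
  have -> : e @^-1` (\bigcup_k A_ k) = \bigcup_K (e @^-1` B K).
    apply/seteqP; split=> [w [k _ Akw]|w [K _]].
      by exists k.+1 => //=; rewrite /B big_ord_recr/=; right.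
    by rewrite /= /B -bigcup_mkord => -[k /= kK Akw]; exists k.
  apply: nondecreasing_cvg_mu.
  - by move=> K; rewrite -[X in measurable X]setTI; exact: me_.
  - by apply: bigcupT_measurable => K; rewrite -[X in measurable X]setTI; exact: me_.
  - move=> m n mn; apply/subsetPset; apply: preimage_subset.
    exact: subset_bigsetU.
pose U : set (conf R I) := \bigcup_k A_ k.
pose D K (x : conf R I) : R := \1_U x - \1_(B K) x.
have bD K : bmeas (D K) by apply: bmeasB; exact: bm_indic.
have BU K : B K `<=` U by move=> x; rewrite /B -bigcup_mkord => -[k _ Ak]; exists k.
have D0 K x : 0 <= D K x.
  rewrite /D !indicE subr_ge0 ler_nat; case: (boolP (x \in B K)) => //.
  by rewrite !inE => /BU xU; rewrite mem_set.
(* A finite union carries almost all the mass. Resampling preserves the law, so the same bound on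
   [D K] serves at [e] and at the resampled configuration; with the finite sum this makes three
   quarters of [eta]. *)
have [K UK] : exists K, Ex P (fun w => D K (e w)) < eta / 4.
  have EK K : Ex P (fun w => D K (e w)) = fine (P (e @^-1` U)) - fine (P (e @^-1` B K)).
    by rewrite /D ExB; [rewrite !Ex_indic|exact/bm_e/bm_indic..].
  have : fine ((P \o (fun K => e @^-1` (B K))) K) @[K --> \oo] --> fine (P (e @^-1` U)).
    by apply: fine_cvg; rewrite fineK// fin_num_measure// -[X in measurable X]setTI; exact: me_.
  move=> /cvgrPdist_lt /(_ (eta / 4)); rewrite divr_gt0// => /(_ isT) [K _ HK].
  by exists K; rewrite EK; apply: le_lt_trans (ler_norm _) (HK K _) => /=.
have Bsum K' (x y : conf R I) :
    `|\1_(B K') x - \1_(B K') y| <= \sum_(k < K') `|\1_(A_ k) x - \1_(A_ k) y| :> R.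
  rewrite /B; elim: K' => [|K' IH].
    by rewrite !big_ord0 !indic0 subrr normr0.
  rewrite !big_ord_recr/=; set V := \big[_/_]_(k < K') _ in IH *.
  rewrite -/V; apply: le_trans (lerD IH (lexx _)).
  rewrite !indicE !in_setU.
  case: (x \in V); case: (y \in V); case: (x \in A_ K'); case: (y \in A_ K');
    rewrite /= ?subrr ?subr0 ?sub0r ?normrN ?normr0 ?normr1 ?addr0 ?add0r ?lerDl ?ler01//.
have sumcvg : (\sum_(k < K) dist (\1_(A_ k)) N) @[N --> \oo] --> 0.
  rewrite [X in _ --> X](_ : _ = \sum_(k < K) (0 : R)); last by rewrite big1.
  by apply: cvg_bigsum => k; have [] := CA_ k.
move/cvgrPdist_lt : sumcvg => /(_ (eta / 4)); rewrite divr_gt0// => /(_ isT).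
apply: filterS => N; rewrite !sub0r !normrN => HN.
rewrite ger0_norm//; apply: (@le_lt_trans _ _ (Ex P (fun w => D K (e w)) +
    Ex P (fun w => D K (mix (out N) (e w) (e' w))) + \sum_(k < K) dist (\1_(A_ k)) N)).
  rewrite -Ex_sum; last by move=> k; exact/bm_dist/bm_indic.
  rewrite -!ExD; last first.
  - exact: bm_mix.
  - exact: bm_e.
  - by apply: bmeas_sum => k; exact/bm_dist/bm_indic.
  - by apply: bmeasD; [exact: bm_e|exact: bm_mix].
  apply: Ex_le; first exact/bm_dist/bm_indic.
    apply: bmeasD; first by apply: bmeasD; [exact: bm_e|exact: bm_mix].
    by apply: bmeas_sum => k; exact/bm_dist/bm_indic.
  move=> w; apply: le_trans (lerD (lexx _) (Bsum K _ _)).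
  set x := e w; set y := mix _ _ _.
  rewrite [X in `|X|](_ : _ = (D K x - D K y) + (\1_(B K) x - \1_(B K) y)); last first.
    by rewrite /D; ring.
  apply: le_trans (ler_normD _ _) _; rewrite lerD2r.
  by apply: le_trans (ler_normB _ _) _; rewrite !ger0_norm.
rewrite Ex_mix1//; move: HN; rewrite ger0_norm ?sumr_ge0//; lra.
Unshelve. all: by end_near. Qed.

(** Takes the place of martingale convergence: a function of infinitely many coordinates is, in L1,
    almost determined by those in a large box. A uniform staircase approximation reduces it to
    indicators. *)
Lemma Ex_mix_cvg (F : conf R I -> R) : bmeas F ->
  Ex P (fun w => `|F (e w) - F (mix (out N) (e w) (e' w))|) @[N --> \oo] --> 0.
Proof.
move=> bF; have [mF [M FM]] := bF.
apply/cvgrPdist_lt => eta eta0.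
pose h := eta / 4; have h0 : 0 < h by rewrite divr_gt0.
have M0 : 0 <= M by rewrite (le_trans _ (FM point)).
(* [F + M] takes its values in [[0, 2 M]], which [K] levels of height [h] cover. *)
pose K := `|Num.ceil (2 * M / h)|%N.
have KM : 2 * M <= K%:R * h.
  rewrite -ler_pdivrMr// /K natr_absz ger0_norm ?ceil_ge// ?ceil_ge0//.
  by rewrite (lt_le_trans (ltrN10 _))// divr_ge0// ?mulr_ge0// ltW.
pose A k : set (conf R I) := [set x | k.+1%:R * h <= F x + M].
have mA k : measurable (A k).
  rewrite -[X in measurable X]setTI.
  have -> : A k = (fun x => F x + M) @^-1` `[k.+1%:R * h, +oo[%classic.
    by apply/seteqP; split=> x; rewrite /A /= in_itv/= andbT.
  by apply: (measurable_funD mF (measurable_cst M)).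
pose S (x : conf R I) := h * \sum_(k < K) \1_(A k) x.
have FS x : `|F x + M - S x| <= h.
  have t0 : 0 <= F x + M by have := FM x; rewrite ler_norml; lra.
  have tM : F x + M <= K%:R * h by have := FM x; rewrite ler_norml; lra.
  have := staircase K h0 t0; rewrite /S.
  have E k : (k.+1%:R * h <= F x + M)%R%:R = \1_(A k) x :> R.
    by rewrite indicE; congr (_%:R); congr nat_of_bool; apply/idP/idP; rewrite inE.
  under eq_bigr do rewrite E.
  by rewrite ler_norml !(le_min, ge_min) => /andP[/orP[] H1 /andP[H2 H3]]; lra.
have sumcvg : (h * \sum_(k < K) dist (\1_(A k)) N) @[N --> \oo] --> 0.
  rewrite [X in _ --> X](_ : _ = h * \sum_(k < K) (0 : R)); last by rewrite big1// mulr0.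
  by apply: cvgZr; apply: cvg_bigsum => k; exact: dist_indic_cvg.
move/cvgrPdist_lt : sumcvg => /(_ h h0); apply: filterS => N.
rewrite !sub0r !normrN => HN; rewrite ger0_norm ?Ex_ge0//.
apply: (@le_lt_trans _ _ (2 * h + h * \sum_(k < K) dist (\1_(A k)) N)).
  rewrite -Ex_sum; last by move=> k; exact/bm_dist/bm_indic.
  rewrite -ExZl; last by apply: bmeas_sum => k; exact/bm_dist/bm_indic.
  have bs : bmeas (fun w => h * \sum_(k < K)
      `|\1_(A k) (e w) - \1_(A k) (mix (out N) (e w) (e' w))|).
    by apply: bmeasM; [exact: bmeas_cst|apply: bmeas_sum => k; exact/bm_dist/bm_indic].
  rewrite -[X in X + _](Ex_cst P) -ExD//; last exact: bmeas_cst.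
  apply: Ex_le; [exact: bm_dist|by apply: bmeasD; [exact: bmeas_cst|]|].
  move=> w; set x := e w; set y := mix _ _ _.
  have SS : `|S x - S y| <= h * \sum_(k < K) `|\1_(A k) x - \1_(A k) y|.
    rewrite /S -mulrBr -sumrB normrM gtr0_norm// ler_pM2l//.
    exact: ler_norm_sum.
  rewrite (_ : F x - F y = (F x + M - S x) - (F y + M - S y) + (S x - S y)); last by ring.
  rewrite (le_trans (ler_normD _ _))// lerD// mulr_natl mulr2n.
  by rewrite (le_trans (ler_normB _ _))// lerD.
move: HN; rewrite ger0_norm; last by rewrite mulr_ge0 ?sumr_ge0// ltW.
rewrite /h; lra.
Qed.

(** For [B] with finite complement: the triangle inequality over the part of [B] in a large box, the
    rest of [B] being negligible in L1 and therefore, [F] being bounded, in L2. *)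
Lemma L2_mix_sup (B : pred I) (F : conf R I -> R) (tau : R) : bmeas F ->
  (exists N, forall j, ~~ B j -> j \in bx N) ->
  (forall s : seq I, uniq s -> all B s ->
     \sum_(j <- s) L2 P (fun w => F (e w) - F (mix (pred1 j) (e w) (e' w))) <= tau) ->
  L2 P (fun w => F (e w) - F (mix B (e w) (e' w))) <= tau.
Proof.
move=> bF [N0 HN0] Htau; have [mF [M FM]] := bF.
have M0 : 0 <= M by rewrite (le_trans _ (FM point)).
apply/ler_addgt0Pr => eta eta0.
(* The square of a difference bounded by [2 M] is at most [2 M] times its modulus; this threshold
   makes the product at most [eta ^+ 2], and the [+ 1] covers [M = 0]. *)
have := Ex_mix_cvg bF => /cvgrPdist_lt /(_ (eta ^+ 2 / (2 * M + 1))).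
have eM : 0 < eta ^+ 2 / (2 * M + 1).
  by rewrite divr_gt0 ?exprn_gt0// ltr_wpDl// mulr_ge0.
move=> /(_ eM) [N1 _ HN1].
pose N := maxn N0 N1.
have := HN1 N (leq_maxr _ _); rewrite sub0r normrN ger0_norm ?Ex_ge0// => HN.
pose s := [seq j <- bx N | B j].
have us : uniq s by exact: filter_uniq.
have aB : all B s by exact: filter_all.
rewrite (@eq_L2 _ _ _ P _ (fun w => (F (e w) - F (mix (mem s) (e w) (e' w))) +
   (F (mix (mem s) (e w) (e' w)) - F (mix B (e w) (e' w))))) => [|w]; last first.
  by congr (_ ^+ 2); ring.
apply: le_trans (L2D _ _ _) _; [by bm; [exact: bm_e|exact: bm_mix]|by bm; exact: bm_mix|].
apply: lerD; first exact: le_trans (L2_mix_le bF us) (Htau s us aB).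
rewrite -(@ler_pXn2r _ 2)// ?nnegrE ?L2_ge0 ?(ltW eta0)// L2_sqr.
pose H (z : conf R I * conf R I) := (F (mix (out N) z.1 z.2) - F z.1) ^+ 2.
have bH : bmeas H by rewrite /H; bm; [exact: bm_pmix|exact: bm_fst].
have -> : Ex P (fun w => (F (mix (mem s) (e w) (e' w)) - F (mix B (e w) (e' w))) ^+ 2) =
   Ex P (fun w => (F (mix (out N) (e w) (e' w)) - F (e w)) ^+ 2).
  (* Exchanging on [B] turns [e] into [mix B] and [mix (out N)] into [mix (mem s)], because
     everything outside [bx N] belongs to [B]. *)
  rewrite -(Exmix B bH) /H /=; apply: eq_Ex => w; congr ((F _ - _) ^+ 2).
  apply/funext => j; rewrite /mix /out /= mem_filter.
  case: (boolP (B j)) => /= Bj; first by case: (j \in bx N).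
  by rewrite (bx_mono (leq_maxl N0 N1) (HN0 _ Bj)).
apply: (@le_trans _ _ (Ex P (fun w => (2 * M) * `|F (e w) - F (mix (out N) (e w) (e' w))|))).
  apply: Ex_le; [by bm; [exact: bm_mix|exact: bm_e]|by bm; [exact: bm_e|exact: bm_mix]|].
  move=> w; rewrite -(real_normK (num_real (_ - _))) expr2 distrC ler_wpM2r//.
  by rewrite (le_trans (ler_normB _ _))// mulr_natl mulr2n lerD.
rewrite ExZl; last exact: bm_dist.
apply: (@le_trans _ _ ((2 * M) * (eta ^+ 2 / (2 * M + 1)))).
  by rewrite ler_wpM2l ?mulr_ge0// ltW.
rewrite mulrCA ger_pMr ?exprn_gt0// ler_pdivrMr ?mul1r ?lerDl//.
by rewrite ltr_wpDl// mulr_ge0.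
Qed.

(** Telescoping over [bx N] yields the variance up to [eta]: resampling a large box amounts, in L1,
    to replacing the whole configuration by the copy, and [E F(e) F(e') = m ^+ 2]. Bounding all
    finite sums by [V] stands for bounding the series. *)
Lemma efron_stein (F : conf R I -> R) (V : R) : bmeas F ->
  (forall s : seq I, uniq s -> 
     \sum_(j <- s) L2 P (fun w => F (e w) - F (mix (pred1 j) (e w) (e' w))) ^+ 2 <= V) ->
  L2 P (fun w => F (e w) - Ex P (fun w => F (e w))) ^+ 2 <= 2^-1 * V.
Proof.
move=> bF HV; have [mF [M FM]] := bF.
have M0 : 0 <= M by rewrite (le_trans _ (FM point)).
have bFe := bm_e bF.
set m := Ex P (fun w => F (e w)).
have varE : L2 P (fun w => F (e w) - m) ^+ 2 = Ex P (fun w => F (e w) * F (e w)) - m ^+ 2.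
  rewrite L2_sqr (@eq_Ex _ _ _ P _ (fun w => (F (e w) * F (e w) - 2 * m * F (e w)) + m ^+ 2)).
    by rewrite ExD ?ExB ?ExZl ?Ex_cst; [rewrite -/m; ring|bm..].
  by move=> w; ring.
rewrite varE; apply/ler_addgt0Pr => eta eta0.
have := Ex_mix_cvg bF => /cvgrPdist_lt /(_ (eta / (M + 1))).
have eM : 0 < eta / (M + 1) by rewrite divr_gt0// ltr_wpDl.
move=> /(_ eM) [N _ /(_ N (leqnn N))].
rewrite sub0r normrN ger0_norm ?Ex_ge0// => HN.
pose Fm w := F (mix (mem (bx N)) (e w) (e' w)).
have bFm : bmeas Fm by exact: bm_mix.
have bFe' : bmeas (fun w => F (e' w)) by exact: bmeas_comp.
have := Ex_mix_telescope bF (bx_uniq N).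
rewrite (@eq_Ex _ _ _ P _ (fun w => F (e w) * F (e w) - F (e w) * Fm w)) => [|w]; last by rewrite mulrBr.
rewrite ExB; [|bm..].
move=> tel.
have ind : Ex P (fun w => F (e w) * F (e' w)) = m ^+ 2.
  by rewrite (Ex_indep meps meps' copy bF bF) expr2.
have close : `|Ex P (fun w => F (e w) * F (e' w)) - Ex P (fun w => F (e w) * Fm w)| <= eta.
  rewrite -ExB; [|bm..].
  apply: le_trans (Ex_norm _ _) _; first by bm.
  pose H (z : conf R I * conf R I) := `|F z.1 - F (mix (out N) z.1 z.2)|.
  have bH : bmeas H by rewrite /H; bm; [exact: bm_fst|exact: bm_pmix].
  (* Seen from the copy, resampling [e] inside the box is resampling [e'] outside it. *)
  apply: (@le_trans _ _ (Ex P (fun w => M * H (e' w, e w)))).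
    apply: Ex_le; [by bm|apply: bmeasM; first exact: bmeas_cst|].
      apply: (bmeas_comp (th := fun w => (e' w, e w))) => //.
      exact: measurable_fun_pair.
    move=> w; rewrite -mulrBr normrM ler_pM// /H /=.
    rewrite (_ : mix (out N) _ _ = mix (mem (bx N)) (e w) (e' w))//.
    by apply/funext => j; rewrite /mix /out /=; case: (j \in bx N).
  rewrite ExZl; last first.
    apply: (bmeas_comp (th := fun w => (e' w, e w))) => //.
    exact: measurable_fun_pair.
  rewrite (Ex_swap bH) /H /=.
  apply: (@le_trans _ _ (M * (eta / (M + 1)))); first by rewrite ler_wpM2l// ltW.
  by rewrite mulrCA ger_pMr// ler_pdivrMr ?mul1r ?lerDl// ltr_wpDl.
have := HV _ (bx_uniq N); move: close; rewrite ind ler_norml.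
by set SS := \sum_(j <- bx N) _ in tel *; lra.
Qed.

End exhaustion.

(** If every frozen value of the copy gave more than [V], the outer average would be at least [V];
    hence the strict inequality in the hypothesis. *)
Lemma Ex_fubini_le (H : conf R I * conf R I -> R) (V : R) : bmeas H ->
  Ex P (fun w => H (e w, e' w)) < V ->
  exists w', Ex P (fun w => H (e w, e w')) <= V.
Proof.
move=> bH HV; apply: contrapT => /forallNP nH.
have [bF E] := Ex_fubini meps meps' copy bH.
move: HV; rewrite E; apply/negP; rewrite -leNgt -[leLHS](Ex_cst P).
apply: Ex_le => //; first exact: bmeas_cst.
by move=> w; rewrite ltW// ltNge; apply/negP/nH.
Qed.

End mixing.

(** * Stein's method for characteristic functions *)

Section trigonometric_bounds.
Context (R : realType).
Implicit Types x y : R.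

Lemma mvt_lipschitz (f df : R -> R) (c : R) :
  (forall x, is_derive x (1 : R) f (df x)) -> (forall x, `|df x| <= c) ->
  forall x y, `|f x - f y| <= c * `|x - y|.
Proof.
move=> fd fc x y.
wlog xy : x y / x < y => [H|].
  have [/H//|/H|->] := ltgtP x y; first by rewrite distrC (distrC y).
  by rewrite !subrr normr0 mulr0.
have [|z _ E] := @MVT _ f df x y xy (fun z _ => fd z).
  by apply: derivable_within_continuous => z _; exact: ex_derive.
by rewrite distrC E normrM (distrC y) ler_wpM2r.
Qed.

Lemma sin_lipschitz x y : `|sin x - sin y| <= `|x - y|.
Proof.
rewrite -[leRHS]mul1r; apply: (@mvt_lipschitz _ cos) => z.
by rewrite ler_norml cos_geN1 cos_le1.
Qed.

Lemma cos_lipschitz x y : `|cos x - cos y| <= `|x - y|.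
Proof.
rewrite -[leRHS]mul1r; apply: (@mvt_lipschitz _ (fun z => - sin z)) => z.
by rewrite normrN ler_norml sin_geN1 sin_le1.
Qed.

Lemma norm_sin_le x : `|sin x| <= `|x|.
Proof. by have := sin_lipschitz x 0; rewrite sin0 !subr0. Qed.

Lemma norm_cosB1 x : `|cos x - 1| <= x ^+ 2.
Proof.
have -> : cos x - 1 = - (2 * sin (x / 2) ^+ 2).
  rewrite [in LHS](_ : x = x / 2 + x / 2); last by lra.
  by rewrite cosD -!expr2 cos2sin2; lra.
rewrite normrN normrM normrX (@ger0_norm _ 2)//.
have := norm_sin_le (x / 2); rewrite -(@ler_pXn2r _ 2) ?nnegrE// => H.
have : `|x / 2| ^+ 2 = x ^+ 2 / 4 by rewrite real_normK ?num_real//; field.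
have := sqr_ge0 x; lra.
Qed.

Lemma norm_sinB x : `|sin x - x| <= x ^+ 2.
Proof.
wlog x0 : x / 0 < x => [H|].
  have [/H//|x0|<-] := ltgtP 0 x; last by rewrite sin0 subrr normr0 sqr_ge0.
  have := H (- x); rewrite oppr_gt0 sinN sqrrN => /(_ x0).
  by rewrite -opprD normrN.
have hd z : is_derive z (1 : R) (fun z => sin z - z) (cos z - 1) by exact: is_deriveB.
have [|z] := @MVT _ (fun z => sin z - z) (fun z => cos z - 1) 0 x x0 (fun z _ => hd z).
  by apply: derivable_within_continuous => z _; exact: ex_derive.
rewrite in_itv/= => /andP[z0 zx]; rewrite sin0 !subr0 => ->.
have : `|cos z - 1| <= z.
  by have := cos_lipschitz z 0; rewrite cos0 subr0 (gtr0_norm z0).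
rewrite normrM (gtr0_norm x0) expr2 => h; rewrite ler_wpM2r ?(ltW x0)//.
exact: le_trans h (ltW zx).
Qed.

End trigonometric_bounds.

(** With the integrating factor [expR (v l^2 / 2)] the residual [dw + l v w] becomes an exact
    derivative. The mean value theorem on [[0, 1]] then loses nothing, since the factor at an inner
    point is at most its value at 1. *)
Lemma gaussian_ode (R : realType) (w dw : R -> R) (v rho : R) : 0 <= v ->
  (forall l, is_derive l (1 : R) w (dw l)) ->
  (forall l, 0 <= l <= 1 -> `|dw l + l * v * w l| <= rho) ->
  `|w 1 - w 0 * expR (- v / 2)| <= rho.
Proof.
move=> v0 wd wrho.
pose u l := expR (v * l ^+ 2 / 2) * w l.
pose du l := expR (v * l ^+ 2 / 2) * (dw l + l * v * w l).
have ud l : is_derive l (1 : R) u (du l).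
  rewrite /u.
  have : is_derive l (1 : R) (fun l => v * l ^+ 2 / 2) (l * v).
    by apply: is_derive_eq; rewrite /GRing.scale /=; field.
  move=> H.
  have H1 : is_derive l (1 : R) (fun l => expR (v * l ^+ 2 / 2)) (expR (v * l ^+ 2 / 2) * (l * v)).
    exact: (@is_derive1_comp _ expR (fun l => v * l ^+ 2 / 2)).
  have H2 := is_deriveM H1 (wd l); apply: is_derive_eq; rewrite /du /GRing.scale /=; ring.
have [|z] := @MVT _ u du 0 1 ltr01 (fun z _ => ud z).
  by apply: derivable_within_continuous => z _; exact: ex_derive.
rewrite in_itv/= => /andP[z0 z1]; rewrite subr0 mulr1 /u /du !expr2 !mulr0 !mulr1 mul0r expR0 mul1r => E.
have e0 := expR_gt0 (v / 2).
have -> : w 1 - w 0 * expR (- v / 2) = expR (- v / 2) * (expR (v / 2) * w 1 - w 0).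
  by rewrite mulrBr mulrA -expRD mulNr addNr expR0; ring.
rewrite E !normrM !(gtr0_norm (expR_gt0 _)) mulrA -expRD.
rewrite -[leRHS]mul1r ler_pM ?expR_ge0//; last by rewrite wrho// !ltW.
rewrite -[leRHS](@expR0 R) ler_expR.
have z2 : z * z <= 1 by nra.
by nra.
Qed.

(** The weight [q] lets one statement serve both expectations, with [q = 1], and integrals against a
    normal density. The bound [|S q|] dominates the derivative uniformly in [l]. *)
Lemma is_derive_Rintegral_cos (R : realType) (disp : measure_display)
    (T : measurableType disp) (mu : {measure set T -> \bar R})
    (S q : T -> R) (beta l : R) : measurable_fun [set: T] S ->
  mu.-integrable [set: T] (EFin \o q) ->
  mu.-integrable [set: T] (EFin \o (fun w => S w * q w)) ->
  (forall w, 0 <= q w) ->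
  is_derive l (1 : R)
    (fun l => Rintegral mu [set: T] (fun w => cos (l * S w + beta) * q w))
    (Rintegral mu [set: T] (fun w => - (S w * sin (l * S w + beta) * q w))).
Proof.
move=> mS iq iSq q0.
pose f (l : R) w := cos (l * S w + beta) * q w.
have mq : measurable_fun [set: T] q by apply/measurable_EFinP; exact: measurable_int iq.
have df (l' : R) w : is_derive l' (1 : R) (f ^~ w) (- (S w * sin (l' * S w + beta) * q w)).
  have H : is_derive l' (1 : R) (fun l => l * S w + beta) (S w).
    by apply: is_derive_eq; rewrite /GRing.scale /=; ring.
  have H2 := @is_derive1_comp _ cos (fun l => l * S w + beta) l' _ _ (is_derive_cos _) H.
  have := is_deriveM H2 (is_derive_cst (q w) l' 1).
  move=> H3; apply: is_derive_eq; rewrite /GRing.scale /=; ring.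
have d1f (l' : R) w : partial1of2 f l' w = - (S w * sin (l' * S w + beta) * q w).
  by rewrite partial1of2E; apply: derive_val.
have la : [set` `](l - 1), (l + 1)[] l.
  by rewrite /= in_itv/=; apply/andP; split; lra.
have mlin (l' : R) : measurable_fun [set: T] (fun w => l' * S w + beta).
  by apply: measurable_funD => //; exact: measurable_funM.
have intf (l' : R) : [set` `](l - 1), (l + 1)[] l' -> mu.-integrable setT (EFin \o f l').
  move=> _; apply: (le_integrable measurableT _ _ iq).
    by apply/measurable_EFinP/measurable_funM => //; exact: (bmeas_cos (mlin l')).1.
  move=> w _ /=; rewrite lee_fin normrM ler_piMl//.
  by rewrite ler_norml cos_geN1 cos_le1.
have derf (l' : R) w : [set` `](l - 1), (l + 1)[] l' -> setT w -> derivable (f ^~ w) l' 1.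
  by move=> _ _; exact: ex_derive.
have G0 w : 0 <= `|S w * q w| by [].
have Gub (l' : R) w : [set` `](l - 1), (l + 1)[] l' -> setT w ->
    `|partial1of2 f l' w| <= `|S w * q w|.
  move=> _ _; rewrite d1f normrN !normrM ler_wpM2r// ler_piMr//.
  by rewrite ler_norml sin_geN1 sin_le1.
have intG : mu.-integrable setT (EFin \o (fun w => `|S w * q w|)).
  exact: integrable_norm iSq.
apply: DeriveDef.
  exact: (derivable_under_integral measurableT la intf derf G0 intG Gub).
rewrite -derive1E.
have -> := differentiation_under_integral measurableT la intf derf G0 intG Gub.
by apply: eq_Rintegral => w _; rewrite d1f.
Qed.

(** * Sums with dependency neighbourhoods *)

Section stein_method.
Context (R : realType) (disp : measure_display) (T : measurableType disp).
Variable P : probability T R.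

Lemma is_derive_Ex_cos (S : T -> R) (beta l : R) : bmeas S ->
  is_derive l (1 : R) (fun l => Ex P (fun w => cos (l * S w + beta)))
    (- Ex P (fun w => S w * sin (l * S w + beta))).
Proof.
move=> bS; have i1 : P.-integrable [set: T] (EFin \o (fun=> 1)).
  exact/bmeas_integrable/bmeas_cst.
have iS : P.-integrable [set: T] (EFin \o (fun w => S w * 1)).
  by under eq_fun do rewrite mulr1; exact: bmeas_integrable.
have := is_derive_Rintegral_cos beta l bS.1 i1 iS (fun=> ler01).
rewrite -ExN; last by apply: bmeasM => //; apply: bmeas_sin; exact: (bmeasD (bmeasM (bmeas_cst _ l) bS) (bmeas_cst _ beta)).1.
under [X in is_derive _ _ _ X]eq_Rintegral do rewrite mulr1.
by under [X in is_derive _ _ X _]eq_fun do under eq_Rintegral do rewrite mulr1.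
Qed.

(** Test functions such as [y * sin (l * y)] or the identity are unbounded on the line, but bounded
    on the range of a bounded variable. *)
Definition locally_bounded (u : R -> R) :=
  measurable_fun [set: R] u /\
  forall M : R, exists M', forall x, `|x| <= M -> `|u x| <= M'.

Lemma bmeas_locally_bounded (d : measure_display) (S : measurableType d)
    (u : R -> R) (F : S -> R) :
  locally_bounded u -> bmeas F -> bmeas (fun s => u (F s)).
Proof.
move=> [mu ub] [mF [M FM]]; split; first exact: measurableT_comp.
by have [M' uM] := ub M; exists M' => s; exact: uM.
Qed.

Variables (I : eqType) (L : seq I) (nb : rel I) (Y : I -> T -> R).
Hypothesis uL : uniq L.
Hypothesis nbxx : forall i, nb i i.
Hypothesis bY : forall i, bmeas (Y i).
Hypothesis EY0 : forall i, Ex P (Y i) = 0.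
Let S w := \sum_(i <- L) Y i w.
(** The part of the sum that [indep] makes independent of [Y i]; [V i] is the rest of the
    neighbourhood of [i]. *)
Let U i w := \sum_(j <- L | ~~ nb i j) Y j w.
Let V i w := \sum_(j <- L | nb i j && (j != i)) Y j w.
Hypothesis indep : forall i (u v : R -> R), i \in L ->
  locally_bounded u -> locally_bounded v ->
  Ex P (fun w => u (Y i w) * v (U i w)) =
  Ex P (fun w => u (Y i w)) * Ex P (fun w => v (U i w)).
Variables kappa rho1 rho2 : R.
Hypothesis Ykappa : forall i w, `|Y i w| <= kappa.
Hypothesis rho1_ub : forall i, i \in L ->
  \sum_(j <- L | nb i j) Ex P (fun w => `|Y j w|) <= rho1.
Hypothesis rho2_ub : \sum_(i <- L) \sum_(j <- L | nb i j && (j != i))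
  Ex P (fun w => `|Y i w * Y j w|) <= rho2.
Let A := \sum_(i <- L) Ex P (fun w => Y i w ^+ 2).

Let bS : bmeas S. Proof. exact: bmeas_sum. Qed.
Let bU i : bmeas (U i). Proof. exact: bmeas_sum. Qed.
Let bV i : bmeas (V i). Proof. exact: bmeas_sum. Qed.

Let A0 : 0 <= A.
Proof. by apply: sumr_ge0 => i _; apply: Ex_ge0 => w; exact: sqr_ge0. Qed.

Let big_nbD1 i (F : I -> R) : i \in L -> \sum_(j <- L | nb i j) F j =
  F i + \sum_(j <- L | nb i j && (j != i)) F j.
Proof.
move=> iL; rewrite (bigID (pred1 i))/=; congr (_ + _).
rewrite big_mkcond (bigD1_seq i)//= eqxx nbxx big1 ?addr0// => j /negbTE ->.
by rewrite andbF.
Qed.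

Let SE i w : i \in L -> S w = U i w + Y i w + V i w.
Proof.
move=> iL; rewrite /S /U /V (bigID (nb i))/= addrC -addrA; congr (_ + _).
by rewrite big_nbD1.
Qed.

Let YVsum i : Ex P (fun w => `|Y i w * V i w|) <=
  \sum_(j <- L | nb i j && (j != i)) Ex P (fun w => `|Y i w * Y j w|).
Proof.
rewrite -Ex_sum; last by move=> j; bm.
apply: Ex_le; [by bm|by apply: bmeas_sum => j; bm|].
by move=> w; rewrite /V mulr_sumr ler_norm_sum.
Qed.

Let Vsum i : i \in L -> Ex P (fun w => `|Y i w|) + Ex P (fun w => `|V i w|) <= rho1.
Proof.
move=> iL; apply: le_trans (rho1_ub iL); rewrite big_nbD1//.
rewrite lerD2l -Ex_sum; last by move=> j; bm.
apply: Ex_le; [by bm|by apply: bmeas_sum => j; bm|].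
by move=> w; rewrite /V ler_norm_sum.
Qed.

Let lb_id : locally_bounded id.
Proof. by split=> [|M]; [exact: measurable_id|exists M]. Qed.

(** The products [Y i * U i] have mean zero by independence and centring, so only near pairs are
    left. *)
Lemma stein_second_moment : Ex P (fun w => S w ^+ 2) <= A + rho2.
Proof.
have -> : Ex P (fun w => S w ^+ 2) = \sum_(i <- L) Ex P (fun w => Y i w * S w).
  rewrite -Ex_sum; last by move=> i; bm.
  by apply: eq_Ex => w; rewrite -mulr_suml expr2.
apply: le_trans (lerD (lexx A) rho2_ub).
rewrite -big_split /=; rewrite big_seq [leRHS]big_seq; apply: ler_sum => i iL.
have -> : Ex P (fun w => Y i w * S w) = Ex P (fun w => Y i w * U i w) +
    (Ex P (fun w => Y i w ^+ 2) + Ex P (fun w => Y i w * V i w)).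
  by rewrite -!ExD; [apply: eq_Ex => w; rewrite (SE w iL); ring|bm..].
rewrite (indep iL lb_id lb_id) EY0 mul0r add0r lerD2l.
apply: le_trans (YVsum i); apply: le_trans (ler_norm _) (Ex_norm _ _); bm.
Qed.

Let mlin (l beta : R) (F : T -> R) : bmeas F ->
  measurable_fun [set: T] (fun w => l * F w + beta).
Proof. by move=> bF; apply: (proj1 (_ : bmeas (fun w => l * F w + beta))); bm. Qed.

Let bsin (l beta : R) (F : T -> R) : bmeas F -> bmeas (fun w => sin (l * F w + beta)).
Proof. by move=> bF; apply/bmeas_sin/mlin. Qed.
Let bcos (l beta : R) (F : T -> R) : bmeas F -> bmeas (fun w => cos (l * F w + beta)).
Proof. by move=> bF; apply/bmeas_cos/mlin. Qed.
Let bsin0 (l : R) (F : T -> R) : bmeas F -> bmeas (fun w => sin (l * F w)).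
Proof. by move=> bF; apply: bmeas_sin; exact: measurable_funM (measurable_cst _) bF.1. Qed.
Let bcos0 (l : R) (F : T -> R) : bmeas F -> bmeas (fun w => cos (l * F w)).
Proof. by move=> bF; apply: bmeas_cos; exact: measurable_funM (measurable_cst _) bF.1. Qed.

Let lb_bm (u : R -> R) : bmeas u -> locally_bounded u.
Proof. by move=> [mu [M uM]]; split=> // N; exists M. Qed.

Let lb_mulid (u : R -> R) : bmeas u -> locally_bounded (fun x => x * u x).
Proof.
move=> [mu [M uM]]; split=> [|N]; first exact: measurable_funM.
by exists (N * M) => x xN; rewrite normrM ler_pM.
Qed.

Let lin_bcos (l beta : R) : bmeas (fun x : R => cos (l * x + beta)).
Proof.
apply: bmeas_cos; apply: measurable_funD => //; apply: measurable_funM => //.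
Qed.
Let lin_bsin (l beta : R) : bmeas (fun x : R => sin (l * x + beta)).
Proof.
apply: bmeas_sin; apply: measurable_funD => //; apply: measurable_funM => //.
Qed.

(** Dropping [V i] from the sine costs [E |Y i V i|]. The addition formula and independence then
    separate [Y i] from [U i]; replacing [sin (l Y)] by [l Y] and [cos (l Y)] by 1 costs [kappa y2]
    each, and going back from [U i] to [S] in the cosine costs [y2 * rho1]. *)
Let stein_term (l beta : R) i : 0 <= l <= 1 -> i \in L ->
  `|Ex P (fun w => Y i w * sin (l * S w + beta)) -
    l * Ex P (fun w => Y i w ^+ 2) * Ex P (fun w => cos (l * S w + beta))| <=
  Ex P (fun w => `|Y i w * V i w|) + Ex P (fun w => Y i w ^+ 2) * (2 * kappa + rho1).
Proof.
move=> /andP[l0 l1] iL.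
set y2 := Ex P (fun w => Y i w ^+ 2).
have y20 : 0 <= y2 by apply: Ex_ge0 => w; exact: sqr_ge0.
have kappa0 : 0 <= kappa by apply: le_trans (Ykappa i point); exact: normr_ge0.
set w0 := Ex P (fun w => cos (l * S w + beta)).
pose UY w := U i w + Y i w.
have bUY : bmeas UY by rewrite /UY; bm.
set cU := Ex P (fun w => cos (l * U i w + beta)).
set sU := Ex P (fun w => sin (l * U i w + beta)).
set ys := Ex P (fun w => Y i w * sin (l * Y i w)).
set yc := Ex P (fun w => Y i w * cos (l * Y i w)).
have bYY : bmeas (Y i) := bY i.
have bUU : bmeas (U i) := bU i.
have bVV : bmeas (V i) := bV i.
have step1 : `|Ex P (fun w => Y i w * sin (l * S w + beta)) -
    Ex P (fun w => Y i w * sin (l * UY w + beta))| <= Ex P (fun w => `|Y i w * V i w|).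
  rewrite -ExB; [|by bm; exact: bsin..].
  apply: le_trans (Ex_norm _ _) _; first by bm; exact: bsin.
  apply: Ex_le; [by bm; exact: bsin|by bm|] => w.
  rewrite -mulrBr !normrM ler_wpM2l// (le_trans (sin_lipschitz _ _))//.
  rewrite (SE w iL) (_ : _ - _ = l * V i w); last by rewrite /UY; ring.
  by rewrite normrM (ger0_norm l0) ler_piMl.
have step2 : Ex P (fun w => Y i w * sin (l * UY w + beta)) = ys * cU + yc * sU.
  have -> : ys * cU = Ex P (fun w => (Y i w * sin (l * Y i w)) * cos (l * U i w + beta)).
    rewrite (indep (u := fun y => y * sin (l * y)) (v := fun u => cos (l * u + beta)))//.
      by apply: lb_mulid; have := lin_bsin l 0; under eq_fun do rewrite addr0.
    exact: lb_bm.
  have -> : yc * sU = Ex P (fun w => (Y i w * cos (l * Y i w)) * sin (l * U i w + beta)).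
    rewrite (indep (u := fun y => y * cos (l * y)) (v := fun u => sin (l * u + beta)))//.
      by apply: lb_mulid; have := lin_bcos l 0; under eq_fun do rewrite addr0.
    exact: lb_bm.
  rewrite -ExD; [|by bm; try exact: bsin; try exact: bcos; try exact: bsin0; exact: bcos0..].
  apply: eq_Ex => w; rewrite (_ : l * UY w + beta = l * Y i w + (l * U i w + beta)).
    by rewrite sinD; ring.
  by rewrite /UY; ring.
have hys : `|ys - l * y2| <= kappa * y2.
  rewrite -ExZl; last by bm.
  rewrite -ExB; [|by bm; exact: bsin0..].
  apply: le_trans (Ex_norm _ _) _; first by bm; exact: bsin0.
  rewrite -ExZl; last by bm.
  apply: Ex_le; [by bm; exact: bsin0|by bm|] => w.
  rewrite (_ : _ - _ = Y i w * (sin (l * Y i w) - l * Y i w)); last by ring.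
  rewrite normrM ler_pM// (le_trans (norm_sinB _))// exprMn.
  by rewrite ler_piMl ?sqr_ge0 ?exprn_ile1.
(* Centring removes the first-order term, leaving [cos (l Y) - 1]. *)
have hyc : `|yc| <= kappa * y2.
  have -> : yc = Ex P (fun w => Y i w * (cos (l * Y i w) - 1)).
    rewrite -[LHS]subr0 -(EY0 i) -ExB; [|by bm; exact: bcos0..].
    by apply: eq_Ex => w; ring.
  apply: le_trans (Ex_norm _ _) _; first by bm; exact: bcos0.
  rewrite -ExZl; last by bm.
  apply: Ex_le; [by bm; exact: bcos0|by bm|] => w.
  rewrite normrM ler_pM// (le_trans (norm_cosB1 _))// exprMn.
  by rewrite ler_piMl ?sqr_ge0 ?exprn_ile1.
have hcU : `|cU - w0| <= rho1.
  rewrite -ExB; [|by exact: bcos..].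
  apply: le_trans (Ex_norm _ _) _; first by bm; exact: bcos.
  apply: le_trans (Vsum iL); rewrite -ExD; [|by bm..].
  apply: Ex_le; [by bm; exact: bcos|by bm|] => w.
  rewrite (le_trans (cos_lipschitz _ _))//.
  rewrite (SE w iL) (_ : _ - _ = - (l * (Y i w + V i w))); last by ring.
  rewrite normrN normrM ger0_norm// (le_trans (ler_piMl _ _))// ?ler_normD//.
have hcU1 : `|cU| <= 1.
  apply: le_trans (Ex_norm _ _) _; first exact: bcos.
  apply: Ex_le_cst => [|w]; first by bm; exact: bcos.
  by rewrite ler_norml cos_geN1 cos_le1.
have hsU1 : `|sU| <= 1.
  apply: le_trans (Ex_norm _ _) _; first exact: bsin.
  apply: Ex_le_cst => [|w]; first by bm; exact: bsin.
  by rewrite ler_norml sin_geN1 sin_le1.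
have -> : Ex P (fun w => Y i w * sin (l * S w + beta)) - l * y2 * w0 =
  (Ex P (fun w => Y i w * sin (l * S w + beta)) -
    Ex P (fun w => Y i w * sin (l * UY w + beta))) +
  ((ys - l * y2) * cU + yc * sU + l * y2 * (cU - w0)).
  by rewrite step2; ring.
apply: le_trans (ler_normD _ _) _; rewrite lerD//.
apply: le_trans (ler_normD _ _) _.
apply: le_trans (lerD (ler_normD _ _) (lexx _)) _; rewrite !normrM.
have h1 : `|ys - l * y2| * `|cU| <= kappa * y2 by rewrite -[leRHS]mulr1 ler_pM.
have h2 : `|yc| * `|sU| <= kappa * y2 by rewrite -[leRHS]mulr1 ler_pM.
have h3 : `|l| * `|y2| * `|cU - w0| <= y2 * rho1.
  by rewrite (ger0_norm l0) (ger0_norm y20) ler_pM ?mulr_ge0// ler_piMl.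
by lra.
Qed.

(* The derivative of E cos(l S + beta) in l is - sum_i E Y_i sin(l S + beta);
   expand S = U_i + Y_i + V_i to second order, Y_i being independent of U_i. *)
Lemma stein_cf (beta : R) :
  `|Ex P (fun w => cos (S w + beta)) - cos beta * expR (- A / 2)| <=
  rho2 + A * (2 * kappa + rho1).
Proof.
have ode := @gaussian_ode R _ _ A (rho2 + A * (2 * kappa + rho1)) A0
  (fun l => is_derive_Ex_cos beta l bS).
have -> : cos beta = Ex P (fun w => cos (0 * S w + beta)).
  by under eq_Ex do rewrite mul0r add0r; rewrite Ex_cst.
under eq_Ex do rewrite -{1}[S _]mul1r.
apply: ode => l l01.
rewrite -normrN opprD opprK.
have -> : Ex P (fun w => S w * sin (l * S w + beta)) =
    \sum_(i <- L) Ex P (fun w => Y i w * sin (l * S w + beta)).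
  rewrite -Ex_sum; last by move=> i; bm; exact: bsin.
  by apply: eq_Ex => w; rewrite -mulr_suml.
have -> : l * A * Ex P (fun w => cos (l * S w + beta)) = \sum_(i <- L)
   l * Ex P (fun w => Y i w ^+ 2) * Ex P (fun w => cos (l * S w + beta)).
  by rewrite -mulr_suml -mulr_sumr.
rewrite -sumrB; apply: le_trans (ler_norm_sum _ _ _) _.
rewrite /A mulr_suml; apply: le_trans (lerD rho2_ub (lexx _)); rewrite -big_split/=.
rewrite big_seq [leRHS]big_seq; apply: ler_sum => i iL.
by apply: le_trans (stein_term beta l01 iL) _; rewrite lerD2r.
Qed.

End stein_method.

(** * Characteristic functions and convergence in law *)

Section trig_functions.
Context (R : realType) (k : nat).
Implicit Types (a z : 'cV[R]_k) (t : 'cV[R]_k -> R).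

Definition dot a z : R := (a^T *m z) ord0 ord0.

Lemma dotE a z : dot a z = \sum_l a l ord0 * z l ord0.
Proof. by rewrite /dot mxE; apply: eq_bigr => l _; rewrite mxE. Qed.

Lemma dotDl a a' z : dot (a + a') z = dot a z + dot a' z.
Proof. by rewrite /dot raddfD/= mulmxDl mxE. Qed.

Lemma dotBl a a' z : dot (a - a') z = dot a z - dot a' z.
Proof. by rewrite /dot raddfB/= mulmxBl !mxE. Qed.

Lemma dotZl (c : R) a z : dot (c *: a) z = c * dot a z.
Proof. by rewrite !dotE mulr_sumr; apply: eq_bigr => l _; rewrite mxE mulrA. Qed.

(** Real trigonometric polynomials with arbitrary frequencies. The phases replace sine terms, which
    is why every statement on characteristic functions below carries a phase. *)
Definition trig t := exists r : seq (R * 'cV[R]_k * R), forall z,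
  t z = \sum_(x <- r) x.1.1 * cos (dot x.1.2 z + x.2).

Lemma eq_trig t t' : (forall z, t z = t' z) -> trig t -> trig t'.
Proof. by move=> tt' [r tr]; exists r => z; rewrite -tt'. Qed.

Lemma trig_cos a (b : R) : trig (fun z => cos (dot a z + b)).
Proof. by exists [:: (1, a, b)] => z; rewrite big_seq1/= mul1r. Qed.

Lemma trigD t t' : trig t -> trig t' -> trig (fun z => t z + t' z).
Proof. by move=> [r tr] [r' tr']; exists (r ++ r') => z; rewrite big_cat/= tr tr'. Qed.

Lemma trigZ (c : R) t : trig t -> trig (fun z => c * t z).
Proof.
move=> [r tr]; exists [seq (c * x.1.1, x.1.2, x.2) | x <- r] => z.
by rewrite tr mulr_sumr big_map; apply: eq_bigr => x _; rewrite /= mulrA.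
Qed.

Lemma trig_cst (c : R) : trig (fun=> c).
Proof.
apply: (@eq_trig (fun z => c * cos (dot 0 z + 0))); last exact/trigZ/trig_cos.
by move=> z; rewrite addr0 dotE big1 ?cos0 ?mulr1// => l _; rewrite mxE mul0r.
Qed.

Lemma trig_sum I (r : seq I) (F : I -> 'cV[R]_k -> R) : (forall i, trig (F i)) ->
  trig (fun z => \sum_(i <- r) F i z).
Proof.
move=> tF; elim: r => [|i r IH].
  by apply: eq_trig (trig_cst 0) => z; rewrite big_nil.
by apply: eq_trig (trigD (tF i) IH) => z; rewrite big_cons.
Qed.

Lemma trigM t t' : trig t -> trig t' -> trig (fun z => t z * t' z).
Proof.
move=> [r tr] [r' tr'].
apply: (@eq_trig (fun z => \sum_(x <- r) \sum_(y <- r')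
    (x.1.1 * y.1.1 / 2) * (cos (dot (x.1.2 + y.1.2) z + (x.2 + y.2)) +
      cos (dot (x.1.2 - y.1.2) z + (x.2 - y.2))))) => [z|].
  rewrite tr tr' mulr_suml; apply: eq_bigr => x _; rewrite mulr_sumr.
  apply: eq_bigr => y _; rewrite dotDl dotBl.
  set A := dot x.1.2 z + x.2; set B := dot y.1.2 z + y.2.
  rewrite (_ : _ + (x.2 + y.2) = A + B); last by rewrite /A /B; ring.
  rewrite (_ : _ + (x.2 - y.2) = A - B); last by rewrite /A /B; ring.
  by rewrite cosD cosB; field.
apply: trig_sum => x; apply: trig_sum => y; apply: trigZ.
by apply: trigD; exact: trig_cos.
Qed.

Lemma trig_prod I (r : seq I) (F : I -> 'cV[R]_k -> R) : (forall i, trig (F i)) ->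
  trig (fun z => \prod_(i <- r) F i z).
Proof.
move=> tF; elim: r => [|i r IH].
  by apply: eq_trig (trig_cst 1) => z; rewrite big_nil.
by apply: eq_trig (trigM (tF i) IH) => z; rewrite big_cons.
Qed.

Lemma trig_sin_coord (c : R) (l : 'I_k) : trig (fun z => sin (c * z l ord0)).
Proof.
apply: eq_trig (trig_cos (c *: delta_mx l ord0) (- (pi / 2))) => z.
rewrite dotZl dotE (bigD1 l)//= big1 => [|i /negbTE il]; last first.
  by rewrite mxE il mul0r.
by rewrite mxE !eqxx mul1r addr0 cosB cos_pihalf sin_pihalf mulr0 mulr1 add0r.
Qed.

End trig_functions.

(** * Bernstein weights *)

Section bernstein.
Context (R : realType).
Implicit Types (u c : R) (f : nat -> R).

(* the weights of the binomial distribution, generated by Pascal's rule *)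
Fixpoint bern (N j : nat) u : R :=
  match N, j with
  | 0, _ => (j == 0)%:R
  | N.+1, 0 => (1 - u) * bern N 0 u
  | N.+1, j.+1 => u * bern N j u + (1 - u) * bern N j.+1 u
  end.

Lemma bern_ge0 N j u : 0 <= u <= 1 -> 0 <= bern N j u.
Proof.
move=> /andP[u0 u1]; elim: N j => [|N IH] [|j]//=.
  by rewrite mulr_ge0// subr_ge0.
by rewrite addr_ge0// mulr_ge0// subr_ge0.
Qed.

Lemma bern_out N j u : (N < j)%N -> bern N j u = 0.
Proof.
elim: N j => [|N IH] [|j]//= Nj.
by rewrite !IH ?mulr0 ?addr0// ltnW.
Qed.

Lemma bern_sumS N u f : \sum_(j < N.+2) bern N.+1 j u * f j =
  u * (\sum_(j < N.+1) bern N j u * f j.+1) +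
  (1 - u) * (\sum_(j < N.+1) bern N j u * f j).
Proof.
rewrite big_ord_recl /= -/bern.
have -> : \sum_(j < N.+1) bern N j u * f j = \sum_(j < N.+2) bern N j u * f j.
  by rewrite [RHS]big_ord_recr/= bern_out// mul0r addr0.
have -> : \sum_(j < N.+2) bern N j u * f j =
    bern N 0 u * f 0%N + \sum_(j < N.+1) bern N j.+1 u * f j.+1.
  by rewrite big_ord_recl.
have -> : \sum_(i < N.+1) (u * bern N (0 + i) u + (1 - u) * bern N (0 + i).+1 u)
      * f (bump 0 i) =
    u * (\sum_(j < N.+1) bern N j u * f j.+1) +
    (1 - u) * (\sum_(j < N.+1) bern N j.+1 u * f j.+1).
  by rewrite !mulr_sumr -big_split/=; apply: eq_bigr => j _; rewrite /bump /= add1n add0n; ring.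
ring.
Qed.

Lemma bern_sum1 N u : \sum_(j < N.+1) bern N j u = 1.
Proof.
elim: N => [|N IH]; first by rewrite big_ord1.
have := bern_sumS N u (fun=> 1).
by under eq_bigr do rewrite mulr1; under [X in u * X]eq_bigr do rewrite mulr1;
  under [X in (1 - u) * X]eq_bigr do rewrite mulr1; rewrite IH => ->; ring.
Qed.

(** Pascal's rule shifts the centre by one, so the induction needs the second moment about every [c]
    and not only about [N u]. *)
Lemma bern_var N u c :
  \sum_(j < N.+1) bern N j u * (j%:R - c) ^+ 2 = (N%:R * u - c) ^+ 2 + N%:R * (u * (1 - u)).
Proof.
elim: N c => [|N IH] c; first by rewrite big_ord1 /=; ring.
rewrite (bern_sumS N u (fun j => (j%:R - c) ^+ 2)) IH.
have -> : \sum_(j < N.+1) bern N j u * (j.+1%:R - c) ^+ 2 =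
    \sum_(j < N.+1) bern N j u * (j%:R - (c - 1)) ^+ 2.
  by apply: eq_bigr => j _; congr (_ * _ ^+ 2); rewrite -natr1; ring.
by rewrite IH -natr1; ring.
Qed.

Lemma trig_bern k N j (u : 'cV[R]_k -> R) : trig u -> trig (fun z => bern N j (u z)).
Proof.
move=> tu; have tu' : trig (fun z => 1 - u z).
  apply: eq_trig (trigD (trig_cst _ 1) (trigZ (-1) tu)) => z.
  by rewrite mulN1r.
elim: N j => [|N IH] [|j] /=; try exact: trig_cst.
- exact: trigM.
- by apply: trigD; exact: trigM.
Qed.

End bernstein.

Section arcsine.
Context (R : realType).

(** [4 / 3] is the inverse of the bound [cos z >= 1 - z^2 >= 3 / 4] on [[-1/2, 1/2]]. *)
Lemma sin_expand (x y : R) : `|x| <= 1 / 2 -> `|y| <= 1 / 2 ->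
  `|x - y| <= 4 / 3 * `|sin x - sin y|.
Proof.
move=> hx hy; wlog xy : x y hx hy / x < y => [H|].
  have [xy|xy|->] := ltgtP x y; first exact: H.
    by rewrite distrC [X in 4 / 3 * X]distrC; exact: H.
  by rewrite !subrr normr0 mulr0.
have [|z zxy E] := @MVT _ sin cos x y xy (fun z _ => is_derive_sin z).
  by apply: derivable_within_continuous => z _; exact: ex_derive.
rewrite [X in _ * X]distrC E normrM [X in X <= _]distrC mulrA.
rewrite ler_peMl// mulrC.
have z2 : `|z| <= 1 / 2.
  move: zxy hx hy; rewrite in_itv/= !ler_norml => /andP[? ?] /andP[? ?] /andP[? ?].
  by apply/andP; split; lra.
have := norm_cosB1 z; have := ler_norm (cos z).
rewrite -(real_normK (num_real z)) ler_norml => h /andP[h1 h2].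
have : `|z| ^+ 2 <= 1 / 4 by have := normr_ge0 z; nra.
lra.
Qed.

(** A local arcsine by the intermediate value theorem; [3 / 8], that is [3 / 4] times [1 / 2], lies
    below [sin (1 / 2)] by the preceding expansion bound. *)
Lemma sin_onto : exists g : R -> R, forall v, `|v| <= 3 / 8 ->
  `|g v| <= 1 / 2 /\ sin (g v) = v.
Proof.
suff H v : exists y : R, `|v| <= 3 / 8 -> `|y| <= 1 / 2 /\ sin y = v.
  by have [g] := choice H; exists g.
have [hv|nh] := pselect (is_true (`|v| <= 3 / 8)); last by exists 0 => /nh.
have s2 : 3 / 8 <= sin (1 / 2 : R).
  have h12 : `|1 / 2 : R| = 1 / 2 by rewrite ger0_norm.
  have := @sin_expand (1 / 2) 0; rewrite sin0 !subr0 normr0 h12 lexx.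
  have s0 : 0 <= sin (1 / 2 : R).
    by rewrite sin_ge0_pi//; have := pi_ge2 R; rewrite ?in_itv/=; lra.
  by rewrite (ger0_norm s0) divr_ge0// => /(_ isT isT); lra.
have [|||y] := @IVT _ sin (- (1 / 2)) (1 / 2) v.
- by lra.
- by apply: derivable_within_continuous => z _; exact: ex_derive.
- by move: hv; rewrite sinN ler_norml ge_min le_max => /andP[? ?]; apply/andP; split;
    apply/orP; [left|right]; lra.
by rewrite in_itv/= => yy yv; exists y => _; rewrite ler_norml.
Qed.

End arcsine.

Lemma exists_natr_ge (R : realType) (x : R) : exists n : nat, x <= n%:R.
Proof.
exists `|Num.ceil x|%N; rewrite natr_absz; apply: le_trans (ceil_ge x) _.
by rewrite ler_int ler_norm.
Qed.

(** * Borel sets and trigonometric approximation for column vectors *)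

Section borel_cV.
Context (R : realType) (k : nat).

Lemma continuous_borel (S : ptopologicalType) (h : S -> R) : continuous h ->
  measurable_fun [set: borel S] h.
Proof.
move=> /continuousP ch; apply: (measurability _ (RGenOpens.measurableE R)).
move=> _ [_ [a [b ->] <-]]; rewrite setTI; apply: sub_sigma_algebra.
exact/ch/interval_open.
Qed.

Lemma continuous_dot (a : 'cV[R]_k) : continuous (dot a).
Proof.
move=> z; rewrite (_ : dot a = fun z => \sum_l a l ord0 * z l ord0); last first.
  by apply/funext => y; rewrite dotE.
elim: (index_enum _) => [|l r IH].
  by under eq_fun do rewrite big_nil; exact: cst_continuous.
under eq_fun do rewrite big_cons.
apply: (@continuousD _ _ _ (fun z : 'cV[R]_k => a l ord0 * z l ord0)) => //.
by apply: continuousM; [exact: cst_continuous|exact: coord_continuous].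
Qed.

(** Every open set is the countable union of the rational boxes that it contains, and preimages of
    boxes only involve coordinates. *)
Lemma measurable_borel_cV (d : measure_display) (S : measurableType d)
    (F : S -> borel 'cV[R]_k) :
  (forall l, measurable_fun [set: S] (fun s => (F s : 'cV[R]_k) l ord0)) ->
  measurable_fun [set: S] F.
Proof.
move=> mF.
have H := @measurability _ _ S (borel 'cV[R]_k) setT F (@open 'cV[R]_k) erefl.
apply: H => _ [A oA <-]; rewrite setTI.
pose box (q : 'cV[rat]_k * nat) : set 'cV[R]_k :=
  [set z | forall l, `|z l ord0 - ratr (q.1 l ord0)| < q.2.+1%:R^-1].
have mbox q : measurable (F @^-1` box q).
  have -> : F @^-1` box q = \bigcap_(l in [set: 'I_k])
      [set s | `|(F s : 'cV[R]_k) l ord0 - ratr (q.1 l ord0)| < q.2.+1%:R^-1].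
    by apply/seteqP; split=> s H; [move=> l _; exact: H|move=> l; exact: H].
  apply: fin_bigcap_measurable => // l _.
  rewrite -[X in measurable X]setTI.
  have -> : [set s | `|(F s : 'cV[R]_k) l ord0 - ratr (q.1 l ord0)| < q.2.+1%:R^-1] =
     (fun s => (F s : 'cV[R]_k) l ord0) @^-1` (ball (ratr (q.1 l ord0) : R) q.2.+1%:R^-1).
    by apply/seteqP; split=> s; rewrite /= -ball_normE/= distrC.
  by apply: mF => //; exact: measurable_ball.
have -> : F @^-1` A = \bigcup_(q in [set: 'cV[rat]_k * nat])
    (if `[< box q `<=` A >] then F @^-1` box q else set0).
  apply/seteqP; split=> [s As|s [q _]]; last first.
    by case: asboolP => // bO /bO.
  have [r /= r0 rA] := (nbhs_ballP (F s : 'cV[R]_k) A).1 (open_nbhs_nbhs (conj oA As)).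
  have [m m1] : exists m : nat, 2 * m.+1%:R^-1 <= r.
    have [m hm] := exists_natr_ge (2 / r); exists m.
    rewrite ler_pdivrMr// -ler_pdivrMl// mulrC (le_trans hm)//.
    by rewrite ler_nat.
  have m0 : 0 < m.+1%:R^-1 :> R by rewrite invr_gt0.
  have [q Hq] : exists q : 'I_k -> rat, forall l,
      `|(F s : 'cV[R]_k) l ord0 - ratr (q l)| < m.+1%:R^-1.
    suff /choice[q Hq] : forall l, exists q : rat,
      `|(F s : 'cV[R]_k) l ord0 - ratr q| < m.+1%:R^-1 by exists q.
    move=> l; have sl : (F s : 'cV[R]_k) l ord0 < (F s : 'cV[R]_k) l ord0 + m.+1%:R^-1.
      by rewrite ltrDl.
    have [q] := rat_in_itvoo sl.
    rewrite in_itv/= => /andP[q1 q2]; exists q.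
    by rewrite ler0_norm ?subr_le0 ?(ltW q1)// opprB ltrBlDl.
  exists (\col_l q l, m) => //.
  have sb : box (\col_l q l, m) (F s) by move=> l; rewrite mxE; exact: Hq.
  rewrite asboolT// => z zb; apply: rA; split=> // l j.
  rewrite (ord1 j) -ball_normE/=; apply: lt_le_trans m1.
  have := zb l; rewrite mxE => zl.
  rewrite (_ : _ - _ = ((F s : 'cV[R]_k) l ord0 - ratr (q l)) - (z l ord0 - ratr (q l))); last by ring.
  by rewrite (le_lt_trans (ler_normB _ _))// mulr_natl mulr2n ltrD.
apply: countable_bigcupT_measurable => [|q].
  exact: countableP.
by case: asboolP.
Qed.

(** Heine's theorem with only [z] confined to the cube: the interpolation node [y] may lie slightly
    outside. *)
Lemma uniformly_continuous_cube (h : 'cV[R]_k -> R) (L eta : R) : continuous h ->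
  0 < eta -> exists2 delta, 0 < delta & forall z y : 'cV[R]_k,
    (forall l, `|z l ord0| <= L) -> (forall l, `|y l ord0 - z l ord0| < delta) ->
    `|h y - h z| <= eta.
Proof.
move=> ch eta0.
pose g (v : 'rV[R]_k) := h v^T.
have cK : compact [set v : 'rV[R]_k | forall l, `[- L, L]%classic (v ord0 l)].
  by apply: (@rV_compact R k (fun=> `[- L, L]%classic)) => l; exact: segment_compact.
pose Q (d : R) (v : 'rV[R]_k) := forall y : 'cV[R]_k,
  (forall l, `|y l ord0 - v ord0 l| < d) -> `|h y - h v^T| <= eta.
have : \forall d \near (0 : R)^'+, [set v : 'rV[R]_k | forall l, `[- L, L]%classic (v ord0 l)] `<=` Q d.
  apply: ((compact_near_coveringP _).1 cK) => v _.
  have := ch v^T; move=> /cvgrPdist_lt /(_ (eta / 2)); rewrite divr_gt0// => /(_ isT).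
  move=> /nbhs_ballP[r /= r0 Hr].
  exists (ball v (r / 2), [set d | d < r / 2]); first split => /=.
  - by apply: nbhsx_ballx; rewrite divr_gt0.
  - by apply: nbhs_right_lt; rewrite divr_gt0.
  move=> [u d] [/= [_ uv] dr] y yu.
  have H1 : `|h v^T - h u^T| < eta / 2.
    apply: Hr; split=> // l j; rewrite !mxE (ord1 j); apply: le_ball (uv _ _); lra.
  have H2 : `|h v^T - h y| < eta / 2.
    apply: Hr; split=> // l j; rewrite !mxE (ord1 j).
    have := uv ord0 l; rewrite -!ball_normE/= => H3.
    rewrite (_ : _ - _ = (v ord0 l - u ord0 l) - (y l ord0 - u ord0 l)); last by ring.
    apply: le_lt_trans (ler_normB _ _) _; have := yu l; lra.
  rewrite (_ : _ - _ = (h v^T - h u^T) - (h v^T - h y)); last by ring.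
  by apply: le_trans (ler_normB _ _) _; lra.
move=> [d /= d0 Hd]; exists (d / 2); first by rewrite divr_gt0.
move=> z y zL yz.
have := Hd (d / 2); rewrite /= sub0r normrN gtr0_norm ?divr_gt0// => /(_ _ _ z^T).
rewrite /Q trmxK; apply.
- by rewrite ltr_pdivrMr// ltr_pMr// ltr1n.
- by [].
- by move=> l; rewrite /= mxE in_itv/= -ler_norml.
- by move=> l; rewrite mxE.
Qed.

(** A product Bernstein operator. The weights [w c z] are nonnegative with sum 1 for every [z], so
    the bound [M] holds on the whole space and not only on the cube, as is needed when tails are cut
    off. On the cube the weights concentrate, by Chebyshev, on nodes near [z]. *)
Lemma trig_approx (h : 'cV[R]_k -> R) (M L eta : R) : continuous h ->
  (forall z, `|h z| <= M) -> 0 < L -> 0 < eta ->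
  exists t, [/\ trig t, forall z, `|t z| <= M & forall z : 'cV[R]_k,
    (forall l, `|z l ord0| <= L) -> `|t z - h z| <= eta].
Proof.
move=> ch hM L0 eta0.
have M0 : 0 <= M := le_trans (normr_ge0 _) (hM 0).
have eta2 : 0 < eta / 2 by rewrite divr_gt0.
have [delta delta0 Hd] := uniformly_continuous_cube L ch eta2.
have [g Hg] := sin_onto R.
(* On the cube the sine then has an argument of size at most [1 / 4]; moving its value by up to
   [1 / 8] stays within the [3 / 8] where the local arcsine [g] is available. *)
pose L' := 4 * L; have L'0 : 0 < L' by rewrite mulr_gt0.
(* A change of [dl] in the sine moves the point by at most [(4 / 3) * L' * dl], which is less than
   [delta]. *)
pose dl := Num.min (1 / 8) (delta / (2 * L')).
have dl0 : 0 < dl by rewrite lt_min !divr_gt0// mulr_gt0.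
(* Makes the Chebyshev term [2 M k / (dl^2 N)] at most [eta / 2]. *)
have [N' HN'] := exists_natr_ge (4 * M * k%:R / (dl ^+ 2 * eta)).
pose N := N'.+1.
pose s (z : 'cV[R]_k) l := sin (L'^-1 * z l ord0).
pose u z l := 2^-1 * (1 + s z l).
pose v (c : {ffun 'I_k -> 'I_N.+1}) l : R := 2 * ((c l : nat)%:R / N%:R) - 1.
(* The node whose sine coordinates are [v c]. Where [v c l] exceeds [3 / 8] in modulus [g] is
   arbitrary, and only [|h| <= M] is used there. *)
pose pt c : 'cV[R]_k := \col_l (L' * g (v c l)).
pose w (c : {ffun 'I_k -> 'I_N.+1}) z := \prod_l bern N (c l) (u z l).
pose t z := \sum_c h (pt c) * w c z.
have N0 : 0 < N%:R :> R by rewrite ltr0n.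
have u01 z l : 0 <= u z l <= 1.
  by rewrite /u /s; have := sin_geN1 (L'^-1 * z l ord0); have := sin_le1 (L'^-1 * z l ord0);
    move=> ? ?; apply/andP; split; lra.
have w0 c z : 0 <= w c z by apply: prodr_ge0 => l _; exact: bern_ge0.
have w1 z : \sum_c w c z = 1.
  rewrite /w -(bigA_distr_bigA (fun l (j : 'I_N.+1) => bern N j (u z l))).
  by apply: big1 => l _; exact: bern_sum1.
have wvar z l0 : \sum_c w c z * (v c l0 - s z l0) ^+ 2 <= N%:R^-1.
  pose F l (j : 'I_N.+1) := bern N j (u z l) *
    (if l == l0 then (2 / N%:R) ^+ 2 * (j%:R - N%:R * u z l0) ^+ 2 else 1).
  have -> : \sum_c w c z * (v c l0 - s z l0) ^+ 2 =
      \sum_(c : {ffun 'I_k -> 'I_N.+1}) \prod_l F l (c l).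
    apply: eq_bigr => c _; rewrite /F big_split/=; congr (_ * _).
    rewrite (bigD1 l0)//= eqxx big1 ?mulr1 => [|l /negbTE ->//].
    by rewrite -exprMn /v /u; congr (_ ^+ 2); field; rewrite gt_eqF.
  rewrite -(bigA_distr_bigA F) (bigD1 l0)//= [X in _ * X]big1 ?mulr1 => [|l ll0]; last first.
    by rewrite /F (negbTE ll0); under eq_bigr do rewrite mulr1; exact: bern_sum1.
  rewrite /F eqxx.
  under eq_bigr do rewrite mulrCA; rewrite -mulr_sumr bern_var subrr expr0n add0r.
  have /andP[h0 h1] := u01 z l0.
  have -> : (2 / N%:R) ^+ 2 * (N%:R * (u z l0 * (1 - u z l0))) =
     N%:R^-1 * (4 * (u z l0 * (1 - u z l0))) :> R by field; rewrite gt_eqF.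
  rewrite ger_pMr ?invr_gt0//; have := sqr_ge0 (2 * u z l0 - 1); nra.
exists t; split.
- apply: trig_sum => c; apply: trigZ; apply: trig_prod => l; apply: trig_bern.
  by apply: trigZ; apply: trigD; [exact: trig_cst|exact: trig_sin_coord].
- move=> z; apply: le_trans (ler_norm_sum _ _ _) _.
  rewrite -[M]mulr1 -(w1 z) mulr_sumr; apply: ler_sum => c _.
  by rewrite normrM (ger0_norm (w0 c z)) ler_wpM2r.
move=> z zL.
have E : t z - h z = \sum_c w c z * (h (pt c) - h z).
  have -> : h z = \sum_c h z * w c z by rewrite -mulr_sumr w1 mulr1.
  by rewrite /t -sumrB; apply: eq_bigr => c _; rewrite -mulr_sumr w1; ring.
(* Either every [v c l] is within [dl] of [s z l] and uniform continuity applies, or one coordinate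
   is off by more than [dl] and its square pays for the trivial bound [2 M]. *)
have term c : `|h (pt c) - h z| <= eta / 2 +
    (2 * M / dl ^+ 2) * \sum_l (v c l - s z l) ^+ 2.
  have S0 : 0 <= \sum_l (v c l - s z l) ^+ 2 by apply: sumr_ge0 => l _; exact: sqr_ge0.
  have K0 : 0 <= 2 * M / dl ^+ 2 by apply: divr_ge0; [exact: mulr_ge0|exact: sqr_ge0].
  have [near_|far] := pselect (forall l, `|v c l - s z l| <= dl).
    apply: le_trans (_ : eta / 2 <= _); last by rewrite lerDl mulr_ge0.
    apply: Hd => // l; rewrite mxE.
    have := near_ l; rewrite le_min => /andP[n1 n2].
    have xz : `|L'^-1 * z l ord0| <= 1 / 4.
      rewrite normrM ger0_norm ?invr_ge0 ?(ltW L'0)//.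
      rewrite ler_pdivrMl// /L'; have := zL l; lra.
    have vs : `|v c l| <= 3 / 8.
      have -> : v c l = (v c l - s z l) + s z l by rewrite subrK.
      apply: le_trans (ler_normD _ _) _.
      have := norm_sin_le (L'^-1 * z l ord0); rewrite -/(s z l); lra.
    have [g1 g2] := Hg _ vs.
    have -> : L' * g (v c l) - z l ord0 = L' * (g (v c l) - L'^-1 * z l ord0).
      by rewrite mulrBr mulrA mulfV ?gt_eqF// mul1r.
    rewrite normrM gtr0_norm//.
    have x12 : `|L'^-1 * z l ord0| <= 1 / 2 by lra.
    have := sin_expand g1 x12; rewrite g2 -/(s z l) => gx.
    rewrite mulrC -ltr_pdivlMr//.
    have : delta / (2 * L') = delta / L' / 2 by field; rewrite gt_eqF.
    have : 0 < delta / L' by rewrite divr_gt0.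
    lra.
  have [l Hl] : exists l, dl < `|v c l - s z l|.
    by move/existsNP : far => [l /negP]; rewrite -ltNge => ?; exists l.
  have hh : `|h (pt c) - h z| <= 2 * M.
    by apply: le_trans (ler_normB _ _) _; have := hM (pt c); have := hM z; lra.
  apply: (le_trans hh); apply: (@le_trans _ _ ((2 * M / dl ^+ 2) * dl ^+ 2)).
    by rewrite divfK// gt_eqF// exprn_gt0.
  apply: (@le_trans _ _ ((2 * M / dl ^+ 2) * \sum_l (v c l - s z l) ^+ 2)).
    rewrite ler_wpM2l// (bigD1 l)//= -[leLHS]addr0 lerD ?sumr_ge0//.
    rewrite -(real_normK (num_real (_ - _))) lerXn2r ?nnegrE// ltW//.
    by move=> j _; exact: sqr_ge0.
  by rewrite lerDr ltW.
rewrite E; apply: le_trans (ler_norm_sum _ _ _) _.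
apply: (@le_trans _ _ (\sum_c (w c z * (eta / 2) +
   (2 * M / dl ^+ 2) * \sum_l w c z * (v c l - s z l) ^+ 2))).
  apply: ler_sum => c _; rewrite normrM (ger0_norm (w0 c z)).
  by rewrite -mulr_sumr [X in _ <= _ + X]mulrCA -mulrDr ler_wpM2l.
rewrite big_split/= -mulr_suml w1 mul1r -mulr_sumr exchange_big/=.
apply: (@le_trans _ _ (eta / 2 + (2 * M / dl ^+ 2) * \sum_(l < k) N%:R^-1)).
  rewrite lerD2l; apply: ler_wpM2l.
    by apply: divr_ge0; [exact: mulr_ge0|exact: sqr_ge0].
  by apply: ler_sum => l _; exact: wvar.
rewrite sumr_const card_ord -mulr_natl.
have NN : 4 * M * k%:R / (dl ^+ 2 * eta) <= N%:R.
  by apply: le_trans HN' _; rewrite ler_nat leqnSn.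
have dl20 : 0 < dl ^+ 2 by rewrite exprn_gt0.
have : 2 * M / dl ^+ 2 * (k%:R / N%:R) <= eta / 2.
  rewrite ler_pdivrMr ?mulr_gt0// in NN.
  rewrite -mulrACA -invfM ler_pdivrMr ?mulr_gt0//; lra.
lra.
Qed.

End borel_cV.

Section tightness.
Context (R : realType).

Definition far k (L : R) : set 'cV[R]_k := [set z | exists l, L < `|z l ord0|].

Lemma measurable_far k L : measurable (far L : set (borel 'cV[R]_k)).
Proof.
rewrite (_ : far L = \bigcup_(l in [set: 'I_k]) [set z | L < `|z l ord0|]); last first.
  by apply/seteqP; split=> z [l]; [exists l|exists l].
apply: fin_bigcup_measurable => // l _.
rewrite [X in measurable X](_ : _ = (fun z : 'cV[R]_k => `|z l ord0|) @^-1` `]L, +oo[%classic); last first.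
  by apply/seteqP; split=> z; rewrite /= in_itv/= andbT.
rewrite -[X in measurable X]setTI; apply: continuous_borel => //.
move=> z; apply: continuous_comp; first exact: coord_continuous.
exact: norm_continuous.
Qed.

Lemma tight_single k (nu : probability (borel 'cV[R]_k) R) (eta : R) : 0 < eta -> exists2 L, 0 < L & fine (nu (far L)) <= eta.
Proof.
move=> eta0; have cap0 : \bigcap_n @far k n%:R = set0.
  apply/seteqP; split=> // z H.
  have [n Hn] := exists_natr_ge (\sum_l `|z l ord0|).
  have [l] := H n I; apply/negP; rewrite -leNgt; apply: le_trans Hn.
  by rewrite (bigD1 l)//= lerDl sumr_ge0.
have : nu (@far k n%:R) @[n --> \oo] --> nu (\bigcap_n @far k n%:R).
  apply: (@nonincreasing_cvg_mu _ _ _ nu (fun n => @far k n%:R)) => //.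
  - by rewrite (le_lt_trans (probability_le1 nu (measurable_far _)))// ltry.
  - by move=> n; exact: measurable_far.
  - by rewrite cap0; exact: measurable0.
  - move=> m n mn; apply/subsetPset => z [l zl]; exists l.
    by apply: le_lt_trans zl; rewrite ler_nat.
rewrite cap0.
rewrite measure0 => /fine_cvg/cvgrPdist_lt /(_ eta eta0) [n _ Hn].
exists n.+1%:R => //; have := Hn n.+1 (leqnSn n).
by rewrite /= sub0r normrN => /ltW; apply: le_trans; exact: ler_norm.
Qed.

End tightness.

(** * From characteristic functions to convergence in law *)

Section weak_convergence.
Context (R : realType) (disp : measure_display) (T : measurableType disp).
Variable P : probability T R.
Context (k : nat).
Variables (Z : nat -> T -> 'cV[R]_k) (nu : probability (borel 'cV[R]_k) R).
Hypothesis mZ : forall n l, measurable_fun [set: T] (fun w => Z n w l ord0).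

Let mZ' n : measurable_fun [set: T] (Z n : T -> borel 'cV[R]_k).
Proof. exact: measurable_borel_cV. Qed.

Let bm_cont (h : 'cV[R]_k -> R) : continuous h -> (exists M, forall z, `|h z| <= M) ->
  bmeas (h : borel 'cV[R]_k -> R).
Proof. by move=> ch [M hM]; split; [exact: continuous_borel|exists M]. Qed.

Lemma trig_continuous (t : 'cV[R]_k -> R) : trig t -> continuous t.
Proof.
move=> [r tr]; rewrite (_ : t = fun z => \sum_(x <- r) x.1.1 * cos (dot x.1.2 z + x.2)); last first.
  exact/funext.
elim: r {tr} => [|x r IH] z.
  by under eq_fun do rewrite big_nil; exact: cst_continuous.
under eq_fun do rewrite big_cons.
apply: (@continuousD _ _ _ (fun z : 'cV[R]_k => x.1.1 * cos (dot x.1.2 z + x.2))); last exact: IH.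
apply: continuousM; first exact: cst_continuous.
apply: continuous_comp; last exact: continuous_cos.
by apply: continuousD; [exact: continuous_dot|exact: cst_continuous].
Qed.

Lemma trig_bounded (t : 'cV[R]_k -> R) : trig t -> exists M, forall z, `|t z| <= M.
Proof.
move=> [r tr]; exists (\sum_(x <- r) `|x.1.1|) => z; rewrite tr.
apply: le_trans (ler_norm_sum _ _ _) _; apply: ler_sum => x _.
by rewrite normrM ler_piMr// ler_norml cos_geN1 cos_le1.
Qed.

Hypothesis cfZ : forall (a : 'cV[R]_k) (b : R),
  Ex P (fun w => cos (dot a (Z n w) + b)) @[n --> \oo] -->
  Ex nu (fun z => cos (dot a z + b)).

Let bcosdot (a : 'cV[R]_k) (b : R) : bmeas ((fun z => cos (dot a z + b)) : borel 'cV[R]_k -> R).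
Proof.
have tc := trig_cos a b.
by apply: bm_cont; [exact: trig_continuous|exact: trig_bounded].
Qed.

Let cvg_trig (t : 'cV[R]_k -> R) : trig t ->
  Ex P (fun w => t (Z n w)) @[n --> \oo] --> Ex nu t.
Proof.
move=> [r tr].
have -> : Ex nu t = \sum_(x <- r) x.1.1 * Ex nu (fun z => cos (dot x.1.2 z + x.2)).
  transitivity (Ex nu (fun z => \sum_(x <- r) x.1.1 * cos (dot x.1.2 z + x.2))).
    exact: eq_Ex.
  rewrite Ex_sum => [|x]; last by bm; exact: bcosdot.
  by apply: eq_bigr => x _; rewrite ExZl//; exact: bcosdot.
have -> : (fun n => Ex P (fun w => t (Z n w))) = (fun n =>
    \sum_(x <- r) x.1.1 * Ex P (fun w => cos (dot x.1.2 (Z n w) + x.2))).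
  apply/funext => n.
  have bc x : bmeas (fun w => cos (dot x.1.2 (Z n w) + x.2)).
    exact: (bmeas_comp (mZ' n) (bcosdot x.1.2 x.2)).
  transitivity (Ex P (fun w => \sum_(x <- r) x.1.1 * cos (dot x.1.2 (Z n w) + x.2))).
    by apply: eq_Ex => w; rewrite tr.
  rewrite Ex_sum => [|x]; last by bm.
  by apply: eq_bigr => x _; rewrite ExZl.
by apply: cvg_bigsum => x; apply: cvgZr; exact: cfZ.
Qed.

Hypothesis tightZ : forall eta : R, 0 < eta -> exists2 L : R, 0 < L &
  \forall n \near \oo, fine (P [set w | exists l, L < `|Z n w l ord0|]) <= eta.

(** Replace [h] by a trigonometric polynomial [t] with the same bound. They are close on a cube that
    carries most of the mass under both laws, off it they differ by at most [2 M], and the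
    expectations of [t] converge by hypothesis. *)
Lemma cf_cvg_in_law : cvg_in_law P Z nu.
Proof.
move=> h ch hb; have [M hM] := hb.
have bh : bmeas (h : borel 'cV[R]_k -> R) by exact: bm_cont.
have bhZ n : bmeas (fun w => h (Z n w)) by exact: (bmeas_comp (mZ' n) bh).
have -> : (fun n => (\int[P]_w (h (Z n w))%:E)%E) = (fun n => (Ex P (fun w => h (Z n w)))%:E).
  by apply/funext => n; rewrite EFin_Ex.
rewrite -(EFin_Ex _ bh); apply: cvg_EFin; first exact: nearW.
rewrite /comp/=; apply/cvgrPdist_le => eta eta0.
have M0 : 0 <= M := le_trans (normr_ge0 _) (hM 0).
(* A tail mass [e1] costs at most [eta / 5]. Approximation and tail take two fifths for each of the
   two laws, the convergence for [t] the last fifth. *)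
pose e1 := eta / (5 * (2 * M + 1)).
have M1 : 0 < 2 * M + 1 by rewrite ltr_wpDl// mulr_ge0.
have e10 : 0 < e1 by rewrite divr_gt0// mulr_gt0.
have [L1 L10 HL1] := tight_single nu e10.
have [L2 L20 HL2] := tightZ e10.
pose L := Num.max L1 L2.
have L0 : 0 < L by rewrite lt_max L10.
have eta5 : 0 < eta / 5 by rewrite divr_gt0.
have [t [tt tM tL]] := trig_approx ch hM L0 eta5.
have bt : bmeas (t : borel 'cV[R]_k -> R).
  by apply: bm_cont; [exact: trig_continuous|exact: trig_bounded].
have pt (z : 'cV[R]_k) : `|h z - t z| <= eta / 5 + 2 * M * \1_(@far R k L) z.
  rewrite indicE; case: (boolP (z \in far L)) => [_|]; last first.
    rewrite notin_setE => nf; rewrite mulr0 addr0 distrC; apply: tL => l.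
    by rewrite leNgt; apply/negP => zl; apply: nf; exists l.
  rewrite mulr1; apply: le_trans (ler_normB _ _) _.
  have := hM z; have := tM z; lra.
have bi : bmeas (\1_(@far R k L) : borel 'cV[R]_k -> R).
  have mL := @measurable_far R k L; split; first exact: measurable_indic.
  by exists 1 => z; rewrite indicE; case: (_ \in _); rewrite ?normr0 ?normr1.
have fs L' : L' <= L -> @far R k L `<=` far L'.
  by move=> LL z [l zl]; exists l; exact: le_lt_trans zl.
(* Over an arbitrary probability space, so that it applies to [nu] with the identity and to [P] with
   [Z n]. *)
have est (d : measure_display) (S : measurableType d) (Q : probability S R)
    (F : S -> borel 'cV[R]_k) (mF : measurable_fun [set: S] F) L' : L' <= L ->
    fine (Q (F @^-1` far L')) <= e1 ->
    `|Ex Q (fun s => h (F s)) - Ex Q (fun s => t (F s))| <= 2 / 5 * eta.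
  move=> LL HQ; rewrite -ExB; [|exact: bmeas_comp..].
  have bD : bmeas (fun s => h (F s) - t (F s)) by apply: bmeasB; exact: bmeas_comp.
  apply: le_trans (Ex_norm _ bD) _.
  apply: (@le_trans _ _ (Ex Q (fun s => eta / 5 + 2 * M * \1_(@far R k L) (F s)))).
    apply: Ex_le; first exact: bmeas_norm.
      by apply: bmeasD; [exact: bmeas_cst|apply: bmeasM; [exact: bmeas_cst|exact: (bmeas_comp mF bi)]].
    by move=> s; exact: pt.
  rewrite ExD; [|exact: bmeas_cst|by apply: bmeasM; [exact: bmeas_cst|exact: (bmeas_comp mF bi)]].
  rewrite Ex_cst ExZl; last exact: (bmeas_comp mF bi).
  rewrite (Ex_indic Q mF (@measurable_far R k L)).
  have mp L'' : measurable (F @^-1` far L'').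
    by rewrite -[X in measurable X]setTI; apply: mF => //; exact: measurable_far.
  have : fine (Q (F @^-1` far L)) <= e1.
    apply: le_trans HQ; apply: fine_le; rewrite ?fin_num_measure//.
    by apply: le_measure; rewrite ?inE//; exact: preimage_subset (fs _ LL).
  set q := fine _ => qe1.
  have : 2 * M * q <= (2 * M + 1) * e1.
    have q0 : 0 <= q by rewrite fine_ge0.
    nra.
  rewrite (_ : (2 * M + 1) * e1 = eta / 5); first lra.
  by rewrite /e1; field; rewrite gt_eqF.
have nuE := @est _ _ nu id (@measurable_id _ _ _) L1 _ HL1.
have := cvg_trig tt => /cvgrPdist_le /(_ _ eta5).
apply: filterS2 HL2 => n HL2 Ht.
have := @est _ _ P (Z n) (mZ' n) L2 _ HL2; rewrite le_max lexx orbT => /(_ isT).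
move: nuE; rewrite le_max lexx => /(_ isT).
move: Ht; rewrite !ler_norml => /andP[? ?] /andP[? ?] /andP[? ?].
by apply/andP; split; lra.
Qed.

End weak_convergence.

(** * Densities and Gaussian laws *)

Lemma integrable_scale (d : measure_display) (T : measurableType d) (R : realType)
    (mu : {measure set T -> \bar R}) (f : T -> R) (c : R) :
  mu.-integrable [set: T] (EFin \o f) ->
  mu.-integrable [set: T] (EFin \o (fun x => c * f x)).
Proof. by move=> intf; exact: (integrableZl measurableT c intf). Qed.

Section densities.
Context (d : measure_display) (T : measurableType d) (R : realType).
Variables (mu : {sigma_finite_measure set T -> \bar R}) (q : T -> R).
Hypothesis mq : measurable_fun [set: T] q.
Hypothesis q0 : forall x, 0 <= q x.

(* q is almost everywhere the Radon-Nikodym derivative *)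
Lemma ge0_integral_density (nu : {finite_measure set T -> \bar R}) (h : T -> \bar R) :
  (forall A, measurable A -> nu A = (\int[mu]_(x in A) (q x)%:E)%E) ->
  measurable_fun [set: T] h -> (forall x, 0 <= h x)%E ->
  (\int[nu]_x h x = \int[mu]_x (h x * (q x)%:E))%E.
Proof.
move=> nuq mh h0; have mqE : measurable_fun [set: T] (EFin \o q) by exact/measurable_EFinP.
have numu : nu `<< mu.
  apply/null_content_dominatesP => A mA A0; rewrite nuq//.
  by apply: null_set_integral => //; exact: measurable_funTS.
rewrite -(Radon_Nikodym_SigmaFinite.change_of_variables numu h0 measurableT mh).
have ig := Radon_Nikodym_SigmaFinite.f_integrable numu.
have mg := measurable_int _ ig.
apply: ae_eq_integral => //; try exact: emeasurable_funM.
apply: ae_eqe_mul2l; apply: integral_ae_eq => // A _ mA.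
by rewrite -nuq// -Radon_Nikodym_SigmaFinite.f_integral.
Qed.

(** Adding the bound [M] to [h] reduces the signed case to the nonnegative one. *)
Lemma Ex_density (nu : probability T R) (h : T -> R) :
  (forall A, measurable A -> nu A = (\int[mu]_(x in A) (q x)%:E)%E) ->
  bmeas h -> Ex nu h = Rintegral mu [set: T] (fun x => h x * q x).
Proof.
move=> nuq bh; have [mh [M hM]] := bh.
have mqE : measurable_fun [set: T] (EFin \o q) by exact/measurable_EFinP.
have iq : mu.-integrable [set: T] (EFin \o q).
  apply/integrableP; split=> //.
  under eq_integral do rewrite /= ger0_norm//.
  by rewrite -nuq// probability_setT ltry.
have bhM : bmeas (fun x => h x + M) by bm.
have pos x : 0 <= h x + M by have := hM x; rewrite ler_norml; lra.
have ihq : mu.-integrable [set: T] (EFin \o (fun x => h x * q x)).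
  apply: (@le_integrable _ _ _ mu _ measurableT _ (EFin \o (fun x => M * q x))).
  - by apply/measurable_EFinP; exact: measurable_funM.
  - by move=> x _ /=; rewrite lee_fin !normrM ler_wpM2r// (le_trans (hM x))// ler_norm.
  - exact: integrable_scale.
have E : Ex nu (fun x => h x + M) = Rintegral mu setT (fun x => (h x + M) * q x).
  rewrite /Ex /Rintegral (ge0_integral_density nuq) => [//| |x]; last by rewrite lee_fin.
  by apply/measurable_EFinP; exact: bhM.1.
have MqE : Rintegral mu setT (fun x => M * q x) = M.
  rewrite RintegralZl// /Rintegral -nuq// probability_setT mulr1//.
move: E; rewrite ExD ?Ex_cst; [|by bm..] => /(canRL (addrK _)) ->.
rewrite (@eq_Rintegral _ _ _ mu _ (fun x => h x * q x + M * q x)) => [|x _]; last exact: mulrDl.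
rewrite RintegralD ?MqE ?addrK//.
exact: integrable_scale.
Qed.

End densities.

(** * Characteristic function of the normal law *)

Section normal_characteristic.
Context (R : realType).
Local Notation leb := (@lebesgue_measure R).

(** The fundamental theorem of calculus on [[-n, n]] and dominated convergence; this is integration
    by parts on the whole line in disguise. *)
Lemma Rintegral_derive_eq0 (F f : R -> R) :
  (forall x, is_derive x (1 : R) F (f x)) -> continuous f ->
  leb.-integrable [set: R] (EFin \o f) ->
  F n%:R @[n --> \oo] --> 0 -> F (- n%:R) @[n --> \oo] --> 0 ->
  Rintegral leb [set: R] f = 0.
Proof.
move=> dF cf intf F1 F2.
pose D n : set R := `[- n%:R, n%:R]%classic.
have mf : measurable_fun [set: R] (EFin \o f) := measurable_int _ intf.
have cvf : (\int[leb]_x ((EFin \o f) \_ (D n)) x)%E @[n --> \oo] --> (\int[leb]_x (f x)%:E)%E.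
  apply: (@dominated_cvg _ _ _ leb _ measurableT _ _ (fun x => `|f x|%:E)) => //.
  - move=> n; have mD : measurable (D n) by exact: measurable_itv.
    exact: ((measurable_restrictT (EFin \o f) mD).1 (measurable_funTS mf)).
  - move=> x _; have [N xN] := exists_natr_ge `|x|.
    apply: (@cvg_trans _ ((f x)%:E @[_ --> \oo])); last exact: cvg_cst.
    apply: near_eq_cvg; near=> n.
    rewrite patchE ifT//; apply/mem_set; rewrite /D /= in_itv/= -ler_norml.
    rewrite (le_trans xN)// ler_nat; near: n; exact: nbhs_infty_ge.
  - exact: integrable_norm intf.
  - move=> n x _; rewrite patchE; case: ifP => _; first by rewrite lee_fin.
    by rewrite abse0 lee_fin.
have cf' : continuous F by move=> x; apply: differentiable_continuous; exact/derivable1_diffP.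
have FTC n : (0 < n)%N -> (\int[leb]_x ((EFin \o f) \_ (D n)) x)%E = (F n%:R - F (- n%:R))%:E.
  move=> n0; rewrite -integral_mkcond EFinB (@continuous_FTC2 _ f F)//.
  - by rewrite (@lt_trans _ _ 0)// ?oppr_lt0 ltr0n.
  - exact: continuous_subspaceT.
  - by split=> //; apply: cvg_at_left_filter || apply: cvg_at_right_filter; exact: cf'.
  - by move=> x _; rewrite derive1E; apply: derive_val.
have F3 : (F n%:R - F (- n%:R)) @[n --> \oo] --> 0.
  by rewrite -[X in _ --> X](subr0 0); exact: cvgB.
rewrite /Rintegral.
suff -> : (\int[leb]_x (f x)%:E = 0%:E)%E by [].
apply: cvg_unique cvf _ => //.
apply: (@cvg_trans _ ((F n%:R - F (- n%:R))%:E @[n --> \oo])).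
  by apply: near_eq_cvg; near=> n; rewrite FTC//; near: n; exact: nbhs_infty_gt.
by apply: cvg_EFin => //; exact: nearW.
Unshelve. all: by end_near. Qed.

Variable s : R.
Hypothesis s0 : 0 < s.
Let q : R -> R := normal_pdf 0 s.

Let qE x : q x = normal_peak s * expR (- x ^+ 2 / (2 * s ^+ 2)).
Proof. by rewrite /q normal_pdfE ?gt_eqF// /normal_fun subr0 mulr_natl. Qed.

Let q_ge0 x : 0 <= q x. Proof. exact: normal_pdf_ge0. Qed.
Let mq : measurable_fun [set: R] q. Proof. exact: measurable_normal_pdf. Qed.
Let iq : leb.-integrable [set: R] (EFin \o q).
Proof. exact: integrable_normal_pdf. Qed.
Let cq : continuous q. Proof. by apply: continuous_normal_pdf; rewrite gt_eqF. Qed.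

(** Half of the Gaussian exponent absorbs the factor [x]; the other half is the density with doubled
    variance, known to be integrable. *)
Let norm_xq x : `|x * q x| <=
  s * normal_peak s / normal_peak (Num.sqrt 2 * s) * normal_pdf 0 (Num.sqrt 2 * s) x.
Proof.
have s20 : 0 < Num.sqrt 2 * s by rewrite mulr_gt0// sqrtr_gt0.
have p0 : 0 < normal_peak (Num.sqrt 2 * s) by rewrite normal_peak_gt0// gt_eqF.
have p1 : 0 < normal_peak s by rewrite normal_peak_gt0// gt_eqF.
rewrite normrM (ger0_norm (q_ge0 x)) qE normal_pdfE ?gt_eqF// /normal_fun subr0.
rewrite exprMn sqr_sqrtr//.
pose y := x ^+ 2 / (4 * s ^+ 2).
have s2 : 0 < s ^+ 2 by rewrite exprn_gt0.
have -> : - x ^+ 2 / (2 * s ^+ 2 *+ 2) = - y by rewrite /y; field; rewrite gt_eqF.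
have -> : - x ^+ 2 / (2 * s ^+ 2) = - y + - y by rewrite /y; field; rewrite gt_eqF.
have h : `|x| * expR (- y) <= s.
  have : `|x| <= s * (1 + y).
    have := sqr_ge0 (`|x| - 2 * s); rewrite sqrrB real_normK ?num_real// => h.
    have -> : s * (1 + y) = (x ^+ 2 + 4 * s ^+ 2) / (4 * s) by rewrite /y; field; rewrite gt_eqF.
    by rewrite ler_pdivlMr ?mulr_gt0//; nra.
  have := expR_ge1Dx y; rewrite expRN => h1 h2.
  by rewrite ler_pdivrMr ?expR_gt0//; apply: (le_trans h2); rewrite ler_pM2l.
rewrite expRD.
rewrite [leLHS](_ : _ = (normal_peak s * expR (- y)) * (`|x| * expR (- y))); last by ring.
rewrite [leRHS](_ : _ = (normal_peak s * expR (- y)) * s); last by field; rewrite gt_eqF.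
by rewrite ler_wpM2l// mulr_ge0 ?expR_ge0// ltW.
Qed.

Let ixq : leb.-integrable [set: R] (EFin \o (fun x => x * q x)).
Proof.
set C := s * normal_peak s / normal_peak (Num.sqrt 2 * s).
apply: (@le_integrable _ _ _ leb _ measurableT _ (EFin \o (fun x => C * normal_pdf 0 (Num.sqrt 2 * s) x))).
- by apply/measurable_EFinP; exact: measurable_funM.
- by move=> x _ /=; rewrite lee_fin (le_trans (norm_xq x))// ler_norm.
- by apply: integrable_scale; exact: integrable_normal_pdf.
Qed.

Let dq x : is_derive x (1 : R) q (- (x / s ^+ 2) * q x).
Proof.
rewrite (_ : q = fun x => normal_peak s * expR (- x ^+ 2 / (2 * s ^+ 2))); last exact/funext.
have H : is_derive x (1 : R) (fun x => - x ^+ 2 / (2 * s ^+ 2)) (- (x / s ^+ 2)).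
  by apply: is_derive_eq; rewrite /GRing.scale /=; field; rewrite gt_eqF.
have H2 := @is_derive1_comp _ expR (fun x => - x ^+ 2 / (2 * s ^+ 2)) x _ _ (is_derive_expR _) H.
have H3 := is_deriveM (is_derive_cst (normal_peak s) x 1) H2.
by apply: is_derive_eq; rewrite /GRing.scale /=; ring.
Qed.

Let sin_itg (c b : R) : leb.-integrable [set: R] (EFin \o (fun x => sin (c * x + b) * (x * q x))).
Proof.
apply: (le_integrable measurableT _ _ ixq).
  apply/measurable_EFinP/measurable_funM; last exact: measurable_funM.
  by apply: (proj1 (bmeas_sin _)); apply: measurable_funD => //; exact: measurable_funM.
move=> x _ /=; rewrite lee_fin normrM ler_piMl//.
by rewrite ler_norml sin_geN1 sin_le1.
Qed.

Let cos_itg (c b : R) : leb.-integrable [set: R] (EFin \o (fun x => cos (c * x + b) * q x)).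
Proof.
apply: (le_integrable measurableT _ _ iq).
  apply/measurable_EFinP/measurable_funM => //.
  by apply: (proj1 (bmeas_cos _)); apply: measurable_funD => //; exact: measurable_funM.
move=> x _ /=; rewrite lee_fin normrM ler_piMl//.
by rewrite ler_norml cos_geN1 cos_le1.
Qed.

Let q_bound (n : nat) (x : R) : (0 < n)%N -> `|x| = n%:R -> `|q x| <= normal_peak s * (2 * s ^+ 2) * n%:R^-1.
Proof.
move=> n0 xn; have p1 : 0 < normal_peak s by rewrite normal_peak_gt0// gt_eqF.
have s2 : 0 < s ^+ 2 by rewrite exprn_gt0.
have nn0 : 0 < n%:R :> R by rewrite ltr0n.
have nn1 : 1 <= n%:R :> R by rewrite ler1n.
rewrite ger0_norm// qE -mulrA ler_pM2l// -[x ^+ 2]real_normK ?num_real// xn.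
have -> : - n%:R ^+ 2 / (2 * s ^+ 2) = - (n%:R ^+ 2 / (2 * s ^+ 2)) :> R by rewrite mulNr.
rewrite expRN -[leRHS]invrK lef_pV2 ?posrE ?expR_gt0 ?invr_gt0 ?divr_gt0 ?mulr_gt0//.
apply: le_trans (expR_ge1Dx _); rewrite invf_div.
apply: (@le_trans _ _ (n%:R ^+ 2 / (2 * s ^+ 2))); last by rewrite lerDr.
by rewrite ler_pM2r ?invr_gt0 ?mulr_gt0// ler_eXnr.
Qed.

(** Stein's identity [E Z phi(Z) = s^2 E phi'(Z)] for [phi x = sin (c * x + b)]: the derivative of
    [phi * q] has integral zero. *)
Lemma normal_stein (c b : R) :
  Rintegral leb [set: R] (fun x => sin (c * x + b) * (x * q x)) =
  c * s ^+ 2 * Rintegral leb [set: R] (fun x => cos (c * x + b) * q x).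
Proof.
pose F x := sin (c * x + b) * q x.
pose f x := c * (cos (c * x + b) * q x) - s ^- 2 * (sin (c * x + b) * (x * q x)).
have cl : continuous (fun x : R => c * x + b).
  move=> x; apply: continuousD; last exact: cst_continuous.
  exact: mulrl_continuous.
have dF x : is_derive x (1 : R) F (f x).
  have H : is_derive x (1 : R) (fun x => c * x + b) c.
    by apply: is_derive_eq; rewrite /GRing.scale /=; ring.
  have H2 := @is_derive1_comp _ sin (fun x => c * x + b) x _ _ (is_derive_sin _) H.
  have H3 := is_deriveM H2 (dq x).
  by apply: is_derive_eq; rewrite /f /GRing.scale /=; field; rewrite gt_eqF.
have cf : continuous f.
  have c1 : continuous (fun x : R => cos (c * x + b)).
    by move=> x; apply: continuous_comp; [exact: cl|exact: continuous_cos].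
  have c2 : continuous (fun x : R => sin (c * x + b)).
    by move=> x; apply: continuous_comp; [exact: cl|exact: continuous_sin].
  move=> x; apply: (@continuousB _ _ _ (fun x => c * (cos (c * x + b) * q x))).
    apply: continuousM; first exact: cst_continuous.
    by apply: continuousM; [exact: c1|exact: cq].
  apply: continuousM; first exact: cst_continuous.
  apply: continuousM; first exact: c2.
  by apply: continuousM; [exact: cvg_id|exact: cq].
have i1 : leb.-integrable [set: R] (EFin \o (fun x => c * (cos (c * x + b) * q x))).
  by apply: integrable_scale; exact: cos_itg.
have i2 : leb.-integrable [set: R] (EFin \o (fun x => s ^- 2 * (sin (c * x + b) * (x * q x)))).
  by apply: integrable_scale; exact: sin_itg.
have intf : leb.-integrable [set: R] (EFin \o f).
  exact: (integrableB measurableT i1 i2).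
have F0 (e : nat -> R) : (forall n, `|e n| = n%:R) -> F (e n) @[n --> \oo] --> 0.
  move=> en; apply: norm_cvg0.
  have h : (normal_peak s * (2 * s ^+ 2) * harmonic n) @[n --> \oo] --> 0.
    rewrite -[X in _ --> X](mulr0 (normal_peak s * (2 * s ^+ 2))).
    by apply: cvgZr; exact: cvg_harmonic.
  rewrite -(cvg_shiftS _).
  apply: (squeeze_cvgr _ (cvg_cst 0) h); near=> n; rewrite normr_ge0/= /F normrM.
  apply: (le_trans (ler_piMl _ _)) => //; first by rewrite ler_norml sin_geN1 sin_le1.
  exact: q_bound.
have := Rintegral_derive_eq0 dF cf intf (F0 _ (fun n => normr_nat _ n)).
move=> /(_ (F0 (fun n => - n%:R) _)) => E.
have {}E : Rintegral leb setT f = 0 by apply: E => n; rewrite normrN normr_nat.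
move: E; rewrite /f RintegralB// (RintegralZl _ measurableT (cos_itg c b)).
rewrite (RintegralZl _ measurableT (sin_itg c b)) => /subr0_eq E.
have s2 : s ^+ 2 != 0 by rewrite gt_eqF// exprn_gt0.
by rewrite mulrAC E mulrC mulrA divff// mul1r.
Unshelve. all: by end_near. Qed.

(** Stein's identity says that the function of [l] solves the Gaussian equation exactly, so
    [gaussian_ode] applies with [rho = 0]. *)
Lemma Ex_normal_cos (a b : R) :
  Ex (normal_prob 0 s) (fun x => cos (a * x + b)) = cos b * expR (- (a ^+ 2 * s ^+ 2) / 2).
Proof.
have mlin (c d : R) : measurable_fun [set: R] (fun x => c * x + d).
  by apply: measurable_funD => //; exact: measurable_funM.
have dens h := @Ex_density _ _ _ leb q mq q_ge0 (normal_prob 0 s) h (fun A mA => erefl).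
have bc : bmeas (fun x : R => cos (a * x + b)) := bmeas_cos (mlin a b).
rewrite (dens _ bc).
have iaq : leb.-integrable [set: R] (EFin \o (fun x => (a * x) * q x)).
  rewrite (_ : (fun x => _) = (fun x => a * (x * q x))); first exact: integrable_scale ixq.
  by apply/funext => x; rewrite mulrA.
have := @gaussian_ode R _ _ (a ^+ 2 * s ^+ 2) 0 _ (fun l =>
  @is_derive_Rintegral_cos R _ _ leb (fun x => a * x) q b l _ iq iaq q_ge0).
rewrite mulr_ge0 ?sqr_ge0// => /(_ isT).
move=> H; have {}H := H (measurable_funM (measurable_cst a) (@measurable_id _ _ _)).
set w := Rintegral _ _ _ in H *.
have -> : cos b = Rintegral leb setT (fun x => cos (0 * (a * x) + b) * q x).
  under eq_Rintegral do rewrite mul0r add0r.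
  rewrite RintegralZl// /Rintegral.
  by have -> := integral_normal_pdf 0 s; rewrite mulr1.
apply/eqP; rewrite -subr_eq0 -normr_le0 /w.
under eq_Rintegral do rewrite -[a * _](mul1r).
apply: H => l _; rewrite normr_le0 addrC addr_eq0; apply/eqP.
have E1 : Rintegral leb setT (fun x => cos (l * (a * x) + b) * q x) =
          Rintegral leb setT (fun x => cos (l * a * x + b) * q x).
  by apply: eq_Rintegral => x _; rewrite mulrA.
rewrite E1.
have -> : Rintegral leb setT (fun x => - (a * x * sin (l * (a * x) + b) * q x)) =
   - a * Rintegral leb setT (fun x => sin (l * a * x + b) * (x * q x)).
  rewrite -(RintegralZl (-a) measurableT (sin_itg (l * a) b)).
  by apply: eq_Rintegral => x _; rewrite [l * (a * x)]mulrA; ring.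
by rewrite normal_stein; ring.
Qed.

End normal_characteristic.

Lemma Ex_prod (R : realType) (d1 d2 : measure_display) (T1 : measurableType d1)
    (T2 : measurableType d2) (P1 : probability T1 R) (P2 : probability T2 R)
    (F : T1 * T2 -> R) : bmeas F ->
  Ex (P1 \x P2)%E F = Ex P1 (fun x => Ex P2 (fun y => F (x, y))).
Proof.
move=> bF.
have bs x : bmeas (fun y => F (x, y)).
  by apply: bmeas_comp bF; exact: pair1_measurable.
have iF : ((P1 \x P2)%E).-integrable setT (EFin \o F) by exact: bmeas_integrable.
rewrite /Ex /Rintegral -integral12_prod_meas1//; congr fine.
by apply: eq_integral => x _; rewrite /fubini_F -(EFin_Ex _ (bs x)).
Qed.

Lemma bmeas_cos_dot (R : realType) (k : nat) (a : 'cV[R]_k) (b : R) :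
  bmeas ((fun z => cos (dot a z + b)) : borel 'cV[R]_k -> R).
Proof.
have mdot := continuous_borel (@continuous_dot _ _ a).
exact: (bmeas_cos (measurable_funD mdot (measurable_cst b))).
Qed.

Lemma measurable_borel_coord (R : realType) (k : nat) (l : 'I_k) :
  measurable_fun [set: borel 'cV[R]_k] (fun z : borel 'cV[R]_k => (z : 'cV[R]_k) l ord0).
Proof. by apply: continuous_borel; exact: coord_continuous. Qed.

(** A product of one-dimensional normal laws, adjoining one coordinate at a time; its characteristic
    function determines it and is all that later steps use. *)
Lemma gaussian_vector_exists (R : realType) (k : nat) (s : 'I_k -> R) :
  (forall l, 0 < s l) -> exists nu : probability (borel 'cV[R]_k) R,
  forall a b, Ex nu (fun z => cos (dot a z + b)) =
    cos b * expR (- (\sum_l (a l ord0) ^+ 2 * (s l) ^+ 2) / 2).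
Proof.
elim: k s => [|k IH] s s0.
  (* For [k = 0] the space has one point; its law is the image of a normal law under a constant
     map. *)
  pose z0 : borel 'cV[R]_0 := (0 : 'cV[R]_0).
  have mc : measurable_fun [set: R] (fun _ : R => z0) by exact: measurable_cst.
  pose P1 := normal_prob (0 : R) 1.
  exists (distribution P1 (rv_of P1 mc)) => a b.
  rewrite Ex_distribution; last exact: bmeas_cos_dot.
  rewrite [LHS]Ex_cst dotE !big_ord0 add0r oppr0 mul0r expR0 mulr1//.
have [nu Hnu] := IH (fun l => s (lift ord0 l)) (fun l => s0 _).
pose th (p : R * borel 'cV[R]_k) : borel 'cV[R]_k.+1 :=
  \col_l (if unlift ord0 l is Some j then (p.2 : 'cV[R]_k) j ord0 else p.1).
have mth : measurable_fun [set: R * borel 'cV[R]_k] th.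
  apply: measurable_borel_cV => l.
  case: (unliftP ord0 l) => [j ->|->]; rewrite /th.
    rewrite (_ : (fun s => _) = fun p : R * borel 'cV[R]_k => (p.2 : 'cV[R]_k) j ord0); last first.
      by apply/funext => p; rewrite mxE liftK.
    exact: (measurableT_comp (measurable_borel_coord j)).
  rewrite (_ : (fun s => _) = fst); first exact: measurable_fst.
  by apply/funext => p; rewrite mxE unlift_none.
pose P1 := normal_prob 0 (s ord0).
exists (distribution (P1 \x nu)%E (rv_of (P1 \x nu)%E mth)) => a b.
rewrite Ex_distribution; last exact: bmeas_cos_dot.
rewrite Ex_prod; last exact: (bmeas_comp mth (bmeas_cos_dot a b)).
pose a' : 'cV[R]_k := \col_j a (lift ord0 j) ord0.
transitivity (Ex P1 (fun x => cos (a ord0 ord0 * x + b) * expR (- (\sum_l (a' l ord0) ^+ 2 * (s (lift ord0 l)) ^+ 2) / 2))).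
  apply: eq_Ex => x; rewrite -Hnu; apply: eq_Ex => z /=.
  congr cos; rewrite !dotE big_ord_recl /th mxE unlift_none /= [in RHS]addrCA addrA.
  congr (_ + _ + _); apply: eq_bigr => j _; rewrite mxE liftK mxE//.
rewrite ExZr; last by apply: bmeas_cos; apply: measurable_funD => //; exact: measurable_funM.
rewrite Ex_normal_cos// -mulrA -expRD big_ord_recl; congr (_ * expR _).
under eq_bigr do rewrite mxE.
by rewrite -mulrDl -opprD.
Qed.

(** The constant sequence with law [mu] converges in law to [nu] by the criterion above, so bounded
    continuous functions have equal integrals. Ramps pass this on to the rays, which form a
    pi-system. *)
Lemma probability_cf_unique (R : realType) (mu nu : probability R R) :
  (forall a b, Ex mu (fun x => cos (a * x + b)) = Ex nu (fun x => cos (a * x + b))) ->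
  forall A, measurable A -> mu A = nu A.
Proof.
move=> munu.
have mline : measurable_fun [set: R] ((fun x => const_mx x) : R -> borel 'cV[R]_1).
  apply: measurable_borel_cV => l; rewrite (_ : (fun s => _) = id)//.
  by apply/funext => x; rewrite mxE.
pose nu1 := distribution nu (rv_of nu mline).
have cv : cvg_in_law mu (fun _ : nat => (fun x => const_mx x) : R -> 'cV[R]_1) nu1.
  apply: cf_cvg_in_law => [n l|a b|eta eta0].
  - by rewrite (_ : (fun w => _) = id)//; apply/funext => x; rewrite mxE.
  - rewrite Ex_distribution; last exact: bmeas_cos_dot.
    have E x : dot a (const_mx x) = a ord0 ord0 * x by rewrite dotE big_ord1 mxE.
    under eq_fun do under eq_Ex do rewrite E.
    rewrite (_ : Ex nu _ = Ex nu (fun x => cos (a ord0 ord0 * x + b))).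
      by rewrite munu; exact: cvg_cst.
    by apply: eq_Ex => x /=; rewrite E.
  - have [L L0 HL] := tight_single (distribution mu (rv_of mu mline)) eta0.
    exists L => //; apply: nearW => n; exact: HL.
have bc (h : R -> R) : continuous h -> (exists M, forall x, `|h x| <= M) -> Ex mu h = Ex nu h.
  move=> ch [M hM].
  have mh : measurable_fun [set: R] h by exact: continuous_measurable_fun.
  have bh : bmeas h by split=> //; exists M.
  have c1 : continuous (fun z : 'cV[R]_1 => h (z ord0 ord0)).
    by move=> z; apply: continuous_comp; [exact: coord_continuous|exact: ch].
  have := cv _ c1 (ex_intro _ M (fun z => hM _)).
  have b1 : bmeas (fun z : borel 'cV[R]_1 => h ((z : 'cV[R]_1) ord0 ord0)).
    by split; [exact: continuous_borel|exists M].
  rewrite -(EFin_Ex _ b1) Ex_distribution//.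
  under eq_fun do under eq_integral do rewrite mxE.
  rewrite -(EFin_Ex _ bh) => H.
  have H0 : (Ex mu h)%:E @[_ --> \oo] --> (Ex mu h)%:E by exact: cvg_cst.
  have E1 : (Ex mu h)%:E = _ := cvg_unique (@ereal_hausdorff R) H0 H.
  rewrite (EFin_inj (E1 _)).
  by apply: eq_Ex => x /=; rewrite mxE.
(* Continuous ramps that tend to the indicator of the open ray above [x]. *)
pose h n (x a : R) := Num.min 1 (Num.max 0 (n%:R * (a - x))).
have ch n x : continuous (h n x).
  have c0 : continuous (fun a : R => n%:R * (a - x)).
    have c1 : continuous (fun a : R => a - x).
      by move=> a; apply: (@continuousB _ _ _ (fun a : R => a)); [exact: cvg_id|exact: cst_continuous].
    by move=> a; apply: (@continuous_comp _ _ _ (fun a : R => a - x)); [exact: c1|exact: mulrl_continuous].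
  move=> a; exact: (continuous_min (@cst_continuous _ _ (1 : R) a)
    (continuous_max (@cst_continuous _ _ (0 : R) a) (c0 a))).
have h01 n x a : 0 <= h n x a <= 1.
  by rewrite /h le_min ler01 le_max lexx/= ge_min lexx.
have hb n x : exists M, forall a, `|h n x a| <= M.
  by exists 1 => a; have /andP[? ?] := h01 n x a; rewrite ger0_norm.
have bh n x : bmeas (h n x).
  by split => //; apply: continuous_measurable_fun; exact: ch.
have hcv (x a : R) : h n x a @[n --> \oo] --> (\1_(`]x, +oo[%classic) a : R).
  rewrite indicE mem_setE in_itv /= andbT; case: ltP => xa.
    have [N HN] := exists_natr_ge (a - x)^-1.
    apply: (@cvg_trans _ ((1 : R) @[_ --> \oo])); last exact: cvg_cst.
    apply: near_eq_cvg; near=> n; rewrite /h; apply/esym/min_idPl.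
    rewrite le_max; apply/orP; right.
    rewrite -ler_pdivrMr ?subr_gt0// div1r (le_trans HN)// ler_nat.
    by near: n; exact: nbhs_infty_ge.
  apply: (@cvg_trans _ ((0 : R) @[_ --> \oo])); last exact: cvg_cst.
  apply: near_eq_cvg; apply: nearW => n; rewrite /h max_l; last by rewrite mulr_ge0_le0// subr_le0.
  by rewrite min_r.
have ray (Q : probability R R) x : Ex Q (h n x) @[n --> \oo] --> fine (Q `]x, +oo[%classic).
  have -> : fine (Q `]x, +oo[%classic) = Ex Q (fun a => \1_(`]x, +oo[%classic) a).
    by rewrite (Ex_indic Q (@measurable_id _ _ setT)).
  have b1 : bmeas (fun a : R => \1_(`]x, +oo[%classic) a : R).
    split; first exact: measurable_indic.
    by exists 1 => a; rewrite indicE; case: (_ \in _); rewrite ?normr0 ?normr1.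
  apply: fine_cvg; rewrite (EFin_Ex _ b1).
  apply: (@dominated_cvg _ _ _ Q _ measurableT _ _ (fun=> 1%E)) => //.
  - by move=> n; apply/measurable_EFinP; exact: (bh n x).1.
  - by move=> a _; apply: cvg_EFin; [exact: nearW|exact: hcv].
  - exact: (@bmeas_integrable _ _ _ Q _ (bmeas_cst _ (1 : R))).
  - by move=> n a _; rewrite lee_fin; have /andP[? ?] := h01 n x a; rewrite ger0_norm.
have rays x : mu `]x, +oo[%classic = nu `]x, +oo[%classic.
  rewrite -[LHS]fineK ?fin_num_measure// -[RHS]fineK ?fin_num_measure//.
  have E : (fun n => Ex mu (h n x)) = (fun n => Ex nu (h n x)).
    by apply/funext => n; exact: bc (ch _ _) (hb _ _).
  have := ray mu x; rewrite E => rm.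
  by congr (_%:E); exact: (cvg_unique _ rm (ray nu x)).
move=> A mA.
apply: (measure_unique (@RGenOInfty.G R) (fun n => `](- n%:R), +oo[%classic)) => //.
- exact: RGenOInfty.measurableE.
- move=> _ _ [x ->] [y ->]; exists (Num.max x y).
  apply/seteqP; split=> z /=; rewrite !in_itv /= !andbT gt_max; first by move=> [-> ->].
  by move/andP.
- by move=> n; exists (- n%:R); exact: erefl.
- apply/seteqP; split=> // z _; have [n zn] := exists_natr_ge (`|z| + 1); exists n => //=.
  rewrite in_itv /= andbT; have := ler_norm (- z); rewrite normrN; lra.
- by move=> _ [x ->]; exact: rays.
- by move=> n; rewrite (le_lt_trans (probability_le1 _ _)) ?ltry.
Unshelve. all: by end_near. Qed.

Lemma law_cf_unique (R : realType) (d1 d2 : measure_display) (T1 : measurableType d1)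
    (T2 : measurableType d2) (mu : probability T1 R) (nu : probability T2 R)
    (F : T1 -> R) (G : T2 -> R) (A : set R) :
  measurable_fun [set: T1] F -> measurable_fun [set: T2] G ->
  (forall a b, Ex mu (fun x => cos (a * F x + b)) = Ex nu (fun x => cos (a * G x + b))) ->
  measurable A -> mu (F @^-1` A) = nu (G @^-1` A).
Proof.
move=> mF mG FG mA.
apply: (@probability_cf_unique R (distribution mu (rv_of mu mF)) (distribution nu (rv_of nu mG))) mA => a b.
have bc : bmeas (fun x : R => cos (a * x + b)).
  by apply: bmeas_cos; apply: measurable_funD => //; exact: measurable_funM.
by rewrite !Ex_distribution//; exact: FG.
Qed.

(* normal_prob is a measure on the alias measurableTypeR R, which does not unify
   with the measurable structure of R although it is convertible to it. *)
Lemma law_normal_unique (R : realType) (d1 : measure_display) (T1 : measurableType d1)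
    (mu : probability T1 R) (s : R) (F : T1 -> R) (A : set R) : 0 < s ->
  measurable_fun [set: T1] F ->
  (forall a b, Ex mu (fun x => cos (a * F x + b)) =
               Ex (normal_prob 0 s) (fun x => cos (a * x + b))) ->
  measurable A -> mu (F @^-1` A) = normal_prob 0 s A.
Proof.
move=> s0 mF FG mA.
exact: (@law_cf_unique R _ _ T1 (measurableTypeR R) mu (normal_prob 0 s) F (fun x => x) A mF
  (@measurable_id _ (measurableTypeR R) setT) FG mA).
Qed.

(** The law of the form [a] is identified by its characteristic function, which is read off the
    hypothesis at the multiples [c *: a]. *)
Lemma multinormal_diag (R : realType) (k : nat) (v : 'I_k -> R)
    (nu : probability (borel 'cV[R]_k) R) : (forall l, 0 < v l) ->
  (forall a b, Ex nu (fun z => cos (dot a z + b)) =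
     cos b * expR (- (\sum_l (a l ord0) ^+ 2 * v l) / 2)) ->
  is_multinormal nu 0 (diag_mx (\row_l v l)).
Proof.
move=> v0 Hnu.
have quadE (a : 'cV[R]_k) : (a^T *m diag_mx (\row_l v l) *m a) ord0 ord0 =
    \sum_l (a l ord0) ^+ 2 * v l.
  by rewrite mxE; apply: eq_bigr => l _; rewrite mul_mx_diag !mxE; ring.
have quad0 (a : 'cV[R]_k) : 0 <= \sum_l (a l ord0) ^+ 2 * v l.
  by apply: sumr_ge0 => l _; rewrite mulr_ge0 ?sqr_ge0// ltW.
split; [exact: tr_diag_mx|by move=> a; rewrite quadE|].
move=> a B mB; rewrite quadE mulmx0 mxE /gauss_law; case: eqP => [|/eqP] q0.
  (* All [v l] being positive, a linear form of variance zero is null, and its law is the Dirac mass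
     of [gauss_law]. *)
  have a0 : a = 0.
    apply/matrixP => l j; rewrite ord1 mxE; apply/eqP.
    have pos i : true -> 0 <= (a i ord0) ^+ 2 * v i by rewrite mulr_ge0 ?sqr_ge0// ltW.
    have /eqP := psumr_eq0P pos q0 (erefl : xpredT l).
    by rewrite mulf_eq0 sqrf_eq0 (gt_eqF (v0 l)) orbF.
  rewrite a0 trmx0; under eq_set do rewrite mul0mx mxE.
  rewrite diracE; case: (boolP (0 \in B)); rewrite ?inE ?notin_setE => B0.
    rewrite (_ : [set _ | _] = setT) ?probability_setT//.
    by apply/seteqP; split.
  rewrite (_ : [set _ | _] = set0) ?measure0//.
  by apply/seteqP; split.
have sq0 : 0 < Num.sqrt (\sum_l (a l ord0) ^+ 2 * v l).
  by rewrite sqrtr_gt0 lt_neqAle eq_sym q0 quad0.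
have ma : measurable_fun [set: borel 'cV[R]_k] (dot a : borel 'cV[R]_k -> R).
  exact: continuous_borel (@continuous_dot _ _ a).
apply: (law_normal_unique sq0 ma _ mB) => c b.
have bc : bmeas (fun x : R => cos (c * x + b)).
  by apply: bmeas_cos; apply: measurable_funD => //; exact: measurable_funM.
rewrite Ex_normal_cos// sqr_sqrtr//.
transitivity (Ex nu (fun z => cos (dot (c *: a) z + b))).
  by apply: eq_Ex => z /=; rewrite dotZl.
rewrite Hnu mulr_sumr (eq_bigr (fun l => c ^+ 2 * (a l ord0 ^+ 2 * v l))) => [//|l _].
by rewrite mxE; ring.
Qed.

(** * Kernels *)

Lemma continuous_fun_comp (R : realType) (g h : R -> R) :
  continuous g -> continuous h -> continuous (fun t => h (g t)).
Proof. by move=> cg ch t; apply: continuous_comp; [exact: cg|exact: ch]. Qed.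

Lemma continuous_fun_mul (R : realType) (g h : R -> R) :
  continuous g -> continuous h -> continuous (fun t => g t * h t).
Proof. by move=> cg ch t; apply: cvgM; [exact: cg|exact: ch]. Qed.

Section change_of_variables.
Context (R : realType).
Local Notation leb := (@lebesgue_measure R).

Lemma ge0_integral_oppr (G : R -> R) : continuous G -> (forall x, 0 <= G x) ->
  (\int[leb]_x (G (- x))%:E = \int[leb]_x (G x)%:E)%E.
Proof.
move=> cG G0.
have cN : continuous (fun x => G (- x)).
  by move=> x; apply: (@continuous_comp _ _ _ (fun x : R => - x)); [exact: opp_continuous|exact: cG].
have half (F : R -> R) : continuous F -> (forall x, 0 <= F x) ->
    (\int[leb]_(x in `]-oo, 0%R]) (F x)%:E = \int[leb]_(x in `[0%R, +oo[) (F (- x))%:E)%E.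
  move=> cF F0; have := @ge0_integration_by_substitutionNy R F 0; rewrite oppr0 => -> //.
  exact: continuous_subspaceT.
have split (F : R -> R) : continuous F -> (forall x, 0 <= F x) ->
    (\int[leb]_x (F x)%:E = \int[leb]_(x in `]-oo, 0%R]) (F x)%:E + \int[leb]_(x in `[0%R, +oo[) (F x)%:E)%E.
  move=> cF F0; have mF : measurable_fun [set: R] (EFin \o F).
    by apply/measurable_EFinP; exact: continuous_measurable_fun.
  rewrite -(@integral_itv_obnd_cbnd _ 0 +oo%O); last exact: measurable_funTS.
  rewrite -ge0_integral_setU//=; last 3 first.
  - exact: measurable_funTS.
  - by move=> x _; rewrite lee_fin.
  - by apply/disj_setPS => x /= []; rewrite !in_itv /= andbT; lra.
  congr (integral _ _ _); apply/seteqP; split=> x //= _.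
  by rewrite !in_itv /= andbT; case: (lerP x 0) => ?; [left|right].
rewrite (split _ cN)// (split _ cG)// half// [in RHS]half// addeC; congr (_ + _)%E.
by apply: eq_integral => x _; rewrite opprK.
Qed.

Lemma ge0_integral_affine (G : R -> R) (x b : R) : 0 < b -> continuous G -> (forall t, 0 <= G t) ->
  (\int[leb]_t (G t)%:E = b%:E * \int[leb]_u (G (x + b * u))%:E)%E.
Proof.
move=> b0 cG G0.
pose F u := x + b * u.
have dF u : is_derive u (1 : R) F b.
  by apply: is_derive_eq; rewrite /GRing.scale /=; ring.
have F'E : F^`()%classic = cst b by apply/funext => u; rewrite derive1E derive_val.
have cF : continuous F.
  by move=> u; apply: differentiable_continuous; exact/derivable1_diffP.
have mGF : measurable_fun [set: R] (fun u => (G (F u))%:E).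
  apply/measurable_EFinP; apply: continuous_measurable_fun => u.
  by apply: continuous_comp; [exact: cF|exact: cG].
have FNy : F x @[x --> -oo] --> -oo.
  apply/cvgrNyPle => A; near=> u; rewrite /F -lerBrDl -(ler_pdivlMl _ _ b0).
  by near: u; apply: nbhs_ninfty_le; exact: num_real.
have Fy : F x @[x --> +oo] --> +oo.
  apply/cvgryPge => A; near=> u; rewrite /F -lerBlDl -(ler_pdivrMl _ _ b0).
  by near: u; apply: nbhs_pinfty_ge; exact: num_real.
rewrite (@increasing_ge0_integration_by_substitutionT _ F G)//.
- rewrite -ge0_integralZl//; last by rewrite lee_fin ltW.
    by apply: eq_integral => u _; rewrite F'E /= -EFinM mulrC.
  by move=> u _; rewrite lee_fin.
- by move=> u v uv; rewrite /F ltrD2l ltr_pM2l.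
- by rewrite F'E; exact: cst_continuous.
- by rewrite F'E; exact: is_cvg_cst.
- by rewrite F'E; exact: is_cvg_cst.
Unshelve. all: by end_near. Qed.

End change_of_variables.

(** * Integrable Lipschitz kernels *)

Section lipschitz_kernel.
Context (R : realType).
Local Notation leb := (@lebesgue_measure R).
Variables (K : R -> R) (Lk : R).
Hypothesis Lk0 : 0 < Lk.
Hypothesis lipK : forall x y, `|K x - K y| <= Lk * `|x - y|.
Hypothesis iK : leb.-integrable [set: R] (EFin \o K).

Lemma lipschitz_continuous : continuous K.
Proof.
move=> x; apply/cvgrPdist_le => e e0; near=> y.
apply: (le_trans (lipK _ _)); rewrite -ler_pdivlMl//.
near: y; apply: cvgr_dist_le; first exact: cvg_id.
by rewrite mulr_gt0 ?invr_gt0.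
Unshelve. all: by end_near. Qed.

Let mK : measurable_fun [set: R] K.
Proof. by apply: continuous_measurable_fun; exact: lipschitz_continuous. Qed.

Let mnK : measurable_fun [set: R] (fun x => `|K x|%:E).
Proof. by apply/measurable_EFinP; exact: measurableT_comp. Qed.

Let bump u c := (`[u - c / (2 * Lk), u + c / (2 * Lk)]%classic : set R).

(* |K| >= c / 2 on the interval of radius c / (2 Lk) around a point where |K| >= c *)
Let bump_integral u c : 0 < c -> c <= `|K u| ->
  ((c ^+ 2 / (2 * Lk))%:E <= \int[leb]_(x in bump u c) `|K x|%:E)%E.
Proof.
move=> c0 cK.
have mb : measurable (bump u c) by exact: measurable_itv.
have d0 : 0 < c / (2 * Lk) by rewrite divr_gt0// mulr_gt0.
apply: (@le_trans _ _ (\int[leb]_(x in bump u c) (cst (c / 2)%:E x))%E).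
  rewrite integral_cst// /bump /= lebesgue_measure_itv /= lte_fin.
  rewrite ltrD2l gtrN//; rewrite -EFinB -EFinM lee_fin.
  rewrite (_ : c / 2 * _ = c ^+ 2 / (2 * Lk))//; field.
  by rewrite gt_eqF.
apply: ge0_le_integral => //.
- by move=> x _; rewrite lee_fin divr_ge0// ltW.
- exact: measurable_funTS.
move=> x; rewrite /bump /= in_itv /= lee_fin => xu.
have xu' : `|u - x| <= c / (2 * Lk) by rewrite ler_norml; lra.
have := lerB_dist (K u) (K x); have := lipK u x.
have : Lk * `|u - x| <= c / 2.
  rewrite (_ : c / 2 = Lk * (c / (2 * Lk))); first by rewrite ler_pM2l.
  by field; rewrite gt_eqF.
lra.
Qed.

Let J := Rintegral leb setT (fun x => `|K x|).

Let JE : (\int[leb]_x `|K x|%:E = J%:E)%E.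
Proof.
rewrite /J /Rintegral fineK//.
by have := integrable_fin_num measurableT (integrable_norm iK).
Qed.

(** A value [c] of [|K|] forces [c^2 <= 2 Lk J], which is impossible once [c] exceeds both 1 and
    [2 Lk J]. *)
Lemma kernel_bounded : exists2 M, 0 < M & forall u, `|K u| <= M.
Proof.
have J0 : 0 <= J by apply: Rintegral_ge0.
have M1 : 1 <= 2 * Lk * J + 1 by rewrite lerDr mulr_ge0// mulr_ge0// ltW.
exists (2 * Lk * J + 1) => [|u]; first exact: lt_le_trans M1.
rewrite leNgt; apply/negP => Mu.
have c0 : 0 < `|K u| by apply: lt_trans Mu; exact: lt_le_trans M1.
have := bump_integral c0 (lexx _).
move=> /le_trans /(_ (ge0_subset_integral leb (measurable_itv _) measurableT mnK _ (@subsetT _ _))).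
move=> /(_ (fun x _ => normr_ge0 _)).
rewrite JE lee_fin ler_pdivrMr ?mulr_gt0//; nra.
Qed.

(** A value [c] far out would bring an integral of at least [c^2 / (2 Lk)] into a region where the
    integral of [|K|] is smaller. *)
Lemma kernel_vanishes c : 0 < c -> exists2 r, 0 < r & forall u, r <= `|u| -> `|K u| < c.
Proof.
move=> c0.
pose D (n : nat) : set R := [set x | n%:R < `|x|].
have mD n : measurable (D n).
  rewrite (_ : D n = (fun x => `|x|) @^-1` `]n%:R, +oo[%classic); last first.
    by apply/seteqP; split=> x /=; rewrite /D /= in_itv /= andbT.
  have mn : measurable_fun [set: R] (fun x : R => `|x|) by exact: measurableT_comp.
  by rewrite -[X in measurable X]setTI; apply: mn => //; exact: measurable_itv.
have mDK n : measurable_fun [set: R] ((fun x => `|K x|%:E) \_ (D n)).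
  exact: ((measurable_restrictT _ (mD n)).1 (measurable_funTS mnK)).
have cv : (\int[leb]_x ((fun x => `|K x|%:E) \_ (D n)) x)%E @[n --> \oo] --> (\int[leb]_x (cst 0 x : \bar R))%E.
  apply: (@dominated_cvg _ _ _ leb _ measurableT _ _ (fun x => `|K x|%:E)) => //.
  - move=> x _; have [N xN] := exists_natr_ge `|x|.
    apply: (@cvg_trans _ ((0 : \bar R) @[_ --> \oo])); last exact: cvg_cst.
    apply: near_eq_cvg; near=> n; rewrite patchE ifF//; apply/negbTE; rewrite notin_setE /D /=.
    apply/negP; rewrite -leNgt (le_trans xN)// ler_nat; near: n; exact: nbhs_infty_ge.
  - exact: integrable_norm iK.
  - by move=> n x _; rewrite patchE; case: ifP => _; rewrite ?abse0 /= lee_fin ?normr_id.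
rewrite integral_cst// mul0e in cv.
have e0 : 0 < c ^+ 2 / (2 * Lk) by rewrite divr_gt0 ?exprn_gt0 ?mulr_gt0.
have := cv; rewrite (_ : 0%E = (0 : R)%:E)// => /fine_cvgP[fin /cvgrPdist_lt /(_ _ e0) H].
near \oo => n.
have fn : ((\int[leb]_x ((fun x => `|K x|%:E) \_ (D n)) x)%E \is a fin_num) by near: n.
have : `|0 - fine (\int[leb]_x ((fun x => `|K x|%:E) \_ (D n)) x)%E| < c ^+ 2 / (2 * Lk) by near: n.
rewrite sub0r normrN => small.
(* The interval of radius [c / (2 Lk)] around such a [u] stays in [D n]; the [+ 1] makes the
   inequality strict. *)
exists (n%:R + c / (2 * Lk) + 1) => [|u ru].
  by rewrite ltr_wpDl// addr_ge0// divr_ge0 ?mulr_ge0 ?ltW.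
rewrite ltNge; apply/negP => cK.
have := bump_integral c0 cK; apply/negP; rewrite -ltNge.
apply: (@le_lt_trans _ _ (\int[leb]_x ((fun x => `|K x|%:E) \_ (D n)) x)%E).
  rewrite -integral_mkcond; apply: ge0_subset_integral => //.
  - exact: measurable_itv.
  - exact: mD.
  - exact: measurable_funTS.
  - move=> x; rewrite /bump /= in_itv /= /D /= => xu.
    have : `|u - x| <= c / (2 * Lk) by rewrite ler_norml; lra.
    by have := lerB_dist u x; lra.
rewrite -(fineK fn) lte_fin (le_lt_trans _ small)// ler_norm//.
Unshelve. all: by end_near. Qed.

End lipschitz_kernel.

Lemma sigma_finite_lebesgue_square (R : realType) :
  sigma_finite [set: measurableTypeR R * measurableTypeR R]
    (@lebesgue_measure R \x @lebesgue_measure R)%E.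
Proof.
pose D (n : nat) : set (measurableTypeR R) := `[- n%:R, n%:R]%classic.
exists (fun n => D n `*` D n).
  apply/seteqP; split=> // -[x y] _; have [n xyn] := exists_natr_ge (`|x| + `|y|).
  have := normr_ge0 x; have := normr_ge0 y => y0 x0.
  by exists n => //; split; rewrite /D /= in_itv /= -ler_norml; lra.
move=> n; have mD : measurable (D n) by exact: measurable_itv.
split; first exact: measurableX.
have Dn : (lebesgue_measure (D n) < +oo)%E.
  by rewrite /D lebesgue_measure_itv; case: ifP => _; rewrite ?ltry//= -EFinB ltry.
by rewrite product_measure1E// lte_mul_pinfty// ge0_fin_numE.
Qed.

(** Planar Lebesgue measure with the sigma-finite structure that the density formula asks for. *)
Definition lebesgue_square (R : realType) :
    {sigma_finite_measure set (measurableTypeR R * measurableTypeR R)%type -> \bar R} :=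
  HB.pack (@lebesgue_measure R \x @lebesgue_measure R)%E
    (Measure_isSigmaFinite.Build _ _ _ (@lebesgue_measure R \x @lebesgue_measure R)%E
      (sigma_finite_lebesgue_square R)).

(** * Moments of the kernel at one site and at two *)

Section kernel_expectations.
Context (R : realType) (disp : measure_display) (T : measurableType disp).
Variable P : probability T R.
Local Notation leb := (@lebesgue_measure R).
Variables (f : R -> R) (Mf : R).
Hypothesis f_ge0 : forall x, 0 <= f x.
Hypothesis fc : continuous f.
Hypothesis f_le : forall x, f x <= Mf.

Let mf : measurable_fun [set: R] f. Proof. exact: continuous_measurable_fun. Qed.

(** The substitution [t = x + b * u] produces the factor [b] behind every power of the bandwidth
    below. As an identity of extended reals it also gives the finiteness of the integral on the
    right. *)
Lemma Ex_affine_density (Y : T -> R) (h : R -> R) (x b : R) :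
  measurable_fun [set: T] Y -> has_density P leb Y f -> 0 < b ->
  continuous h -> (forall u, 0 <= h u) -> bmeas h ->
  ((Ex P (fun w => h ((Y w - x) / b)))%:E =
   b%:E * \int[leb]_u (h u * f (x + b * u))%:E)%E.
Proof.
move=> mY [_ _ dY] b0 ch h0 bh.
have ca : continuous (fun t : R => (t - x) / b).
  by move=> t; apply: differentiable_continuous; exact/derivable1_diffP.
have cg : continuous (fun t : R => h ((t - x) / b)).
  by move=> t; apply: (@continuous_comp _ _ _ (fun t : R => (t - x) / b)); [exact: ca|exact: ch].
have bg : bmeas (fun t : measurableTypeR R => h ((t - x) / b)).
  split; first exact: continuous_measurable_fun.
  by have [_ [M hM]] := bh; exists M.
have mY' : measurable_fun [set: T] (Y : T -> measurableTypeR R) := mY.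
pose nu := distribution P (rv_of P mY').
have -> : Ex P (fun w => h ((Y w - x) / b)) = Ex nu (fun t => h ((t - x) / b)).
  by rewrite Ex_distribution.
rewrite (EFin_Ex _ bg).
have E := @ge0_integral_density _ (measurableTypeR R) R leb f mf nu (fun t => (h ((t - x) / b))%:E) dY.
rewrite E => [| |t]; last 2 first.
- by apply/measurable_EFinP; exact: bg.1.
- by rewrite lee_fin; exact: h0.
rewrite (ge0_integral_affine x b0 (G := fun t => h ((t - x) / b) * f t)).
- congr (_ * _)%E; apply: eq_integral => u _; congr (h _ * _)%:E.
  by field; rewrite gt_eqF.
- by move=> t; apply: continuousM; [exact: cg|exact: fc].
- by move=> t; rewrite mulr_ge0.
Qed.

Variables (K : R -> R) (Lk : R).
Hypothesis Lk0 : 0 < Lk.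
Hypothesis lipK : forall x y, `|K x - K y| <= Lk * `|x - y|.
Hypothesis iK : leb.-integrable [set: R] (EFin \o K).
Let J := Rintegral leb setT (fun x => `|K x|).

Let cK : continuous K. Proof. exact: lipschitz_continuous Lk0 lipK. Qed.
Let bK : bmeas K.
Proof.
split; first exact: continuous_measurable_fun.
by have [M _ hM] := kernel_bounded Lk0 lipK iK; exists M.
Qed.
Let cnK : continuous (fun x => `|K x|).
Proof. by move=> x; apply: continuous_comp; [exact: cK|exact: norm_continuous]. Qed.
Let caff (a b : R) : continuous (fun u : R => a + b * u).
Proof. by move=> t; apply: differentiable_continuous; exact/derivable1_diffP. Qed.
Let mnK : measurable_fun [set: R] (fun x => `|K x|%:E).
Proof. by apply/measurable_EFinP; exact: continuous_measurable_fun. Qed.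

Let JE : (\int[leb]_x `|K x|%:E = J%:E)%E.
Proof.
rewrite /J /Rintegral fineK//.
by have := integrable_fin_num measurableT (integrable_norm iK).
Qed.

Let Mf0 : 0 <= Mf. Proof. exact: le_trans (f_ge0 0) (f_le 0). Qed.

Lemma Ex_norm_kernel (Y : T -> R) (x b : R) :
  measurable_fun [set: T] Y -> has_density P leb Y f -> 0 < b ->
  Ex P (fun w => `|K ((Y w - x) / b)|) <= Mf * J * b.
Proof.
move=> mY dY b0; rewrite -lee_fin (Ex_affine_density x mY dY b0 cnK)//; last exact: bmeas_norm.
rewrite mulrC EFinM lee_pmul2l ?lte_fin// EFinM -JE -ge0_integralZl//.
apply: ge0_le_integral => //.
- by move=> u _; rewrite lee_fin mulr_ge0.
- apply/measurable_EFinP; apply: measurable_funM; first exact: continuous_measurable_fun.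
  apply: continuous_measurable_fun => u; apply: continuous_comp; [exact: caff|exact: fc].
- by apply/measurable_EFinP; apply: measurable_funM => //; exact: continuous_measurable_fun.
by move=> u _; rewrite -EFinM lee_fin mulrC ler_wpM2r.
Qed.

(** Tonelli under the bounded joint density: one factor [b] for each variable. The gain of a power
    over the one-site moments makes near pairs negligible. *)
Lemma Ex_kernel_pair (Y Y' : T -> R) (q : R * R -> R) (kappa x y b : R) :
  measurable_fun [set: T] Y -> measurable_fun [set: T] Y' ->
  has_density P (leb \x leb)%E (fun w => (Y w, Y' w)) q ->
  (forall s t, q (s, t) <= kappa) -> 0 < kappa -> 0 < b ->
  Ex P (fun w => `|K ((Y w - x) / b)| * `|K ((Y' w - y) / b)|) <= kappa * (J * b) ^+ 2.
Proof.
move=> mY mY' [mq q0 dq] qk k0 b0.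
pose T2 := (measurableTypeR R * measurableTypeR R)%type.
pose th w : T2 := (Y w, Y' w).
have mth : measurable_fun [set: T] th by exact: measurable_fun_pair.
pose k x t := `|K ((t - x) / b)|.
have ck z : continuous (k z).
  have ca : continuous (fun t : R => (t - z) / b).
    by move=> t; apply: differentiable_continuous; exact/derivable1_diffP.
  exact: (continuous_fun_comp ca cnK).
have bk z : bmeas (k z : measurableTypeR R -> R).
  split; first exact: continuous_measurable_fun.
  by have [_ [M hM]] := bK; exists M => t; rewrite /k normr_id.
have bk2 : bmeas (fun z : T2 => k x z.1 * k y z.2).
  apply: bmeasM; first by apply: (bmeas_comp (th := fst) (F := k x)) => //; exact: bk.
  by apply: (bmeas_comp (th := snd) (F := k y)) => //; exact: bk.
have intk z : (\int[leb]_t (k z t)%:E = (J * b)%:E)%E.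
  rewrite (ge0_integral_affine z b0 (ck z)); last by move=> t; exact: normr_ge0.
  rewrite mulrC EFinM -JE; congr (_ * _)%E; apply: eq_integral => u _; congr (`|K _|%:E).
  by field; rewrite gt_eqF.
pose nu := distribution P (rv_of P mth).
have -> : Ex P (fun w => `|K ((Y w - x) / b)| * `|K ((Y' w - y) / b)|) =
    Ex nu (fun z => k x z.1 * k y z.2) by rewrite Ex_distribution.
rewrite -lee_fin (EFin_Ex _ bk2).
have E := @ge0_integral_density _ T2 R (lebesgue_square R) q mq nu (fun z => (k x z.1 * k y z.2)%:E) dq.
rewrite E => [| |z]; last 2 first.
- by apply/measurable_EFinP; exact: bk2.1.
- by rewrite lee_fin mulr_ge0// normr_ge0.
have mk2 : measurable_fun [set: T2] (fun z => (k x z.1 * k y z.2)%:E).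
  by apply/measurable_EFinP; exact: bk2.1.
apply: (@le_trans _ _ (\int[(leb \x leb)%E]_z (kappa%:E * (k x z.1 * k y z.2)%:E))%E).
  apply: ge0_le_integral => //.
  - by move=> z _; rewrite -EFinM lee_fin mulr_ge0// mulr_ge0// normr_ge0.
  - by apply: emeasurable_funM => //; exact/measurable_EFinP.
  - by apply: emeasurable_funM => //; exact: measurable_cst.
  by move=> [s t] _; rewrite -!EFinM lee_fin mulrC ler_wpM2r// mulr_ge0// normr_ge0.
rewrite ge0_integralZl//; [|by move=> z _; rewrite lee_fin mulr_ge0// normr_ge0|by rewrite lee_fin ltW].
rewrite fubini_tonelli1//; last by move=> z; rewrite lee_fin mulr_ge0// normr_ge0.
rewrite EFinM lee_pmul2l ?lte_fin// /fubini_F /=.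
have mkE z : measurable_fun [set: measurableTypeR R] (fun t => (k z t)%:E).
  by apply/measurable_EFinP; exact: (bk z).1.
have inner s : (\int[leb]_t (k x s * k y t)%:E = (J * b)%:E * (k x s)%:E)%E.
  transitivity ((k x s)%:E * \int[leb]_t (k y t)%:E)%E; last by rewrite intk muleC.
  rewrite -ge0_integralZl// ?lee_fin ?normr_ge0//.
  by move=> t _; rewrite lee_fin normr_ge0.
under eq_integral do rewrite inner.
rewrite ge0_integralZl//; last 2 first.
- by move=> t _; rewrite lee_fin normr_ge0.
- by rewrite lee_fin mulr_ge0 ?(ltW b0)// Rintegral_ge0.
by rewrite intk -EFinM expr2.
Qed.

Variable b : nat -> R.
Hypothesis b_gt0 : \forall n \near \oo, 0 < b n.
Hypothesis b_cvg0 : b n @[n --> \oo] --> (0 : R).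
Variable Y : T -> R.
Hypothesis mY : measurable_fun [set: T] Y.
Hypothesis dY : has_density P leb Y f.

Let f_bu (x u : R) : f (x + b n * u) @[n --> \oo] --> f x.
Proof.
apply: continuous_cvg; first exact: fc.
rewrite -[X in _ --> X]addr0; apply: cvgD; first exact: cvg_cst.
by rewrite -(mul0r u); apply: cvgMl.
Qed.

Let mfb (x : R) n : measurable_fun [set: R] (fun u => f (x + b n * u)).
Proof.
by apply: continuous_measurable_fun => u; apply: continuous_comp; [exact: caff|exact: fc].
Qed.

(** Bochner's lemma for the kernel [K^2]: [f] is continuous at [x], and [Mf * K^2] dominates. *)
Lemma cvg_Ex_kernel_sqr (x : R) : leb.-integrable setT (fun u => (K u ^+ 2)%:E) ->
  (b n)^-1 * Ex P (fun w => K ((Y w - x) / b n) ^+ 2) @[n --> \oo] -->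
  f x * Rintegral leb setT (fun u => K u ^+ 2).
Proof.
move=> iK2.
have H : (\int[leb]_u (K u ^+ 2 * f (x + b n * u))%:E)%E @[n --> \oo] -->
    (\int[leb]_u (K u ^+ 2 * f x)%:E)%E.
  apply: (@dominated_cvg _ _ _ leb _ measurableT _ _ (fun u => (Mf * K u ^+ 2)%:E)) => //.
  - move=> n; apply/measurable_EFinP; apply: measurable_funM => //.
      exact: (bmeasX 2 bK).1.
    exact: mfb.
  - move=> u _; apply: cvg_EFin; first exact: nearW.
    by apply: cvgMr; exact: f_bu.
  - exact: integrable_scale.
  - move=> n u _; have h : 0 <= K u ^+ 2 * f (x + b n * u) by rewrite mulr_ge0 ?sqr_ge0.
    by rewrite /= lee_fin (ger0_norm h) mulrC ler_wpM2r ?sqr_ge0.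
have E : (\int[leb]_u (K u ^+ 2 * f x)%:E)%E = (f x * Rintegral leb setT (fun u => K u ^+ 2))%:E.
  rewrite -RintegralZl// /Rintegral fineK.
    by apply: eq_integral => u _; rewrite mulrC.
  exact: (integrable_fin_num measurableT (integrable_scale _ iK2)).
move: H; rewrite E => /fine_cvgP[_ H].
apply: cvg_trans H; apply: near_eq_cvg; near=> n.
have bn0 : 0 < b n by near: n.
have c2 : continuous (fun u => K u ^+ 2) by move=> u; apply: continuousM; exact: cK.
have := Ex_affine_density x mY dY bn0 c2 (fun u => sqr_ge0 _) (bmeasX 2 bK).
move=> /(congr1 (fun z => ((b n)^-1%:E * z)%E)).
by rewrite muleA -!EFinM mulVf ?gt_eqF// mul1e /= => <-.
Unshelve. all: by end_near. Qed.

Lemma cvg_Ex_kernel_cross (x y : R) : x != y ->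
  (b n)^-1 * Ex P (fun w => `|K ((Y w - x) / b n)| * `|K ((Y w - y) / b n)|) @[n --> \oo] --> 0.
Proof.
move=> xy; have b_small e : 0 < e -> \forall n \near \oo, `|b n| <= e.
  move=> e0; move/cvgrPdist_le : b_cvg0 => /(_ _ e0).
  by apply: filterS => n; rewrite sub0r normrN.
have [M M0 hM] := kernel_bounded Lk0 lipK iK.
have ct n : continuous (fun u : R => u + (x - y) / b n).
  by move=> u; apply: differentiable_continuous; exact/derivable1_diffP.
have cKt n : continuous (fun u : R => `|K (u + (x - y) / b n)|).
  exact: (continuous_fun_comp (ct n) cnK).
have H : (\int[leb]_u (`|K u| * `|K (u + (x - y) / b n)| * f (x + b n * u))%:E)%E @[n --> \oo] -->
    (\int[leb]_u (cst 0 u : \bar R))%E.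
  apply: (@dominated_cvg _ _ _ leb _ measurableT _ _ (fun u => (M * Mf * `|K u|)%:E)) => //.
  - move=> n; apply/measurable_EFinP; apply: measurable_funM => //.
      by apply: measurable_funM => //; exact: continuous_measurable_fun.
    exact: mfb.
  - move=> u _; apply: cvg_EFin; first exact: nearW.
    apply/cvgrPdist_lt => e e0.
    have [r r0 Hr] := kernel_vanishes Lk0 lipK iK (divr_gt0 e0 (ltr_wpDl (mulr_ge0 (ltW M0) Mf0) ltr01)).
    near=> n; rewrite sub0r normrN ger0_norm ?mulr_ge0//.
    have bn0 : 0 < b n by near: n.
    have : `|K (u + (x - y) / b n)| < e / (M * Mf + 1).
      (* As soon as [b n] is at most [|x - y| / (r + |u|)], the shifted argument has modulus at
         least [r]. *)
      apply: Hr; have := lerB_dist ((x - y) / b n) (- u); rewrite opprK normrN [_ + u]addrC.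
      suff : r + `|u| <= `|(x - y) / b n| by lra.
      rewrite normrM normfV (gtr0_norm bn0) ler_pdivlMr// mulrC -ler_pdivlMr; last by rewrite ltr_wpDr.
      rewrite (le_trans (ler_norm _))//.
      near: n; apply: b_small; rewrite divr_gt0 ?normr_gt0 ?subr_eq0// ltr_wpDr//.
    move=> h; apply: (@le_lt_trans _ _ (M * Mf * (e / (M * Mf + 1)))).
      rewrite /= mulrAC; apply: ler_pM; [exact: mulr_ge0|exact: normr_ge0|exact: ler_pM|exact: ltW].
    rewrite mulrCA gtr_pMr// ltr_pdivrMr ?mul1r ?ltrDl// ltr_wpDl// mulr_ge0// ltW//.
  - exact: integrable_scale (integrable_norm iK).
  - move=> n u _; rewrite /= lee_fin ger0_norm ?mulr_ge0//.
    by rewrite -mulrA mulrC ler_wpM2r// ler_pM.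
rewrite integral_cst// mul0e in H.
move: H; rewrite (_ : 0%E = (0 : R)%:E)// => /fine_cvgP[_ H].
apply: cvg_trans H; apply: near_eq_cvg; near=> n.
have bn0 : 0 < b n by near: n.
have c2 : continuous (fun u => `|K u| * `|K (u + (x - y) / b n)|).
  exact: continuous_fun_mul.
have b2 : bmeas (fun u => `|K u| * `|K (u + (x - y) / b n)|).
  split; first exact: continuous_measurable_fun.
  by exists (M * M) => u; rewrite normrM !normr_id ler_pM.
have := Ex_affine_density x mY dY bn0 c2 (fun u => mulr_ge0 (normr_ge0 _) (normr_ge0 _)) b2.
move=> /(congr1 (fun z => ((b n)^-1%:E * z)%E)).
rewrite muleA -!EFinM mulVf ?gt_eqF// mul1e /= => <- /=.
congr (_ * _); apply: eq_Ex => w; congr (_ * `|K _|); field.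
by rewrite gt_eqF.
Unshelve. all: by end_near. Qed.

End kernel_expectations.

Section kernel_combination.
Context (R : realType) (disp : measure_display) (T : measurableType disp).
Variable P : probability T R.
Local Notation leb := (@lebesgue_measure R).
Variables (f : R -> R) (Mf : R).
Hypothesis f_ge0 : forall x, 0 <= f x.
Hypothesis fc : continuous f.
Hypothesis f_le : forall x, f x <= Mf.
Variables (K : R -> R) (Lk : R).
Hypothesis Lk0 : 0 < Lk.
Hypothesis lipK : forall x y, `|K x - K y| <= Lk * `|x - y|.
Hypothesis iK : leb.-integrable [set: R] (EFin \o K).
Let J := Rintegral leb setT (fun x => `|K x|).
Variables (k : nat) (x a : 'I_k -> R).
Let A := \sum_l `|a l|.

(** The [Phi] of the overview, with [t - x l] for [x l - t]: the theorem applies it to the reversed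
    kernel. *)
Definition kernel_sum (b t : R) := \sum_l a l * K ((t - x l) / b).

Let A0 : 0 <= A. Proof. exact: sumr_ge0. Qed.
Let cK : continuous K. Proof. exact: lipschitz_continuous Lk0 lipK. Qed.
Let mK : measurable_fun [set: R] K. Proof. exact: continuous_measurable_fun. Qed.

Let norm_kernel_sum b t : `|kernel_sum b t| <= \sum_l `|a l| * `|K ((t - x l) / b)|.
Proof.
by apply: le_trans (ler_norm_sum _ _ _) _; apply: ler_sum => l _; rewrite normrM.
Qed.

Lemma kernel_sum_bounded : exists2 M, 0 < M & forall b t, `|kernel_sum b t| <= M.
Proof.
have [M M0 hM] := kernel_bounded Lk0 lipK iK.
exists ((A + 1) * M) => [|b t]; first by rewrite mulr_gt0// ltr_wpDl.
apply: le_trans (norm_kernel_sum _ _) _.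
apply: (@le_trans _ _ (A * M)); last by rewrite ler_pM2r// lerDl.
by rewrite mulr_suml; apply: ler_sum => l _; rewrite ler_wpM2l.
Qed.

Lemma measurable_kernel_sum b : measurable_fun [set: R] (kernel_sum b).
Proof.
apply: measurable_sum => l; apply: measurable_funM => //.
apply: measurableT_comp => //; apply: measurable_funM => //.
exact: measurable_funB.
Qed.

Lemma kernel_sum_lipschitz b s t : 0 < b ->
  `|kernel_sum b s - kernel_sum b t| <= A * Lk / b * `|s - t|.
Proof.
move=> b0; rewrite /kernel_sum -sumrB; apply: le_trans (ler_norm_sum _ _ _) _.
rewrite !mulr_suml; apply: ler_sum => l _.
rewrite -mulrBr normrM -!mulrA ler_wpM2l//; apply: le_trans (lipK _ _) _.
rewrite (_ : _ - _ = b^-1 * (s - t)); last by ring.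
by rewrite normrM gtr0_norm ?invr_gt0.
Qed.

Section one_variable.
Variable Y : T -> R.
Hypothesis mY : measurable_fun [set: T] Y.

Lemma bmeas_kernel_sum b : bmeas (fun w => kernel_sum b (Y w)).
Proof.
split; first exact: measurableT_comp (measurable_kernel_sum b) mY.
by have [M _ hM] := kernel_sum_bounded; exists M.
Qed.

Let bK b z : bmeas (fun w => K ((Y w - z) / b)).
Proof.
have [M M0 hM] := kernel_bounded Lk0 lipK iK.
split; last by exists M.
apply: measurableT_comp => //; apply: measurable_funM => //.
exact: measurable_funB.
Qed.

Hypothesis dY : has_density P leb Y f.

Lemma Ex_norm_kernel_sum b : 0 < b -> Ex P (fun w => `|kernel_sum b (Y w)|) <= A * (Mf * J) * b.
Proof.
move=> b0; apply: (@le_trans _ _ (Ex P (fun w => \sum_l `|a l| * `|K ((Y w - x l) / b)|))).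
  by apply: Ex_le => //; [exact/bmeas_norm/bmeas_kernel_sum|bm; exact: bK].
rewrite Ex_sum; last by move=> l; bm; exact: bK.
rewrite !mulr_suml; apply: ler_sum => l _.
rewrite ExZl; last by apply: bmeas_norm; exact: bK.
rewrite -mulrA ler_wpM2l//.
exact: Ex_norm_kernel f_ge0 fc f_le _ _ Lk0 lipK iK _ _ _ mY dY b0.
Qed.

Hypothesis injx : injective x.
Variable b : nat -> R.
Hypothesis b_gt0 : \forall n \near \oo, 0 < b n.
Hypothesis b_cvg0 : b n @[n --> \oo] --> (0 : R).
Hypothesis iK2 : leb.-integrable setT (fun u => (K u ^+ 2)%:E).

Lemma cvg_Ex_kernel_sum_sqr :
  (b n)^-1 * Ex P (fun w => kernel_sum (b n) (Y w) ^+ 2) @[n --> \oo] -->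
  \sum_l a l ^+ 2 * (f (x l) * Rintegral leb setT (fun u => K u ^+ 2)).
Proof.
pose k_ n l w := K ((Y w - x l) / b n).
have bk n l : bmeas (k_ n l) by exact: bK.
have E n : (b n)^-1 * Ex P (fun w => kernel_sum (b n) (Y w) ^+ 2) =
    \sum_l \sum_m (a l * a m) * ((b n)^-1 * Ex P (fun w => k_ n l w * k_ n m w)).
  transitivity ((b n)^-1 * Ex P (fun w => \sum_l \sum_m (a l * a m) * (k_ n l w * k_ n m w))).
    congr (_ * _); apply: eq_Ex => w; rewrite expr2 /kernel_sum mulr_suml.
    apply: eq_bigr => l _; rewrite mulr_sumr; apply: eq_bigr => m _.
    by rewrite /k_; ring.
  have bkn l : bmeas (k_ n l) by [].
  rewrite Ex_sum; last by move=> l; bm.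
  rewrite mulr_sumr; apply: eq_bigr => l _; rewrite Ex_sum; last by move=> m; bm.
  rewrite mulr_sumr; apply: eq_bigr => m _; rewrite ExZl; last by bm.
  by rewrite mulrCA.
under eq_fun do rewrite E.
apply: cvg_bigsum => l.
rewrite (_ : a l ^+ 2 * _ = \sum_m (a l * a m) * (if m == l then f (x l) * Rintegral leb setT (fun u => K u ^+ 2) else 0)); last first.
  rewrite (bigD1 l)//= eqxx big1 ?addr0 ?expr2// => m /negbTE ->.
  by rewrite mulr0.
apply: cvg_bigsum => m; apply: cvgZr; case: eqP => [->|/eqP ml].
  under eq_fun do under eq_Ex do rewrite -expr2.
  exact: cvg_Ex_kernel_sqr f_ge0 fc f_le _ _ Lk0 lipK iK _ b_gt0 b_cvg0 _ mY dY _ iK2.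
apply: norm_cvg0.
have xlm : x l != x m by rewrite (inj_eq injx) eq_sym.
have H := cvg_Ex_kernel_cross f_ge0 fc f_le Lk0 lipK iK b_gt0 b_cvg0 mY dY xlm.
apply: (squeeze_cvgr _ (cvg_cst 0) H); near=> n.
have bn0 : 0 < b n by near: n.
rewrite normr_ge0/= normrM gtr0_norm ?invr_gt0// ler_pM2l ?invr_gt0//.
apply: le_trans (Ex_norm _ _) _; first by bm.
by apply: Ex_le; [by bm|by bm; exact: bK|move=> w; rewrite normrM].
Unshelve. all: by end_near. Qed.

End one_variable.

Lemma Ex_kernel_sum_pair (Y Y' : T -> R) (q : R * R -> R) (kappa b : R) :
  measurable_fun [set: T] Y -> measurable_fun [set: T] Y' ->
  has_density P (leb \x leb)%E (fun w => (Y w, Y' w)) q ->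
  (forall s t, q (s, t) <= kappa) -> 0 < kappa -> 0 < b ->
  Ex P (fun w => `|kernel_sum b (Y w) * kernel_sum b (Y' w)|) <=
  A ^+ 2 * (kappa * J ^+ 2) * b ^+ 2.
Proof.
move=> mY mY' dq qk k0 b0; have [M M0 hM] := kernel_bounded Lk0 lipK iK.
have bK z (Z : T -> R) : measurable_fun [set: T] Z -> bmeas (fun w => K ((Z w - z) / b)).
  move=> mZ; split; last by exists M.
  apply: measurableT_comp => //; apply: measurable_funM => //.
  exact: measurable_funB.
have bKl l : bmeas (fun w => K ((Y w - x l) / b)) by exact: bK.
have bKm m : bmeas (fun w => K ((Y' w - x m) / b)) by exact: bK.
apply: (@le_trans _ _ (Ex P (fun w => \sum_l \sum_m (`|a l| * `|a m|) *
    (`|K ((Y w - x l) / b)| * `|K ((Y' w - x m) / b)|)))).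
  apply: Ex_le; first by apply: bmeas_norm; apply: bmeasM; exact: bmeas_kernel_sum.
    by bm.
  move=> w; rewrite normrM.
  apply: le_trans (ler_pM _ _ (norm_kernel_sum _ _) (norm_kernel_sum _ _)) _ => //.
  rewrite mulr_suml; apply: ler_sum => l _; rewrite mulr_sumr; apply: ler_sum => m _.
  by rewrite mulrACA.
rewrite Ex_sum; last by move=> ?; bm.
rewrite (_ : A ^+ 2 * _ * _ = \sum_l \sum_m `|a l| * `|a m| * (kappa * (J * b) ^+ 2)); last first.
  rewrite (_ : A ^+ 2 * _ * _ = A * (A * (kappa * (J * b) ^+ 2))); last by ring.
  rewrite mulr_suml; apply: eq_bigr => l _; rewrite mulr_suml mulr_sumr; apply: eq_bigr => m _.
  by rewrite mulrA.
apply: ler_sum => l _; rewrite Ex_sum; last by move=> ?; bm.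
apply: ler_sum => m _; rewrite ExZl; last by bm.
rewrite ler_wpM2l// ?mulr_ge0//.
exact: (Ex_kernel_pair Lk0 lipK iK _ _ mY mY' dq qk k0 b0).
Qed.

End kernel_combination.

(** * Block approximation *)

Section lattice_boxes.
Variable d : nat.
Implicit Types (i j : lattice d).

Lemma lnorm_leP i (N : nat) : reflect (forall k, (`|i ord0 k| <= N)%N) (lnorm i <= N)%N.
Proof. by apply: (iffP (bigop.bigmax_leqP _ _ _)) => H k => [|_]; exact: H. Qed.

Lemma lnormN i : lnorm (- i) = lnorm i.
Proof. by apply: eq_bigr => k _; rewrite mxE abszN. Qed.

Lemma lnormB i j : lnorm (i - j) = lnorm (j - i).
Proof. by rewrite -lnormN opprB. Qed.

Lemma lnormD i j : (lnorm (i + j) <= lnorm i + lnorm j)%N.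
Proof.
apply/lnorm_leP => k; rewrite mxE.
have := elimT (lnorm_leP i _) (leqnn _) k; have := elimT (lnorm_leP j _) (leqnn _) k.
move: (i ord0 k) (j ord0 k) (lnorm i) (lnorm j) => a c p q; lia.
Qed.

Lemma lnorm0 : lnorm (0 : lattice d) = 0%N.
Proof. by apply/eqP; rewrite -leqn0; apply/lnorm_leP => k; rewrite mxE. Qed.

Definition box (N : nat) : seq (lattice d) :=
  [seq \row_k ((f k : nat)%:Z - N%:Z) | f : {ffun 'I_d -> 'I_(2 * N).+1}].

Lemma box_uniq N : uniq (box N).
Proof.
rewrite map_inj_uniq ?enum_uniq// => f g /rowP fg; apply/ffunP => k.
by have := fg k; rewrite !mxE => /addIr [] /val_inj.
Qed.

Lemma size_box N : size (box N) = ((2 * N).+1 ^ d)%N.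
Proof. by rewrite size_map -cardE card_ffun !card_ord. Qed.

Lemma mem_box N i : (i \in box N) = (lnorm i <= N)%N.
Proof.
apply/idP/idP => [/mapP[f _ ->]|/lnorm_leP iN].
  by apply/lnorm_leP => k; rewrite mxE; case: (f k) => v /= vN; lia.
apply/mapP; exists [ffun k => inord `|i ord0 k + N%:Z|]; first by rewrite mem_enum.
by apply/rowP => k; rewrite mxE ffunE inordK; have := iN k; move: (i ord0 k) => a; lia.
Qed.

End lattice_boxes.

(** * Freezing the distant innovations *)

Section block_approximation.
Context (R : realType) (disp : measure_display) (T : measurableType disp).
Variable P : probability T R.
Variables (d : nat) (eps eps' : lattice d -> T -> R).
Hypothesis meps : forall j, measurable_fun [set: T] (eps j).
Hypothesis meps' : forall j, measurable_fun [set: T] (eps' j).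
Let e w : conf R (lattice d) := fun j => eps j w.
Let e' w : conf R (lattice d) := fun j => eps' j w.
Variable p : set R -> R.
Hypothesis iid_eps : iid_law P p eps.
Hypothesis copy : forall A B : set (conf R (lattice d)), measurable A -> measurable B ->
  P (e @^-1` A `&` e' @^-1` B) = (P (e @^-1` A) * P (e @^-1` B))%E.
Local Notation conf_d := (conf R (lattice d)).

Let me_ : measurable_fun [set: T] e. Proof. exact: measurable_conf. Qed.
Let me'_ : measurable_fun [set: T] e'. Proof. exact: measurable_conf. Qed.

(** The configuration as seen from site [i], the field being [g (reflected i (e w))]. The
    relabelling [s |-> i - s] is an involution, so it preserves the law. *)
Definition reflected (i : lattice d) (a : conf_d) : conf_d := fun s => a (i - s).

Lemma measurable_reflected i : measurable_fun [set: conf_d] (reflected i).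
Proof. by apply: measurable_conf => j; exact: measurable_coord. Qed.

Lemma reflected_mix i (B : pred (lattice d)) a a' :
  reflected i (mix B a a') = mix (fun s => B (i - s)) (reflected i a) (reflected i a').
Proof. by []. Qed.

Lemma Ex_reflected i (H : conf_d * conf_d -> R) : bmeas H ->
  Ex P (fun w => H (reflected i (e w), reflected i (e' w))) = Ex P (fun w => H (e w, e' w)).
Proof.
move=> bH; apply: (Ex_reindex meps meps' iid_eps copy (pi := fun s => i - s) (pi' := fun s => i - s)) => // s.
by rewrite opprB addrC subrK.
Qed.

Lemma Ex_reflected1 i (F : conf_d -> R) : bmeas F ->
  Ex P (fun w => F (reflected i (e w))) = Ex P (fun w => F (e w)).
Proof.
move=> bF; apply: (Ex_reflected i (H := fun z => F z.1)).
by apply: bmeas_comp bF; exact: measurable_fst.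
Qed.

Let bm_e (F : conf_d -> R) : bmeas F -> bmeas (fun w => F (e w)).
Proof. exact: bmeas_comp. Qed.
Let bm_r i (F : conf_d -> R) : bmeas F -> bmeas (fun a => F (reflected i a)).
Proof. by apply: bmeas_comp; exact: measurable_reflected. Qed.
Let bm_mix B (F : conf_d -> R) : bmeas F -> bmeas (fun w => F (mix B (e w) (e' w))).
Proof. by apply: bmeas_comp; exact: measurable_mix. Qed.
Let bm_pmix B (F : conf_d -> R) : bmeas F ->
  bmeas (fun z : conf_d * conf_d => F (mix B z.1 z.2)).
Proof. by apply: bmeas_comp; exact: measurable_mix. Qed.
Let bm_fst (F : conf_d -> R) : bmeas F -> bmeas (fun z : conf_d * conf_d => F z.1).
Proof. by apply: bmeas_comp; exact: measurable_fst. Qed.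

(** The dependence coefficient of a functional. By stationarity, resampling the innovation [j]
    changes the value at site [i] by the influence at [i - j]. *)
Definition influence (F : conf_d -> R) (s : lattice d) : R :=
  L2 P (fun w => F (e w) - F (mix (pred1 s) (e w) (e' w))).

Lemma influence_reflected (F : conf_d -> R) i j : bmeas F ->
  L2 P (fun w => F (reflected i (e w)) - F (reflected i (mix (pred1 j) (e w) (e' w)))) =
  influence F (i - j).
Proof.
move=> bF; rewrite /influence /L2; congr Num.sqrt.
have bH : bmeas (fun z : conf_d * conf_d => (F z.1 - F (mix (pred1 (i - j)) z.1 z.2)) ^+ 2).
  by bm; [exact: bm_fst|exact: bm_pmix].
rewrite -(Ex_reflected i bH); apply: eq_Ex => w /=; congr ((_ - F _) ^+ 2).
rewrite reflected_mix; apply/funext => s; rewrite /mix /=.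
by rewrite (_ : (i - s == j) = (s == i - j))//; apply/eqP/eqP => [<-|->]; rewrite opprB addrC subrK.
Qed.

Variables (G : conf_d -> R) (m : nat) (tau : R).
Hypothesis bG : bmeas G.
Hypothesis tau0 : 0 < tau.
Let far : pred (lattice d) := fun s => (m < lnorm s)%N.
Hypothesis tail : forall s : seq (lattice d), uniq s -> all far s ->
  \sum_(j <- s) influence G j <= tau.

(* By Fubini some value c of the independent copy does at least as well as its
   average, so that no conditional expectation is needed. *)
Lemma block_copy_exists : exists c : conf_d,
  L2 P (fun w => G (e w) - G (mix far (e w) c)) <= 2 * tau.
Proof.
have H := L2_mix_sup meps meps' iid_eps copy (@box_uniq d) _ _ bG _ tail.
have {}H : L2 P (fun w => G (e w) - G (mix far (e w) (e' w))) <= tau.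
  apply: H => [N M j NM|j|].
  - by rewrite !mem_box => /leq_trans; apply.
  - by exists (lnorm j); rewrite mem_box.
  - by exists m => j; rewrite mem_box leqNgt.
pose H2 (z : conf_d * conf_d) := (G z.1 - G (mix far z.1 z.2)) ^+ 2.
have bH2 : bmeas H2 by rewrite /H2; bm; [exact: bm_fst|exact: bm_pmix].
(* The factor 2 provides the strict inequality that the Fubini argument requires. *)
have [|w' Hw'] := @Ex_fubini_le _ _ _ P _ _ _ meps meps' copy H2 ((2 * tau) ^+ 2) bH2.
  rewrite /H2 /= -L2_sqr; apply: (@le_lt_trans _ _ (tau ^+ 2)).
    by rewrite lerXn2r ?nnegrE ?L2_ge0 ?(ltW tau0).
  rewrite -subr_gt0 (_ : _ - _ = 3 * tau ^+ 2); last by ring.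
  by rewrite mulr_gt0 ?exprn_gt0.
exists (e w'); rewrite -(@ler_pXn2r _ 2)// ?nnegrE ?L2_ge0 ?mulr_ge0 ?(ltW tau0)//.
by rewrite L2_sqr.
Qed.

Variable c : conf_d.
Definition block (a : conf_d) : R := G (mix far a c).
Hypothesis L2c : L2 P (fun w => G (e w) - block (e w)) <= 2 * tau.
Let D a := G a - block a.

Lemma bmeas_block : bmeas block.
Proof.
apply: (bmeas_comp _ bG); apply: measurable_mix; first exact: measurable_id.
exact: measurable_cst.
Qed.
Let bD : bmeas D. Proof. exact: bmeasB bG bmeas_block. Qed.

(** Bounds the sum of all influences of the error [D]: [4 * tau], twice its L2 bound, for each
    coordinate within distance [m], and [tau] for all the others together. *)
Let V := (4 * (size (box d m))%:R + 1) * tau.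
Let V0 : 0 <= V. Proof. by rewrite mulr_ge0 ?(ltW tau0)// addr_ge0// mulr_ge0. Qed.

Let influence_far j : far j -> influence D j = influence G j.
Proof.
move=> fj; apply: eq_L2 => w; congr (_ ^+ 2); rewrite /D /block.
rewrite (_ : mix far (mix _ _ _) c = mix far (e w) c); first by ring.
apply/funext => s; rewrite /mix; case: ifP => // fs /=.
by case: eqP => // E; move: fs; rewrite E fj.
Qed.

Let influence_near j : influence D j <= 4 * tau.
Proof.
rewrite /influence; apply: le_trans (L2B P (bm_e bD) (bm_mix _ bD)) _.
have -> : L2 P (fun w => D (mix (pred1 j) (e w) (e' w))) = L2 P (fun w => D (e w)).
  by rewrite /L2; congr Num.sqrt; exact: (Ex_mix1 meps meps' iid_eps copy _ (bmeasX 2 bD)).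
by move: L2c; rewrite /D; lra.
Qed.

Let influence_sum s : uniq s -> \sum_(j <- s) influence D j <= V.
Proof.
move=> us; rewrite (bigID far)/= /V mulrDl mul1r addrC; apply: lerD; last first.
  rewrite -big_filter (eq_big_seq (influence G)) => [|j]; last first.
    by rewrite mem_filter => /andP[/influence_far].
  by apply: tail; [exact: filter_uniq|exact: filter_all].
apply: (@le_trans _ _ (\sum_(j <- s | ~~ far j) 4 * tau)).
  by apply: ler_sum => j _; exact: influence_near.
rewrite -big_filter big_const_seq count_predT iter_addr_0 -[leLHS]mulr_natr mulrAC ler_wpM2r ?(ltW tau0)//.
rewrite ler_pM2l// ler_nat; apply: uniq_leq_size; first exact: filter_uniq.
by move=> j; rewrite mem_filter mem_box leqNgt => /andP[].
Qed.

Variable L : seq (lattice d).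
Hypothesis uL : uniq L.
Let F a := \sum_(i <- L) D (reflected i a).
Let bF : bmeas F. Proof. by apply: bmeas_sum => i; exact: bm_r. Qed.

Let influence_F j : influence F j <= \sum_(i <- L) influence D (i - j).
Proof.
have -> : influence F j = L2 P (fun w => \sum_(i <- L)
    (D (reflected i (e w)) - D (reflected i (mix (pred1 j) (e w) (e' w))))).
  by apply: eq_L2 => w; rewrite sumrB /F; reflexivity.
apply: le_trans (L2_sum _ _ _) _.
  by move=> i; apply: bmeasB; [exact: bm_e (bm_r i bD)|exact: bm_mix (bm_r i bD)].
by apply: ler_sum => i _; rewrite (influence_reflected i j bD).
Qed.

(** Young's inequality for the convolution over [L]: in the sum over [j] of squared influences, one
    factor is bounded by [V] through summation over [i], the other, after exchanging the sums,
    through summation over [j]. The bound grows like [size L] and not its square. *)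
Lemma block_variance : L2 P (fun w => F (e w) - Ex P (fun w => F (e w))) ^+ 2 <=
  2^-1 * ((size L)%:R * V ^+ 2).
Proof.
have ES := efron_stein meps meps' iid_eps copy (@box_uniq d) _ _ bF.
apply: ES => [N M j NM|j|s us].
- by rewrite !mem_box => /leq_trans; apply.
- by exists (lnorm j); rewrite mem_box.
apply: (@le_trans _ _ (\sum_(j <- s) V * \sum_(i <- L) influence D (i - j))).
  apply: ler_sum => j _; rewrite expr2; apply: ler_pM; [exact: L2_ge0|exact: L2_ge0| |exact: influence_F].
  apply: le_trans (influence_F j) _.
  rewrite -(big_map (fun i => i - j) predT (influence D)); apply: influence_sum.
  by rewrite map_inj_uniq//; exact: addIr.
rewrite -mulr_sumr exchange_big/= expr2 mulrCA ler_wpM2l//.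
apply: (@le_trans _ _ (\sum_(i <- L) V)); last first.
  by rewrite big_const_seq count_predT iter_addr_0 mulr_natl.
apply: ler_sum => i _.
rewrite -(big_map (fun j => i - j) predT (influence D)); apply: influence_sum.
by rewrite map_inj_uniq//; apply: inj_comp; [exact: addrI|exact: oppr_inj].
Qed.

End block_approximation.

Section block_sums.
Context (R : realType) (disp : measure_display) (T : measurableType disp).
Variable P : probability T R.
Variables (d : nat) (eps eps' : lattice d -> T -> R).
Hypothesis meps : forall j, measurable_fun [set: T] (eps j).
Hypothesis meps' : forall j, measurable_fun [set: T] (eps' j).
Let e w : conf R (lattice d) := fun j => eps j w.
Let e' w : conf R (lattice d) := fun j => eps' j w.
Variable p : set R -> R.
Hypothesis iid_eps : iid_law P p eps.
Hypothesis copy : forall A B : set (conf R (lattice d)), measurable A -> measurable B ->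
  P (e @^-1` A `&` e' @^-1` B) = (P (e @^-1` A) * P (e @^-1` B))%E.
Local Notation conf_d := (conf R (lattice d)).

Let me_ : measurable_fun [set: T] e. Proof. exact: measurable_conf. Qed.
Let bm_e (F : conf_d -> R) : bmeas F -> bmeas (fun w => F (e w)).
Proof. exact: bmeas_comp. Qed.
Let bm_r i (F : conf_d -> R) : bmeas F -> bmeas (fun a => F (reflected i a)).
Proof. by apply: bmeas_comp; exact: measurable_reflected. Qed.
Let Exr i (F : conf_d -> R) : bmeas F ->
  Ex P (fun w => F (reflected i (e w))) = Ex P (fun w => F (e w)).
Proof. by move=> bF; exact: (Ex_reflected1 meps meps' iid_eps copy i bF). Qed.

(** In the application [c1], [c2] and [c3] are of order [b], [b^2] and [sqrt b], and [t] is
    [2 theta sqrt b]. *)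
Variables (G : conf_d -> R) (M c1 c2 c3 t : R) (m : nat) (c : conf_d).
Hypothesis bG : bmeas G.
Hypothesis GM : forall a, `|G a| <= M.
Hypothesis c1P : Ex P (fun w => `|G (e w)|) <= c1.
Hypothesis c2P : forall i j, i != j ->
  Ex P (fun w => `|G (reflected i (e w)) * G (reflected j (e w))|) <= c2.
Hypothesis c3P : L2 P (fun w => G (e w)) <= c3.
Hypothesis tP : L2 P (fun w => G (e w) - block G m c (e w)) <= t.
Let H := block G m c.
Let bH : bmeas H. Proof. exact: bmeas_block. Qed.
Let D a := G a - H a.
Let bD : bmeas D. Proof. exact: bmeasB. Qed.
Let mu := Ex P (fun w => H (e w)).

Let t0 : 0 <= t. Proof. exact: le_trans (L2_ge0 _ _) tP. Qed.
Let c30 : 0 <= c3. Proof. exact: le_trans (L2_ge0 _ _) c3P. Qed.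

Let Ex_normH : Ex P (fun w => `|H (e w)|) <= c1 + t.
Proof.
apply: (@le_trans _ _ (Ex P (fun w => `|G (e w)| + `|D (e w)|))).
  apply: Ex_le; [exact: bmeas_norm (bm_e bH)|by apply: bmeasD; apply: bmeas_norm; exact: bm_e|].
  move=> w; rewrite -[X in `|X| <= _](_ : G (e w) - D (e w) = _); first exact: ler_normB.
  by rewrite /D; ring.
rewrite ExD; [|exact: bmeas_norm (bm_e bG)|exact: bmeas_norm (bm_e bD)].
by apply: lerD => //; apply: le_trans (Ex_norm_le_L2 _ (bm_e bD)) _.
Qed.

Let norm_mu : `|mu| <= c1 + t.
Proof. exact: le_trans (Ex_norm _ (bm_e bH)) Ex_normH. Qed.

Let c1t0 : 0 <= c1 + t. Proof. exact: le_trans (normr_ge0 _) norm_mu. Qed.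

(** [G^2 - H^2 = D (2 G - D)], estimated by Cauchy-Schwarz; the square of the mean is bounded
    through the first absolute moment. *)
Lemma block_second_moment :
  `|(Ex P (fun w => H (e w) ^+ 2) - mu ^+ 2) - Ex P (fun w => G (e w) ^+ 2)| <=
  t * (2 * c3 + t) + (c1 + t) ^+ 2.
Proof.
rewrite -addrA [- _ - _]addrC addrA; apply: le_trans (ler_normB _ _) _.
apply: lerD; last by rewrite normrX lerXn2r ?nnegrE.
have bGe := bm_e bG; have bHe := bm_e bH; have bDe := bm_e bD.
rewrite -ExB; [|by bm..].
have bd : bmeas (fun w => H (e w) ^+ 2 - G (e w) ^+ 2) by bm.
apply: le_trans (Ex_norm _ bd) _.
have b2 : bmeas (fun w => 2 * G (e w) - D (e w)) by bm.
rewrite (@eq_Ex _ _ _ P _ (fun w => `|D (e w) * (2 * G (e w) - D (e w))|)) => [|w]; last first.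
  by rewrite -normrN; congr `|_|; rewrite /D; ring.
apply: le_trans (Ex_cauchy_schwarz _ bDe b2) _.
apply: ler_pM; [exact: L2_ge0|exact: L2_ge0|exact: tP|].
apply: le_trans (L2B _ _ bDe) _; first by bm.
by rewrite L2Zl// ger0_norm// lerD// ler_pM2l.
Qed.

Let Ex_pairH i j : i != j ->
  Ex P (fun w => `|H (reflected i (e w)) * H (reflected j (e w))|) <=
  c2 + 2 * c3 * t + t ^+ 2.
Proof.
move=> ij.
have bg k : bmeas (fun w => G (reflected k (e w))) by exact: bm_e (bm_r k bG).
have bd k : bmeas (fun w => D (reflected k (e w))) by exact: bm_e (bm_r k bD).
have bh k : bmeas (fun w => H (reflected k (e w))) by exact: bm_e (bm_r k bH).
have L2r (F : conf_d -> R) k : bmeas F -> L2 P (fun w => F (reflected k (e w))) = L2 P (fun w => F (e w)).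
  by move=> bF; rewrite /L2; congr Num.sqrt; exact: Exr (bmeasX 2 bF).
have L2g k : L2 P (fun w => G (reflected k (e w))) <= c3 by rewrite L2r.
have L2d k : L2 P (fun w => D (reflected k (e w))) <= t by rewrite L2r.
apply: (@le_trans _ _ (Ex P (fun w => `|G (reflected i (e w)) * G (reflected j (e w))| +
   `|G (reflected i (e w)) * D (reflected j (e w))| +
   `|D (reflected i (e w)) * G (reflected j (e w))| +
   `|D (reflected i (e w)) * D (reflected j (e w))|))).
  apply: Ex_le; [by bm|by bm|move=> w].
  rewrite [X in `|X|](_ : _ = G (reflected i (e w)) * G (reflected j (e w))
    - G (reflected i (e w)) * D (reflected j (e w))
    - D (reflected i (e w)) * G (reflected j (e w))
    + D (reflected i (e w)) * D (reflected j (e w))); last by rewrite /D; ring.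
  apply: le_trans (ler_normD _ _) _; rewrite lerD2r.
  by apply: le_trans (ler_normB _ _) _; rewrite lerD2r ler_normB.
rewrite !ExD; [|by bm..].
have cs F1 F2 u1 u2 : bmeas F1 -> bmeas F2 -> L2 P F1 <= u1 -> L2 P F2 <= u2 ->
    Ex P (fun w => `|F1 w * F2 w|) <= u1 * u2.
  move=> b1 b2 h1 h2; apply: le_trans (Ex_cauchy_schwarz _ b1 b2) _.
  by apply: ler_pM => //; exact: L2_ge0.
have := c2P ij; have := cs _ _ _ _ (bg i) (bd j) (L2g i) (L2d j).
have := cs _ _ _ _ (bd i) (bg j) (L2d i) (L2g j).
have := cs _ _ _ _ (bd i) (bd j) (L2d i) (L2d j); lra.
Qed.

Variables (L : seq (lattice d)) (sc : R).
Hypothesis uL : uniq L.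
Hypothesis sc0 : 0 <= sc.
Let Y i w := sc * (H (reflected i (e w)) - mu).

Let bY i : bmeas (Y i).
Proof. by rewrite /Y; bm; exact: bm_e (bm_r i bH). Qed.

Let EY0 i : Ex P (Y i) = 0.
Proof.
have bh : bmeas (fun w => H (reflected i (e w))) by exact: bm_e (bm_r i bH).
rewrite /Y ExZl; last by bm.
by rewrite ExB ?Ex_cst ?Exr ?subrr ?mulr0//; exact: bmeas_cst.
Qed.

Let HM a : `|H a| <= M. Proof. exact: GM. Qed.

Let Ykappa i w : `|Y i w| <= sc * (2 * M).
Proof.
rewrite normrM ger0_norm// ler_wpM2l// (le_trans (ler_normB _ _))//.
rewrite mulr_natl mulr2n lerD// (le_trans (Ex_norm _ (bm_e bH)))//.
by apply: Ex_le_cst; first exact: bmeas_norm (bm_e bH).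
Qed.

Let ExY i : Ex P (fun w => `|Y i w|) <= sc * (2 * (c1 + t)).
Proof.
have bh : bmeas (fun w => H (reflected i (e w))) by exact: bm_e (bm_r i bH).
apply: (@le_trans _ _ (Ex P (fun w => sc * (`|H (reflected i (e w))| + `|mu|)))).
  apply: Ex_le; [exact: bmeas_norm (bY i)|by bm|move=> w].
  by rewrite normrM ger0_norm// ler_wpM2l// ler_normB.
rewrite ExZl; last by bm.
rewrite ler_wpM2l// ExD; [|by bm..].
by rewrite Ex_cst mulr_natl mulr2n lerD// (Exr i (bmeas_norm bH)).
Qed.

Let ExYY i j : i != j -> Ex P (fun w => `|Y i w * Y j w|) <=
  sc ^+ 2 * (c2 + 2 * c3 * t + t ^+ 2 + 3 * (c1 + t) ^+ 2).
Proof.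
move=> ij.
have bh k : bmeas (fun w => H (reflected k (e w))) by exact: bm_e (bm_r k bH).
have Eh k : Ex P (fun w => `|H (reflected k (e w))|) <= c1 + t.
  by rewrite (Exr k (bmeas_norm bH)).
apply: (@le_trans _ _ (Ex P (fun w => sc ^+ 2 * (`|H (reflected i (e w)) * H (reflected j (e w))| +
   (`|mu| * `|H (reflected i (e w))| + `|mu| * `|H (reflected j (e w))| + `|mu| ^+ 2))))).
  apply: Ex_le; [by bm|by bm|move=> w].
  rewrite [X in `|X|](_ : _ = sc ^+ 2 * ((H (reflected i (e w)) - mu) * (H (reflected j (e w)) - mu))); last by rewrite /Y; ring.
  rewrite normrM ger0_norm ?sqr_ge0// ler_wpM2l ?sqr_ge0//.
  set x := H _; set y := H _.
  rewrite (_ : (x - mu) * (y - mu) = x * y + (- (mu * x) - mu * y + mu ^+ 2)); last by ring.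
  apply: le_trans (ler_normD _ _) _; rewrite lerD2l.
  apply: le_trans (ler_normD _ _) _; rewrite normrX lerD2r.
  by apply: le_trans (ler_normB _ _) _; rewrite normrN !normrM.
rewrite ExZl; last by bm.
rewrite ler_wpM2l ?sqr_ge0//.
rewrite ExD; [|by bm..].
rewrite ExD; [|by bm..].
rewrite ExD; [|by bm..].
rewrite Ex_cst !ExZl; [|by bm..].
apply: lerD; first exact: Ex_pairH.
have h k : `|mu| * Ex P (fun w => `|H (reflected k (e w))|) <= (c1 + t) ^+ 2.
  by rewrite expr2 ler_pM// Ex_ge0.
have h2 : `|mu| ^+ 2 <= (c1 + t) ^+ 2 by rewrite lerXn2r ?nnegrE.
have := h i; have := h j; lra.
Qed.

(** Beyond distance [2 m] two frozen values read disjoint sets of innovations. *)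
Let nb : rel (lattice d) := fun i j => (lnorm (i - j) <= 2 * m)%N.
Let N : R := (size (box d (2 * m)))%:R.

Let nbxx i : nb i i. Proof. by rewrite /nb subrr lnorm0. Qed.

Let card_nb i : ((size [seq j <- L | nb i j])%:R <= N).
Proof.
rewrite ler_nat -(size_map (fun j => i - j)); apply: uniq_leq_size.
  rewrite map_inj_uniq ?filter_uniq//.
  by apply: inj_comp; [exact: addrI|exact: oppr_inj].
by move=> x /mapP[j + ->]; rewrite mem_filter mem_box => /andP[].
Qed.

Let sum_nb i (F : lattice d -> R) (u : R) : 0 <= u -> (forall j, nb i j -> F j <= u) ->
  \sum_(j <- L | nb i j) F j <= N * u.
Proof.
move=> u0 Fu; apply: (@le_trans _ _ (\sum_(j <- L | nb i j) u)).
  by apply: ler_sum => j; exact: Fu.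
rewrite -big_filter big_const_seq count_predT iter_addr_0 -[leLHS]mulr_natl.
by rewrite ler_wpM2r ?card_nb.
Qed.

Let rho1_ub i : i \in L -> \sum_(j <- L | nb i j) Ex P (fun w => `|Y j w|) <=
  N * (sc * (2 * (c1 + t))).
Proof. by move=> _; apply: sum_nb => [|j _]; rewrite ?mulr_ge0. Qed.

Let q2 := c2 + 2 * c3 * t + t ^+ 2 + 3 * (c1 + t) ^+ 2.
Hypothesis c20 : 0 <= c2.
Let q20 : 0 <= q2.
Proof. by rewrite /q2 !addr_ge0 ?mulr_ge0 ?sqr_ge0. Qed.

Let rho2_ub : \sum_(i <- L) \sum_(j <- L | nb i j && (j != i)) Ex P (fun w => `|Y i w * Y j w|) <=
  (size L)%:R * (N * (sc ^+ 2 * q2)).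
Proof.
apply: (@le_trans _ _ (\sum_(i <- L) N * (sc ^+ 2 * q2))); last first.
  by rewrite big_const_seq count_predT iter_addr_0 -[leLHS]mulr_natl.
apply: ler_sum => i _; rewrite big_mkcondr; apply: sum_nb.
  by rewrite mulr_ge0 ?sqr_ge0.
move=> j _; case: ifP => [ji|_]; last by rewrite mulr_ge0 ?sqr_ge0.
by apply: ExYY; rewrite eq_sym.
Qed.

(** The coordinates within [m] of [i] determine [Y i]; by the triangle inequality the sites outside
    the neighbourhood read none of them. *)
Let indep i (u v : R -> R) : i \in L -> locally_bounded u -> locally_bounded v ->
  Ex P (fun w => u (Y i w) * v (\sum_(j <- L | ~~ nb i j) Y j w)) =
  Ex P (fun w => u (Y i w)) * Ex P (fun w => v (\sum_(j <- L | ~~ nb i j) Y j w)).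
Proof.
move=> _ lu lv.
pose y k (a : conf_d) := sc * (H (reflected k a) - mu).
have by_ k : bmeas (y k) by rewrite /y; bm; exact: bm_r.
have bU : bmeas (fun a => \sum_(j <- L | ~~ nb i j) y j a).
  by apply: bmeas_sum => k; exact: by_.
have local k a a' : (forall j, (lnorm (k - j) <= m)%N -> a j = a' j) -> y k a = y k a'.
  move=> aa'; rewrite /y /H /block; congr (_ * (G _ - _)).
  apply/funext => s; rewrite /mix; case: ltnP => // sm; rewrite /reflected aa'//.
  by rewrite opprB addrC subrK.
apply: (Ex_indep_coord meps meps' iid_eps copy (B := fun j => (lnorm (i - j) <= m)%N)
  (F := fun a => u (y i a)) (G := fun a => v (\sum_(j <- L | ~~ nb i j) y j a))).
- exact: bmeas_locally_bounded lu (by_ i).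
- exact: bmeas_locally_bounded lv bU.
- by move=> a a' aa'; rewrite (local i a a').
move=> a a' aa'; congr v; apply: eq_bigr => k; rewrite /nb -ltnNge => ik.
apply: local => j kj; apply: aa'; rewrite -ltnNge.
have := lnormD (i - j) (j - k); rewrite addrA subrK (lnormB j k) => tri.
rewrite ltnNge; apply/negP => ijm; move: ik; apply/negP; rewrite -leqNgt.
by rewrite (leq_trans tri)// mul2n -addnn leq_add.
Qed.

Let A := \sum_(i <- L) Ex P (fun w => Y i w ^+ 2).

Let AE : A = (size L)%:R * (sc ^+ 2 * (Ex P (fun w => H (e w) ^+ 2) - mu ^+ 2)).
Proof.
rewrite /A (eq_bigr (fun=> sc ^+ 2 * (Ex P (fun w => H (e w) ^+ 2) - mu ^+ 2))) => [|i _].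
  by rewrite big_const_seq count_predT iter_addr_0 -[LHS]mulr_natl.
have bh : bmeas (fun w => H (reflected i (e w))) by exact: bm_e (bm_r i bH).
transitivity (Ex P (fun w => sc ^+ 2 * (H (reflected i (e w)) ^+ 2 - (2 * mu) * H (reflected i (e w)) + mu ^+ 2))).
  by apply: eq_Ex => w; rewrite /Y; ring.
rewrite ExZl; last by bm.
rewrite ExD ?ExB ?ExZl ?Ex_cst; [|by bm..].
by rewrite (Exr i (bmeasX 2 bH)) (Exr i bH) -/mu; ring.
Qed.

(** Stein's bounds for the centred and scaled frozen field: [v] is the sum of the site variances,
    [rho2] bounds the near pairs. *)
Lemma block_sum_cf (beta : R) (v := (size L)%:R * (sc ^+ 2 * (Ex P (fun w => H (e w) ^+ 2) - mu ^+ 2)))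
    (rho2 := (size L)%:R * (N * (sc ^+ 2 * q2))) :
  Ex P (fun w => (\sum_(i <- L) sc * (H (reflected i (e w)) - mu)) ^+ 2) <= v + rho2 /\
  `|Ex P (fun w => cos (\sum_(i <- L) sc * (H (reflected i (e w)) - mu) + beta)) -
    cos beta * expR (- v / 2)| <=
  rho2 + v * (2 * (sc * (2 * M)) + N * (sc * (2 * (c1 + t)))).
Proof.
rewrite /v -AE; split.
  exact: (stein_second_moment uL nbxx bY EY0 indep rho2_ub).
exact: (stein_cf uL nbxx bY EY0 indep Ykappa rho1_ub rho2_ub).
Qed.

End block_sums.

Lemma norm_expRNB (R : realType) (x y : R) : 0 <= x -> 0 <= y ->
  `|expR (- x) - expR (- y)| <= `|x - y|.
Proof.
wlog xy : x y / x <= y => [H x0 y0|x0 y0].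
  case: (leP x y) => [xy|/ltW yx]; first exact: H.
  by rewrite distrC [leRHS]distrC; exact: H.
rewrite ger0_norm ?subr_ge0 ?ler_expR ?lerN2// distrC ger0_norm ?subr_ge0//.
have -> : expR (- x) - expR (- y) = expR (- x) * (1 - expR (- (y - x))).
  by rewrite mulrBr mulr1 -expRD; congr (_ - expR _); ring.
have h1 : expR (- x) <= 1 by rewrite -expR0 ler_expR oppr_le0.
have h2 : 1 - expR (- (y - x)) <= y - x by have := expR_ge1Dx (- (y - x)); lra.
have h3 : 0 <= 1 - expR (- (y - x)) by rewrite subr_ge0 -expR0 ler_expR oppr_le0 subr_ge0.
by apply: le_trans h2; rewrite ler_piMl.
Qed.

(** * Quantitative bound for the normalized sum *)

Section cf_bound.
Context (R : realType) (disp : measure_display) (T : measurableType disp).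
Variable P : probability T R.
Variables (d : nat) (eps eps' : lattice d -> T -> R).
Hypothesis meps : forall j, measurable_fun [set: T] (eps j).
Hypothesis meps' : forall j, measurable_fun [set: T] (eps' j).
Let e w : conf R (lattice d) := fun j => eps j w.
Let e' w : conf R (lattice d) := fun j => eps' j w.
Variable p : set R -> R.
Hypothesis iid_eps : iid_law P p eps.
Hypothesis copy : forall A B : set (conf R (lattice d)), measurable A -> measurable B ->
  P (e @^-1` A `&` e' @^-1` B) = (P (e @^-1` A) * P (e @^-1` B))%E.
Local Notation conf_d := (conf R (lattice d)).

Let me_ : measurable_fun [set: T] e. Proof. exact: measurable_conf. Qed.
Let bm_e (F : conf_d -> R) : bmeas F -> bmeas (fun w => F (e w)).
Proof. exact: bmeas_comp. Qed.
Let bm_r i (F : conf_d -> R) : bmeas F -> bmeas (fun a => F (reflected i a)).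
Proof. by apply: bmeas_comp; exact: measurable_reflected. Qed.

Variables (G : conf_d -> R) (M C b theta eta sc : R) (m : nat) (L : seq (lattice d)).
Hypothesis bG : bmeas G.
Hypothesis GM : forall a, `|G a| <= M.
Hypothesis C1 : 1 <= C.
Hypothesis b0 : 0 < b.
Hypothesis EG1 : Ex P (fun w => `|G (e w)|) <= C * b.
Hypothesis EG12 : forall i j, i != j ->
  Ex P (fun w => `|G (reflected i (e w)) * G (reflected j (e w))|) <= C * b ^+ 2.
Hypothesis EG2 : Ex P (fun w => G (e w) ^+ 2) <= C * b.
Hypothesis theta0 : 0 < theta.
Hypothesis tail : forall s : seq (lattice d), uniq s -> all (fun j => (m < lnorm j)%N) s ->
  \sum_(j <- s) influence P eps eps' G j <= theta * Num.sqrt b.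
Let N : R := (size (box d (2 * m)))%:R.
Hypothesis Nb : N * b <= eta.
Hypothesis Nt : N * theta <= eta.
Hypothesis eta1 : eta <= 1.
Hypothesis uL : uniq L.
Hypothesis sc0 : 0 <= sc.
Hypothesis scE : (size L)%:R * sc ^+ 2 * b = 1.

Let S w := \sum_(i <- L) sc * (G (reflected i (e w)) - Ex P (fun w => G (e w))).
Let v0 := b^-1 * Ex P (fun w => G (e w) ^+ 2).

Let N1 : 1 <= N.
Proof. by rewrite ler1n size_box expn_gt0. Qed.
Let NmN : (size (box d m))%:R <= N.
Proof.
rewrite /N ler_nat; apply: uniq_leq_size; first exact: box_uniq.
by move=> j; rewrite !mem_box => /leq_trans; apply; rewrite leq_pmull.
Qed.
Let C0 : 0 < C. Proof. exact: lt_le_trans C1. Qed.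
Let s := Num.sqrt b.
Let s0 : 0 < s. Proof. by rewrite sqrtr_gt0. Qed.
Let N_ge0 : 0 <= N. Proof. exact: ler0n. Qed.
Let C_ge0 : 0 <= C. Proof. exact: ltW. Qed.
Let b_ge0 : 0 <= b. Proof. exact: ltW. Qed.
Let s_ge0 : 0 <= s. Proof. exact: ltW. Qed.
Let theta_ge0 : 0 <= theta. Proof. exact: ltW. Qed.
Let b_eta : b <= eta. Proof. by apply: le_trans Nb; rewrite ler_peMl. Qed.
Let t_eta : theta <= eta. Proof. by apply: le_trans Nt; rewrite ler_peMl. Qed.
Let eta0 : 0 < eta. Proof. exact: lt_le_trans t_eta. Qed.
Let eta_ge0 : 0 <= eta. Proof. exact: ltW. Qed.
Let M_ge0 : 0 <= M. Proof. exact: le_trans (normr_ge0 _) (GM (e point)). Qed.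
Let scL : (size L)%:R * sc ^+ 2 = b^-1.
Proof. by apply: (mulIf (lt0r_neq0 b0)); rewrite scE mulVf ?gt_eqF. Qed.

Let bS : bmeas S.
Proof.
rewrite /S; apply: bmeas_sum => i; bm; exact: bm_e (bm_r i bG).
Qed.

Let sE : s ^+ 2 = b. Proof. by rewrite sqr_sqrtr. Qed.

Let L2G : L2 P (fun w => G (e w)) <= C * s.
Proof.
rewrite -(@ler_pXn2r _ 2)// ?nnegrE ?L2_ge0 ?mulr_ge0//.
by rewrite L2_sqr exprMn sE (le_trans EG2)// ler_wpM2r// ler_eXnr.
Qed.

Let t := 2 * (theta * s).

Let C2 : C <= C ^+ 2. Proof. by rewrite ler_eXnr. Qed.
Let C21 : 1 <= C ^+ 2. Proof. exact: le_trans C1 C2. Qed.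
Let C20 : 0 <= C ^+ 2. Proof. exact: sqr_ge0. Qed.

Let bC : b * C ^+ 2 <= eta * C ^+ 2. Proof. by rewrite ler_wpM2r. Qed.
Let theta2 : theta ^+ 2 <= eta.
Proof. by rewrite expr2 -[leRHS]mulr1 ler_pM// (le_trans t_eta). Qed.
Let Ntheta2 : N * theta ^+ 2 <= eta.
Proof.
by rewrite expr2 mulrA -[leRHS]mulr1 ler_pM ?mulr_ge0// (le_trans t_eta).
Qed.

(** Since [t = 2 theta s] and [s^2 = b], the division by [b] leaves multiples of [theta], [theta^2]
    and a square of order [b + theta^2], all at most of order [eta]. *)
Let second_moment_error :
  b^-1 * (t * (2 * (C * s) + t) + (C * b + t) ^+ 2) <= 40 * C ^+ 2 * eta.
Proof.
have -> : b^-1 * (t * (2 * (C * s) + t) + (C * b + t) ^+ 2) =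
    4 * C * theta + 4 * theta ^+ 2 + (C * s + 2 * theta) ^+ 2.
  by rewrite /t -sE; field; rewrite gt_eqF.
have h : (C * s + 2 * theta) ^+ 2 <= 2 * C ^+ 2 * b + 8 * theta ^+ 2.
  rewrite -subr_ge0 -sE (_ : _ - _ = (C * s - 2 * theta) ^+ 2) ?sqr_ge0//; ring.
have h1 : C * theta <= C ^+ 2 * eta by rewrite ler_pM.
have h2 : theta ^+ 2 <= C ^+ 2 * eta by apply: (le_trans theta2); rewrite ler_peMl.
have h3 : 0 <= C ^+ 2 * eta by rewrite mulr_ge0.
move: bC; lra.
Qed.

Let rho2_error :
  N * (b^-1 * (C * b ^+ 2 + 2 * (C * s) * t + t ^+ 2 + 3 * (C * b + t) ^+ 2)) <= 40 * C ^+ 2 * eta.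
Proof.
have -> : b^-1 * (C * b ^+ 2 + 2 * (C * s) * t + t ^+ 2 + 3 * (C * b + t) ^+ 2) =
    C * b + 4 * C * theta + 4 * theta ^+ 2 + 3 * (C * s + 2 * theta) ^+ 2.
  by rewrite /t -sE; field; rewrite gt_eqF.
have h : (C * s + 2 * theta) ^+ 2 <= 2 * C ^+ 2 * b + 8 * theta ^+ 2.
  rewrite -subr_ge0 -sE (_ : _ - _ = (C * s - 2 * theta) ^+ 2) ?sqr_ge0//; ring.
apply: (@le_trans _ _ (C * (N * b) + 4 * (C * (N * theta)) + 28 * (N * theta ^+ 2) + 6 * (C ^+ 2 * (N * b)))).
  rewrite (_ : C * (N * b) + _ + _ + _ = N * (C * b + 4 * C * theta + 4 * theta ^+ 2 + 3 * (2 * C ^+ 2 * b + 8 * theta ^+ 2))); last by ring.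
  by rewrite ler_wpM2l//; lra.
have h1 : C * (N * b) <= C ^+ 2 * eta by rewrite ler_pM ?mulr_ge0.
have h2 : C * (N * theta) <= C ^+ 2 * eta by rewrite ler_pM ?mulr_ge0.
have h3 : N * theta ^+ 2 <= C ^+ 2 * eta by apply: (le_trans Ntheta2); rewrite ler_peMl.
have h4 : C ^+ 2 * (N * b) <= C ^+ 2 * eta by rewrite ler_wpM2l.
have h5 : 0 <= C ^+ 2 * eta by rewrite mulr_ge0.
lra.
Qed.

Let s1 : s <= 1.
Proof. by rewrite -[leRHS]sqrtr1 ler_wsqrtr// (le_trans b_eta). Qed.

(** Bounded rather than small in [eta]; the remaining factor [sc], which tends to 0, makes this term
    vanish. *)
Let rho1_error : N * (sc * (2 * (C * b + t))) <= sc * (6 * C ^+ 2).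
Proof.
rewrite mulrCA ler_wpM2l//.
have h1 : C * (N * b) <= C ^+ 2 by rewrite -[leRHS]mulr1 ler_pM ?mulr_ge0// (le_trans Nb).
have h2 : N * theta * s <= 1.
  by rewrite -[leRHS]mulr1 ler_pM ?mulr_ge0// (le_trans Nt).
rewrite (_ : N * _ = 2 * (C * (N * b)) + 4 * (N * theta * s)); last by rewrite /t; ring.
move: C21; lra.
Qed.

(* theta is tau / sqrt b, where tau bounds the influences outside the box of radius m *)
Lemma sum_cf_bound (K := 300 * C ^+ 2 + 4 * M) :
  Ex P (fun w => S w ^+ 2) <= 2 * v0 + K /\
  forall beta, `|Ex P (fun w => cos (S w + beta)) - cos beta * expR (- v0 / 2)| <=
    K * eta + (v0 + K) * K * sc.
Proof.
have tau0 : 0 < theta * s by rewrite mulr_gt0.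
have [c L2c] := block_copy_exists meps meps' iid_eps copy bG tau0 tail.
pose H := block G m c.
have bH : bmeas H by exact: bmeas_block.
pose mu := Ex P (fun w => H (e w)).
pose Sb w := \sum_(i <- L) sc * (H (reflected i (e w)) - mu).
have bSb : bmeas Sb.
  by rewrite /Sb; apply: bmeas_sum => i; bm; exact: bm_e (bm_r i bH).
have c20 : 0 <= C * b ^+ 2 by rewrite mulr_ge0 ?sqr_ge0.
have H2 := block_second_moment meps bG EG1 L2G L2c.
have HS1 := proj1 (block_sum_cf meps meps' iid_eps copy bG GM EG1 EG12 L2G L2c uL sc0 c20 0).
have HS2 beta := proj2 (block_sum_cf meps meps' iid_eps copy bG GM EG1 EG12 L2G L2c uL sc0 c20 beta).
have HV := block_variance meps meps' iid_eps copy bG tau0 tail L2c uL.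
cbv zeta in HS1, HS2; rewrite -/H -/mu -/s -/t in H2 HS1 HS2 HV.
set vH := Ex P (fun w => H (e w) ^+ 2) - mu ^+ 2 in H2 HS1 HS2.
set v := b^-1 * vH.
have vE : (size L)%:R * (sc ^+ 2 * vH) = v by rewrite mulrA scL.
have vv0 : `|v - v0| <= 40 * C ^+ 2 * eta.
  rewrite /v /v0 -mulrBr normrM gtr0_norm ?invr_gt0//.
  apply: le_trans second_moment_error; by rewrite ler_pM2l ?invr_gt0.
(* By [scE] the scaled variance bound is free of [size L] and [b]; it leaves
   [(4 * size (box d m) + 1) * theta], which is at most [5 * N * theta]. *)
have dS : L2 P (fun w => S w - Sb w) <= 5 * eta.
  pose Fd a := \sum_(i <- L) (G (reflected i a) - H (reflected i a)).
  have bF : bmeas Fd by apply: bmeas_sum => i; apply: bmeasB; exact: bm_r.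
  have EF : Ex P (fun w => Fd (e w)) = \sum_(i <- L) (Ex P (fun w => G (e w)) - mu).
    rewrite /Fd Ex_sum => [|i]; last first.
      by apply: bmeasB; [exact: bm_e (bm_r i bG)|exact: bm_e (bm_r i bH)].
    apply: eq_bigr => i _; rewrite ExB; [|exact: bm_e (bm_r i bG)|exact: bm_e (bm_r i bH)].
    by rewrite (Ex_reflected1 meps meps' iid_eps copy i bG) (Ex_reflected1 meps meps' iid_eps copy i bH).
  have -> : L2 P (fun w => S w - Sb w) = sc * L2 P (fun w => Fd (e w) - Ex P (fun w => Fd (e w))).
    rewrite -[X in X * _](ger0_norm sc0) -L2Zl; last by apply: bmeasB; [exact: bm_e|exact: bmeas_cst].
    apply: eq_L2 => w; congr (_ ^+ 2); rewrite EF /S /Sb /Fd -!sumrB mulr_sumr.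
    by apply: eq_bigr => i _; ring.
  rewrite -(@ler_pXn2r _ 2)// ?nnegrE ?mulr_ge0 ?L2_ge0// exprMn.
  apply: (@le_trans _ _ (sc ^+ 2 * (2^-1 * ((size L)%:R * ((4 * (size (box d m))%:R + 1) * (theta * s)) ^+ 2)))).
    by rewrite ler_wpM2l ?sqr_ge0.
  rewrite [leLHS](_ : _ = 2^-1 * ((4 * (size (box d m))%:R + 1) * theta) ^+ 2); last first.
    rewrite [in RHS](_ : 2^-1 * _ = ((size L)%:R * sc ^+ 2 * b) * (2^-1 * ((4 * (size (box d m))%:R + 1) * theta) ^+ 2)); last by rewrite scE mul1r.
    by rewrite -sE; ring.
  set Nm := (size (box d m))%:R; have Nm0 : 0 <= Nm by exact: ler0n.
  have h : (4 * Nm + 1) * theta <= 5 * eta.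
    apply: (@le_trans _ _ (5 * N * theta)); last by rewrite -mulrA ler_pM2l.
    by rewrite ler_wpM2r//; move: NmN N1; rewrite -/Nm; lra.
  apply: (@le_trans _ _ (((4 * Nm + 1) * theta) ^+ 2)).
    by rewrite ler_piMl ?sqr_ge0// invf_le1// ler1n.
  by rewrite lerXn2r ?nnegrE ?mulr_ge0// addr_ge0// mulr_ge0.
have v_ge0 : 0 <= v.
  rewrite mulr_ge0 ?invr_ge0// subr_ge0 -L2_sqr -[mu ^+ 2]real_normK ?num_real//.
  rewrite lerXn2r ?nnegrE ?L2_ge0//.
  by apply: le_trans (Ex_norm _ (bm_e bH)) (Ex_norm_le_L2 _ (bm_e bH)).
have v0_ge0 : 0 <= v0 by rewrite mulr_ge0 ?invr_ge0// Ex_ge0// => w; exact: sqr_ge0.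
have rho2E q : (size L)%:R * (N * (sc ^+ 2 * q)) = N * (b^-1 * q) by rewrite -scL; ring.
rewrite vE rho2E -/Sb in HS1.
have C2e : C ^+ 2 * eta <= C ^+ 2 by rewrite ler_piMr.
have vb : v <= v0 + 40 * C ^+ 2.
  by move: vv0 C2e; rewrite ler_norml => /andP[_]; lra.
have e2 : eta ^+ 2 <= 1 by rewrite expr_le1.
split.
  apply: (@le_trans _ _ (Ex P (fun w => 2 * Sb w ^+ 2 + 2 * (S w - Sb w) ^+ 2))).
    apply: Ex_le; [by bm|by bm|move=> w].
    rewrite -subr_ge0 (_ : _ - _ = (S w - 2 * Sb w) ^+ 2) ?sqr_ge0//; ring.
  rewrite ExD ?ExZl; [|by bm..].
  rewrite -(L2_sqr P (fun w => S w - Sb w)).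
  have h : L2 P (fun w => S w - Sb w) ^+ 2 <= (5 * eta) ^+ 2.
    by rewrite lerXn2r ?nnegrE ?L2_ge0 ?mulr_ge0.
  rewrite exprMn in h; have h2 := rho2_error.
  move: h2 HS1 vb h e2 C21 C2e M_ge0; rewrite /K; lra.
move=> beta; have {}HS2 := HS2 beta; rewrite vE rho2E in HS2.
have mS F : bmeas F -> bmeas (fun w => cos (F w + beta)).
  by move=> bF; apply: bmeas_cos; exact: (bmeasD bF (bmeas_cst _ beta)).1.
have h1 : `|Ex P (fun w => cos (S w + beta)) - Ex P (fun w => cos (Sb w + beta))| <= 5 * eta.
  rewrite -ExB; [|exact: mS..].
  have bd : bmeas (fun w => cos (S w + beta) - cos (Sb w + beta)) by apply: bmeasB; exact: mS.
  apply: le_trans (Ex_norm _ bd) _.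
  have bd2 : bmeas (fun w => S w - Sb w) by bm.
  apply: (@le_trans _ _ (Ex P (fun w => `|S w - Sb w|))).
    apply: Ex_le; [exact: bmeas_norm|exact: bmeas_norm|move=> w].
    apply: le_trans (cos_lipschitz _ _) _.
    by rewrite (_ : S w + beta - (Sb w + beta) = S w - Sb w)//; ring.
  exact: le_trans (Ex_norm_le_L2 _ bd2) dS.
have h3 : `|cos beta * expR (- v / 2) - cos beta * expR (- v0 / 2)| <= 20 * C ^+ 2 * eta.
  rewrite -mulrBr normrM.
  have hc : `|cos beta| <= 1 by rewrite ler_norml cos_geN1 cos_le1.
  apply: (@le_trans _ _ (`|expR (- v / 2) - expR (- v0 / 2)|)); first by rewrite ler_piMl.
  rewrite !mulNr; apply: le_trans (norm_expRNB _ _) _; [by rewrite divr_ge0|by rewrite divr_ge0|].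
  by rewrite -mulrBl normrM (@ger0_norm _ 2^-1)//; move: vv0; lra.
have h4 : v * (2 * (sc * (2 * M)) + N * (sc * (2 * (C * b + t)))) <= (v0 + K) * K * sc.
  apply: (@le_trans _ _ (v * ((4 * M + 6 * C ^+ 2) * sc))).
    by rewrite ler_wpM2l//; move: rho1_error; lra.
  rewrite mulrA ler_wpM2r// ler_pM// /K; move: vb C20 M_ge0; lra.
have := rho2_error.
move: h1 HS2 h3 h4; rewrite /Sb /K.
set x1 := Ex P _; set x2 := Ex P _; set y1 := cos beta * expR (- v / 2); set y2 := cos beta * _.
move=> h1 HS2 h3 h4 h5.
have -> : x1 - y2 = (x1 - x2) + ((x2 - y1) + (y1 - y2)) by ring.
apply: le_trans (ler_normD _ _) _.
have h6 := ler_normD (x2 - y1) (y1 - y2).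
have h7 : eta <= C ^+ 2 * eta by rewrite ler_peMl.
have h8 : 0 <= M * eta by rewrite mulr_ge0.
apply: le_trans (lerD h1 (le_trans h6 (lerD (le_trans HS2 (lerD h5 h4)) h3))) _.
set W := (v0 + _) * _ * sc; rewrite -subr_ge0.
rewrite (_ : _ - _ = 240 * (C ^+ 2 * eta) - 5 * eta + 4 * (M * eta)); last by ring.
by move: h7 h8 eta_ge0; lra.
Qed.

End cf_bound.

(** * Choice of the block radius *)

Lemma powR_halfint (R : realType) (d k : nat) :
  (k.+1)%:R `^ ((5 * d)%:R / 2) = (k.+1%:R ^+ d) ^+ 2 * Num.sqrt (k.+1%:R ^+ d) :> R.
Proof.
have q0 : 0 < (k.+1%:R : R) ^+ d by rewrite exprn_gt0.
have -> : (5 * d)%:R / 2 = d%:R * (2%:R + 2^-1) :> R by rewrite natrM; field.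
rewrite powRrM powR_mulrn// powRD; last by rewrite (gt_eqF q0) implybT.
by rewrite powR_mulrn ?(ltW q0)// powR12_sqrt// ltW.
Qed.

(* Take the largest m with (m + 1)^d b <= eta / 4^d: then (m + 1)^d b is also
   bounded below, and with the weight (m + 1)^(5d/2) the last quantity depends
   on (m + 1)^d b only. *)
Lemma scale_choice (R : realType) (d : nat) (L eta : R) : (0 < d)%N -> 0 < L -> 0 < eta ->
  exists2 r, 0 < r & forall m0 : nat, exists2 bs, 0 < bs & forall b, 0 < b -> b <= bs ->
  exists m, [/\ (m0 <= m)%N, ((4 * m).+1 ^ d)%:R * b <= eta &
    ((4 * m).+1 ^ d)%:R * (L / b * (r / ((m.+1)%:R `^ ((5 * d)%:R / 2))) / Num.sqrt b) <= eta].
Proof.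
(* [4^d] compares [(4 m + 1)^d] with [(m + 1)^d]. The lower bound [ka] for [(m + 1)^d b] comes from
   maximality of [m] and [m + 2 <= 2 (m + 1)]. *)
move=> d0 L0 eta0; pose th := eta / 4 ^+ d; pose ka := th / 2 ^+ d.
have th0 : 0 < th by rewrite divr_gt0 ?exprn_gt0.
have ka0 : 0 < ka by rewrite divr_gt0 ?exprn_gt0.
have sk0 : 0 < Num.sqrt ka by rewrite sqrtr_gt0.
(* Turns the last quantity into at most [eta * (ka / (q b))^(3/2)]. This [r] depends on neither [m0]
   nor [b], so the tail radius [m0] may be derived from it. *)
exists (eta * (ka * Num.sqrt ka) / (4 ^+ d * L)).
  by rewrite divr_gt0 ?mulr_gt0 ?exprn_gt0.
move=> m0; exists (th / (m0.+1)%:R ^+ d); first by rewrite divr_gt0 ?exprn_gt0.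
move=> b b0 bb.
pose Q m := (m.+1)%:R ^+ d * b <= th.
have Qm0 : Q m0 by rewrite /Q mulrC -ler_pdivlMr ?exprn_gt0.
have [B HB] := exists_natr_ge (th / b).
have Qub m : Q m -> (m <= B)%N.
  rewrite /Q -ler_pdivlMr// => h; rewrite -(ler_nat R).
  apply: le_trans HB; apply: le_trans h; apply: (@le_trans _ _ (m.+1)%:R); first by rewrite ler_nat.
  by rewrite ler_eXnr// ler1n.
have [m Qm mmax] := ex_maxnP (ex_intro Q m0 Qm0) Qub.
have nQ : th < (m.+2)%:R ^+ d * b by rewrite ltNge; apply/negP => /mmax; rewrite ltnn.
pose q : R := (m.+1)%:R ^+ d.
have q0 : 0 < q by rewrite exprn_gt0.
have kq : ka <= q * b.
  rewrite /ka ler_pdivrMr ?exprn_gt0// (le_trans (ltW nQ))//.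
  rewrite mulrAC ler_pM2r// -exprMn lerXn2r ?nnegrE ?mulr_ge0//.
  by rewrite -natrM ler_nat muln2 -addnn addSn ltnS leq_addl.
have NQ : ((4 * m).+1 ^ d)%:R <= 4 ^+ d * q.
  rewrite natrX -exprMn lerXn2r ?nnegrE ?mulr_ge0//.
  by rewrite -natrM ler_nat mulnS -addn1 addnC leq_add2r.
exists m; split; first exact: mmax.
  apply: (@le_trans _ _ (4 ^+ d * q * b)); first by rewrite ler_pM2r.
  have -> : eta = 4 ^+ d * th by rewrite /th mulrC divfK// gt_eqF// exprn_gt0.
  by rewrite -mulrA ler_pM2l ?exprn_gt0.
(* The weight is [q^2 sqrt q], so [m] enters only through [q], up to the comparison [NQ]. *)
rewrite powR_halfint -/q.
set r := eta * _ / _.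
have r0 : 0 < r by rewrite divr_gt0 ?mulr_gt0 ?exprn_gt0.
have sb0 : 0 < Num.sqrt b by rewrite sqrtr_gt0.
have sq0 : 0 < Num.sqrt q by rewrite sqrtr_gt0.
apply: (@le_trans _ _ (4 ^+ d * q * (L / b * (r / (q ^+ 2 * Num.sqrt q)) / Num.sqrt b))).
  by rewrite ler_wpM2r// !mulr_ge0 ?invr_ge0 ?mulr_ge0 ?exprn_ge0 ?ltW.
have -> : 4 ^+ d * q * (L / b * (r / (q ^+ 2 * Num.sqrt q)) / Num.sqrt b) =
    eta * ((ka * Num.sqrt ka) / (q * b * (Num.sqrt q * Num.sqrt b))).
  rewrite /r; field.
  by rewrite !gt_eqF ?exprn_gt0.
rewrite ger_pMr// ler_pdivrMr ?mulr_gt0// mul1r ler_pM ?(ltW ka0) ?(ltW sk0)//.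
by rewrite -sqrtrM ?(ltW q0)// ler_wsqrtr.
Qed.

(** A finite set carrying all but [r] of the total lies in some box, and lists outside that box are
    disjoint from it. *)
Lemma esum_tail (R : realType) (d : nat) (a : lattice d -> \bar R) (r : R) :
  (forall i, 0 <= a i)%E -> (\esum_(i in [set: lattice d]) a i < +oo)%E -> 0 < r ->
  exists m0 : nat, forall s : seq (lattice d), uniq s -> all (fun i => m0 < lnorm i)%N s ->
    (\sum_(i <- s) a i <= r%:E)%E.
Proof.
move=> a0 aoo r0.
pose E := (\esum_(i in [set: lattice d]) a i)%E; rewrite -/E in aoo.
have E0 : (0 <= E)%E by exact: esum_ge0.
have Efin : E \is a fin_num by rewrite ge0_fin_numE.
have : (E - r%:E < E)%E by rewrite lteBlDr// lteDl// lte_fin.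
move=> /ereal_sup_gt[_ [A [finA _] <-]].
rewrite fsbig_finite// => EA.
exists (\max_(i <- fset_set A) lnorm i)%N => s us /allP far.
have disj i : i \in s -> i \notin (fset_set A : seq (lattice d)).
  move=> /far; apply: contraTN => iA; rewrite -leqNgt.
  exact: (leq_bigmax_seq _ iA).
have uAs : uniq (fset_set A ++ s).
  rewrite cat_uniq fset_uniq us andbT/=; apply/hasPn => i /disj.
  by [].
have ub : (\sum_(i <- fset_set A) a i + \sum_(i <- s) a i <= E)%E.
  rewrite -big_cat/= fsbig_seq//.
  apply: esum_ge; exists [set` (fset_set A ++ s)]; last exact: lexx.
  by split => //; exact: finite_seq.
rewrite leNgt; apply/negP => rs.
have := lteD EA rs; rewrite subeK// => h.
by have := lt_le_trans h ub; rewrite ltxx.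
Qed.

(** * Central limit theorem *)

Section central_limit.
Context (R : realType) (disp : measure_display) (T : measurableType disp).
Variable P : probability T R.
Variables (d : nat) (eps eps' : lattice d -> T -> R).
Hypothesis d0 : (0 < d)%N.
Hypothesis meps : forall j, measurable_fun [set: T] (eps j).
Hypothesis meps' : forall j, measurable_fun [set: T] (eps' j).
Let e w : conf R (lattice d) := fun j => eps j w.
Let e' w : conf R (lattice d) := fun j => eps' j w.
Variable p : set R -> R.
Hypothesis iid_eps : iid_law P p eps.
Hypothesis copy : forall A B : set (conf R (lattice d)), measurable A -> measurable B ->
  P (e @^-1` A `&` e' @^-1` B) = (P (e @^-1` A) * P (e @^-1` B))%E.
Local Notation conf_d := (conf R (lattice d)).
Variable g : conf_d -> R.
Hypothesis mg : measurable_fun [set: conf_d] g.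

Let me_ : measurable_fun [set: T] e. Proof. exact: measurable_conf. Qed.
Let me'_ : measurable_fun [set: T] e'. Proof. exact: measurable_conf. Qed.

(** [delta_i] resamples the innovation at 0 and looks at site [i]; the influence resamples
    coordinate [i] of the argument of [g]. Reflection about [i] identifies the two. The comparison
    is made in extended reals because [g], unlike [Phi], may be unbounded. *)
Lemma influence_le (Phi : R -> R) (l : R) (i : lattice d) :
  bmeas Phi -> 0 < l -> (forall x y, `|Phi x - Phi y| <= l * `|x - y|) ->
  ((influence P eps eps' (Phi \o g) i)%:E <= l%:E * phys_dep P g eps eps' 2 i)%E.
Proof.
move=> bPhi l0 lip.
pose a w : conf_d := reflected i (e w).
pose a' w : conf_d := reflected i (mix (pred1 0) (e w) (e' w)).
have ma : measurable_fun [set: T] a by exact: measurableT_comp (measurable_reflected i) me_.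
have ma' : measurable_fun [set: T] a'.
  exact: measurableT_comp (measurable_reflected i) (measurable_mix _ me_ me'_).
have bG : bmeas (Phi \o g) by exact: bmeas_comp.
have -> : influence P eps eps' (Phi \o g) i = L2 P (fun w => Phi (g (a w)) - Phi (g (a' w))).
  by rewrite -[i in LHS]subr0 -(influence_reflected meps meps' iid_eps copy i 0 bG).
pose U w := g (a w) - g (a' w).
have mU : measurable_fun [set: T] U.
  by apply: measurable_funB; exact: measurableT_comp.
have -> : phys_dep P g eps eps' 2 i = Lnorm P 2%:E (fun w => (U w)%:E).
  rewrite /phys_dep; congr (Lnorm _ _ _); apply/funext => w; congr (_ - g _)%:E.
  apply/funext => s; rewrite /a' /reflected /mix /swap0 /=.
  by case: ifP.
have bV : bmeas (fun w => Phi (g (a w)) - Phi (g (a' w))).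
  by apply: bmeasB; [exact: bmeas_comp ma bG|exact: bmeas_comp ma' bG].
have mU2 : measurable_fun [set: T] (fun w => (U w ^+ 2)%:E).
  by apply/measurable_EFinP; exact: measurable_funX.
rewrite unlock.
have -> : (\int[P]_w `|(U w)%:E| `^ 2 = \int[P]_w (U w ^+ 2)%:E)%E.
  apply: eq_integral => w _; rewrite abse_EFin poweR_EFin powR_mulrn//.
  by rewrite real_normK ?num_real.
have I0 : (0 <= \int[P]_w (U w ^+ 2)%:E)%E.
  by apply: integral_ge0 => w _; rewrite lee_fin sqr_ge0.
have VU : ((Ex P (fun w => (Phi (g (a w)) - Phi (g (a' w))) ^+ 2))%:E <=
    (l ^+ 2)%:E * \int[P]_w (U w ^+ 2)%:E)%E.
  rewrite (EFin_Ex _ (bmeasX 2 bV)) -ge0_integralZl//; last 2 first.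
  - by move=> w _; rewrite lee_fin sqr_ge0.
  - by rewrite lee_fin sqr_ge0.
  apply: ge0_le_integral => //.
  - by move=> w _; rewrite lee_fin sqr_ge0.
  - by apply/measurable_EFinP; exact: (bmeasX 2 bV).1.
  - by apply: emeasurable_funM => //; exact: measurable_cst.
  move=> w _; rewrite -EFinM lee_fin -exprMn -[leLHS]real_normK ?num_real//.
  rewrite -[leRHS]real_normK ?num_real// lerXn2r ?nnegrE// normrM (gtr0_norm l0).
  exact: lip.
move: I0 VU; case: (\int[P]_w _)%E => [x x0 VU|_ _|//].
  rewrite poweR_EFin powR12_sqrt// -EFinM lee_fin.
  rewrite -(@ler_pXn2r _ 2)// ?nnegrE ?L2_ge0 ?mulr_ge0 ?sqrtr_ge0 ?(ltW l0)//.
  by rewrite L2_sqr exprMn sqr_sqrtr// -lee_fin EFinM.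
by rewrite poweRyr ?invr_eq0// gt0_muley ?lte_fin// leey.
Qed.

Hypothesis hsum : (\esum_(i in [set: lattice d])
  ((lnorm i)%:R `^ ((5 * d)%:R / 2))%:E * phys_dep P g eps eps' 2 i < +oo)%E.

(** Beyond distance [m] the weight in [hsum] is at least [(m + 1)^(5d/2)], which is the gain. The
    radius [m0] is uniform in [Phi] and [l], as these change with the bandwidth. *)
Lemma influence_tail (r : R) : 0 < r -> exists m0 : nat,
  forall (Phi : R -> R) (l : R) (m : nat) (s : seq (lattice d)),
  bmeas Phi -> 0 < l -> (forall x y, `|Phi x - Phi y| <= l * `|x - y|) ->
  (m0 <= m)%N -> uniq s -> all (fun j => m < lnorm j)%N s ->
  \sum_(j <- s) influence P eps eps' (Phi \o g) j <= l * (r / (m.+1)%:R `^ ((5 * d)%:R / 2)).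
Proof.
move=> r0; have := esum_tail _ hsum r0.
have pd0 i : (0 <= phys_dep P g eps eps' 2 i)%E by exact: Lnorm_ge0.
case=> [i|m0 Hm0]; first by rewrite mule_ge0// lee_fin powR_ge0.
exists m0 => Phi l m s bPhi l0 lip m0m us /allP far.
set W := (m.+1)%:R `^ _.
have W0 : 0 < W by rewrite powR_gt0.
have {}Hm0 : (\sum_(i <- s) ((lnorm i)%:R `^ ((5 * d)%:R / 2))%:E * phys_dep P g eps eps' 2 i <= r%:E)%E.
  by apply: Hm0 => //; apply/allP => j /far; exact: leq_ltn_trans.
rewrite -lee_fin -sumEFin.
apply: (@le_trans _ _ (\sum_(i <- s) (l / W)%:E * (((lnorm i)%:R `^ ((5 * d)%:R / 2))%:E * phys_dep P g eps eps' 2 i))%E).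
  rewrite big_seq [leRHS]big_seq; apply: lee_sum => i si.
  apply: (le_trans (influence_le i bPhi l0 lip)).
  rewrite muleA -EFinM; apply: lee_pmul => //; rewrite ?lee_fin ?(ltW l0)//.
  rewrite -mulrA ler_peMr ?(ltW l0)// mulrC ler_pdivlMr// mul1r.
  by apply: ge0_ler_powR => //; rewrite ?nnegrE// ler_nat; exact: far.
rewrite -ge0_sume_distrr; last by move=> i _; rewrite mule_ge0// lee_fin powR_ge0.
apply: (@le_trans _ _ ((l / W)%:E * r%:E)%E).
  by apply: lee_wpmul2l => //; rewrite lee_fin divr_ge0 ?(ltW l0) ?(ltW W0).
by rewrite -EFinM lee_fin mulrAC mulrA.
Qed.

Variables (Phi : nat -> R -> R) (b : nat -> R) (L : nat -> seq (lattice d)) (M C l v : R).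
Hypothesis mPhi : forall n, measurable_fun [set: R] (Phi n).
Hypothesis PhiM : forall n x, `|Phi n x| <= M.
Hypothesis l0 : 0 < l.
Hypothesis lip : forall n, 0 < b n -> forall x y, `|Phi n x - Phi n y| <= l / b n * `|x - y|.
Hypothesis C1 : 1 <= C.
Hypothesis b_gt0 : \forall n \near \oo, 0 < b n.
Hypothesis b_cvg0 : b n @[n --> \oo] --> (0 : R).
Hypothesis uL : forall n, uniq (L n).
Hypothesis Lb : ((size (L n))%:R * b n) @[n --> \oo] --> +oo.
Let G n : conf_d -> R := Phi n \o g.
Hypothesis EG1 : forall n, 0 < b n -> Ex P (fun w => `|G n (e w)|) <= C * b n.
Hypothesis EG12 : forall n, 0 < b n -> forall i j, i != j ->
  Ex P (fun w => `|G n (reflected i (e w)) * G n (reflected j (e w))|) <= C * b n ^+ 2.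
Hypothesis EG2 : forall n, 0 < b n -> Ex P (fun w => G n (e w) ^+ 2) <= C * b n.
Hypothesis EGv : (b n)^-1 * Ex P (fun w => G n (e w) ^+ 2) @[n --> \oo] --> v.

Definition normalized_sum n w := \sum_(i <- L n) (Num.sqrt ((size (L n))%:R * b n))^-1 *
  (G n (reflected i (e w)) - Ex P (fun w => G n (e w))).

Let K := 300 * C ^+ 2 + 4 * M.

Let bPhi n : bmeas (Phi n). Proof. by split => //; exists M. Qed.
Let bG n : bmeas (G n). Proof. exact: bmeas_comp mg (bPhi n). Qed.

Let bound eta : 0 < eta -> eta <= 1 -> \forall n \near \oo,
  Ex P (fun w => normalized_sum n w ^+ 2) <= 2 * ((b n)^-1 * Ex P (fun w => G n (e w) ^+ 2)) + K /\
  forall beta, `|Ex P (fun w => cos (normalized_sum n w + beta)) -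
     cos beta * expR (- ((b n)^-1 * Ex P (fun w => G n (e w) ^+ 2)) / 2)| <=
    K * eta + ((b n)^-1 * Ex P (fun w => G n (e w) ^+ 2) + K) * K *
      (Num.sqrt ((size (L n))%:R * b n))^-1.
Proof.
move=> eta0 eta1.
(* The order of choices is [eta], [r], [m0], [bs], and only then [n] and the block radius [m]. *)
have [r r0 Hr] := scale_choice d0 l0 eta0.
have [m0 Hm0] := influence_tail r0.
have [bs bs0 Hbs] := Hr m0.
have small : \forall n \near \oo, b n <= bs.
  move/cvgrPdist_le : b_cvg0 => /(_ _ bs0); apply: filterS => n.
  by rewrite sub0r normrN; apply: le_trans; exact: ler_norm.
have Lb0 : \forall n \near \oo, 0 < (size (L n))%:R * b n.
  by move/cvgryPgt : Lb; apply.
near=> n.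
have bn0 : 0 < b n by near: n.
have [|m [m0m Nb Nt]] := Hbs _ bn0; first by near: n.
have ln0 : 0 < l / b n by rewrite divr_gt0.
set theta := _ / Num.sqrt (b n) in Nt.
have theta0 : 0 < theta.
  apply: divr_gt0; last by rewrite sqrtr_gt0.
  by apply: mulr_gt0 => //; apply: divr_gt0 => //; exact: powR_gt0.
have boxE : ((4 * m).+1 ^ d)%N = size (box d (2 * m)) by rewrite size_box mulnA.
rewrite boxE in Nb Nt.
have tail s : uniq s -> all (fun j => (m < lnorm j)%N) s ->
    \sum_(j <- s) influence P eps eps' (G n) j <= theta * Num.sqrt (b n).
  move=> us fs; rewrite /theta divfK ?gt_eqF ?sqrtr_gt0//.
  exact: Hm0 (bPhi n) ln0 (lip bn0) m0m us fs.
have Ln0 : 0 < (size (L n))%:R * b n by near: n.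
have sc0 : 0 <= (Num.sqrt ((size (L n))%:R * b n))^-1 by rewrite invr_ge0.
have scE : (size (L n))%:R * (Num.sqrt ((size (L n))%:R * b n))^-1 ^+ 2 * b n = 1.
  by rewrite exprVn sqr_sqrtr ?(ltW Ln0)// mulrAC divff// gt_eqF.
exact: (sum_cf_bound meps meps' iid_eps copy (bG n) (fun a => PhiM n _) C1 bn0 (EG1 bn0)
  (EG12 bn0) (EG2 bn0) theta0 tail Nb Nt eta1 (uL n) sc0 scE).
Unshelve. all: by end_near. Qed.

Lemma normalized_sum_second_moment : exists K2 : R, \forall n \near \oo,
  Ex P (fun w => normalized_sum n w ^+ 2) <= K2.
Proof.
exists (2 * (v + 1) + K); have := bound ltr01 (lexx _).
move/cvgrPdist_le : EGv => /(_ _ ltr01); apply: filterS2 => n.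
by rewrite ler_norml => /andP[h _] [+ _]; lra.
Qed.

(** [n] grows with [eta] fixed in advance. The error [z] is split into thirds: the terms of order
    [eta], the term with the normalizing factor, and the difference between the variance at [n] and
    its limit [v]. *)
Lemma normalized_sum_cf (beta : R) :
  Ex P (fun w => cos (normalized_sum n w + beta)) @[n --> \oo] --> cos beta * expR (- v / 2).
Proof.
have v0 : 0 <= v.
  rewrite leNgt; apply/negP => v0; have nv0 : 0 < - v by rewrite oppr_gt0.
  move/cvgrPdist_lt : EGv => /(_ _ nv0) H; near \oo => n.
  have bn0 : 0 < b n by near: n.
  have : `|v - (b n)^-1 * Ex P (fun w => G n (e w) ^+ 2)| < - v by near: n.
  have : 0 <= (b n)^-1 * Ex P (fun w => G n (e w) ^+ 2).
    by rewrite mulr_ge0 ?invr_ge0 ?(ltW bn0)// Ex_ge0// => w; exact: sqr_ge0.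
  by move=> ? /ltr_normlP[]; lra.
have M0 : 0 <= M := le_trans (normr_ge0 _) (PhiM 0 0).
have K0 : 0 < K.
  apply: ltr_pwDl; last exact: mulr_ge0.
  by apply: mulr_gt0 => //; apply: exprn_gt0; exact: lt_le_trans C1.
apply/cvgrPdist_le => z z0.
pose eta := Num.min 1 (z / (3 * K)).
have eta0 : 0 < eta by rewrite lt_min ltr01 divr_gt0 ?mulr_gt0.
have eta1 : eta <= 1 by rewrite ge_min lexx.
have etaK : K * eta <= z / 3.
  apply: (@le_trans _ _ (K * (z / (3 * K)))).
    by rewrite ler_pM2l// ge_min lexx orbT.
  by rewrite (_ : K * _ = z / 3)//; field; rewrite gt_eqF.
(* Once [sc <= 1 / q], the term with [sc] is at most [z / 3], since [vn] is at most [v + 1]. *)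
pose q := 3 * ((v + 1 + K) * K) / z.
have v1K : 0 < v + 1 + K by lra.
have q0 : 0 < q by rewrite /q divr_gt0// !mulr_gt0.
have z30 : 0 < Num.min 1 (z / 3) by rewrite lt_min ltr01 divr_gt0.
near=> n.
have [_ /(_ beta)] : Ex P (fun w => normalized_sum n w ^+ 2) <= 2 * ((b n)^-1 * Ex P (fun w => G n (e w) ^+ 2)) + K /\
  forall beta, `|Ex P (fun w => cos (normalized_sum n w + beta)) -
     cos beta * expR (- ((b n)^-1 * Ex P (fun w => G n (e w) ^+ 2)) / 2)| <=
    K * eta + ((b n)^-1 * Ex P (fun w => G n (e w) ^+ 2) + K) * K *
      (Num.sqrt ((size (L n))%:R * b n))^-1 by near: n; exact: bound.
set vn := (b n)^-1 * _; set sc := (Num.sqrt _)^-1.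
have bn0 : 0 < b n by near: n.
have vn0 : 0 <= vn by rewrite mulr_ge0 ?invr_ge0 ?(ltW bn0)// Ex_ge0// => w; exact: sqr_ge0.
have vvn : `|v - vn| <= Num.min 1 (z / 3).
  by rewrite /vn; near: n; move/cvgrPdist_le : EGv; apply.
have Lq : q ^+ 2 < (size (L n))%:R * b n.
  by near: n; move/cvgryPgt : Lb; apply.
have scq : sc <= q^-1.
  rewrite /sc lef_pV2 ?posrE ?sqrtr_gt0//; last exact: le_lt_trans (sqr_ge0 q) Lq.
  by rewrite -[leLHS](ger0_norm (ltW q0)) -sqrtr_sqr ler_wsqrtr// ltW.
have sc0 : 0 <= sc by rewrite invr_ge0.
have h2 : (vn + K) * K * sc <= z / 3.
  apply: (@le_trans _ _ ((v + 1 + K) * K * q^-1)).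
    apply: ler_pM; [|exact: sc0| |exact: scq].
      by apply: mulr_ge0; [apply: addr_ge0 => //; exact: ltW|exact: ltW].
    rewrite ler_pM2r// lerD2r; move: vvn; rewrite le_min => /andP[+ _].
    by rewrite ler_norml => /andP[h _]; lra.
  rewrite /q invf_div (_ : _ * _ = z / 3)//; field.
  by rewrite !gt_eqF.
have h3 : `|cos beta * expR (- v / 2) - cos beta * expR (- vn / 2)| <= z / 3.
  rewrite -mulrBr normrM.
  have hc : `|cos beta| <= 1 by rewrite ler_norml cos_geN1 cos_le1.
  apply: (@le_trans _ _ (`|expR (- v / 2) - expR (- vn / 2)|)); first by rewrite ler_piMl.
  rewrite !mulNr; apply: le_trans (norm_expRNB _ _) _; [by rewrite divr_ge0|by rewrite divr_ge0|].
  rewrite -mulrBl normrM (@ger0_norm _ 2^-1)//.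
  by move: vvn; rewrite le_min => /andP[_]; have := normr_ge0 (v - vn); lra.
set x := Ex P _; set y := cos beta * expR (- vn / 2).
move: h3; rewrite -/y => h3 h1.
rewrite (_ : _ - x = (cos beta * expR (- v / 2) - y) + (y - x)); last by ring.
apply: le_trans (ler_normD _ _) _; rewrite (distrC y).
apply: le_trans (lerD h3 (le_trans h1 (lerD etaK h2))) _.
by rewrite -subr_ge0 (_ : _ - _ = 0)//; field.
Unshelve. all: by end_near. Qed.

End central_limit.

(** * The kernel applied to the random field *)

Section kernel_field.
Context (R : realType) (disp : measure_display) (T : measurableType disp).
Variable P : probability T R.
Variables (d : nat) (eps eps' : lattice d -> T -> R).
Hypothesis d0 : (0 < d)%N.
Hypothesis meps : forall j, measurable_fun [set: T] (eps j).
Hypothesis meps' : forall j, measurable_fun [set: T] (eps' j).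
Let e w : conf R (lattice d) := fun j => eps j w.
Let e' w : conf R (lattice d) := fun j => eps' j w.
Variable p : set R -> R.
Hypothesis iid_eps : iid_law P p eps.
Hypothesis copy : forall A B : set (conf R (lattice d)), measurable A -> measurable B ->
  P (e @^-1` A `&` e' @^-1` B) = (P (e @^-1` A) * P (e @^-1` B))%E.
Local Notation conf_d := (conf R (lattice d)).
Local Notation leb := (@lebesgue_measure R).
Variable g : conf_d -> R.
Hypothesis mg : measurable_fun [set: conf_d] g.
Hypothesis hsum : (\esum_(i in [set: lattice d])
  ((lnorm i)%:R `^ ((5 * d)%:R / 2))%:E * phys_dep P g eps eps' 2 i < +oo)%E.
Let X i w := g (reflected i (e w)).

Variables (f : R -> R) (Mf : R).
Hypothesis f_ge0 : forall x, 0 <= f x.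
Hypothesis fc : continuous f.
Hypothesis f_le : forall x, f x <= Mf.
Hypothesis dX : has_density P leb (X 0) f.
Variables (q : lattice d -> R * R -> R) (kappa : R).
Hypothesis dXX : forall i, i != 0 -> has_density P (leb \x leb)%E (fun w => (X 0 w, X i w)) (q i).
Hypothesis kappa0 : 0 < kappa.
Hypothesis q_le : forall i, i != 0 -> forall x y, q i (x, y) <= kappa.
Variables (K : R -> R) (Lk : R).
Hypothesis Lk0 : 0 < Lk.
Hypothesis lipK : forall x y, `|K x - K y| <= Lk * `|x - y|.
Hypothesis iK : leb.-integrable [set: R] (EFin \o K).
Hypothesis iK2 : leb.-integrable setT (fun u => (K u ^+ 2)%:E).
Variables (b : nat -> R) (L : nat -> seq (lattice d)).
Hypothesis b_gt0 : \forall n \near \oo, 0 < b n.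
Hypothesis b_cvg0 : b n @[n --> \oo] --> (0 : R).
Hypothesis uL : forall n, uniq (L n).
Hypothesis Lb : ((size (L n))%:R * b n) @[n --> \oo] --> +oo.
Variables (k : nat) (x : 'I_k -> R).
Hypothesis injx : injective x.
Variable a : 'I_k -> R.

Let me_ : measurable_fun [set: T] e. Proof. exact: measurable_conf. Qed.
Let mX i : measurable_fun [set: T] (X i).
Proof.
by apply: measurableT_comp mg _; exact: measurableT_comp (measurable_reflected i) me_.
Qed.

Let J := Rintegral leb setT (fun u => `|K u|).
Let A := \sum_l `|a l|.
Let J0 : 0 <= J. Proof. exact: Rintegral_ge0. Qed.
Let A0 : 0 <= A. Proof. exact: sumr_ge0. Qed.
Let Mf0 : 0 <= Mf. Proof. exact: le_trans (f_ge0 0) (f_le 0). Qed.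

Definition kernel_field_sum := normalized_sum P eps g (fun n => kernel_sum K x a (b n)) b L.
Let G n : conf_d -> R := kernel_sum K x a (b n) \o g.
Let v := \sum_l a l ^+ 2 * (f (x l) * Rintegral leb setT (fun u => K u ^+ 2)).

Let bks n : bmeas (kernel_sum K x a (b n)).
Proof.
split; first exact: measurable_kernel_sum Lk0 lipK _ _ _ _.
by have [M _ hM] := kernel_sum_bounded Lk0 lipK iK x a; exists M.
Qed.
Let bG n : bmeas (G n). Proof. exact: bmeas_comp mg (bks n). Qed.

Let Ex_G n (F : R -> R) : bmeas (fun t => F (kernel_sum K x a (b n) t)) ->
  Ex P (fun w => F (G n (e w))) = Ex P (fun w => F (kernel_sum K x a (b n) (X 0 w))).
Proof.
move=> bF; have bFG : bmeas (fun c : conf_d => F (G n c)) by exact: (bmeas_comp mg bF).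
exact: esym (Ex_reflected1 meps meps' iid_eps copy 0 bFG).
Qed.

Let EG1 n : 0 < b n -> Ex P (fun w => `|G n (e w)|) <= A * (Mf * J) * b n.
Proof.
move=> bn0; rewrite (Ex_G (F := fun t => `|t|)); last exact: bmeas_norm.
exact: (Ex_norm_kernel_sum f_ge0 fc f_le Lk0 lipK iK x a (mX 0) dX bn0).
Qed.

(** A translation carries the pair of sites [i, j] to [0, j - i], where a joint density is given. *)
Let EG12 n : 0 < b n -> forall i j, i != j ->
  Ex P (fun w => `|G n (reflected i (e w)) * G n (reflected j (e w))|) <=
  A ^+ 2 * (kappa * J ^+ 2) * b n ^+ 2.
Proof.
move=> bn0 i j ij; have ji0 : j - i != 0 by rewrite subr_eq0 eq_sym.
pose H (z : conf_d * conf_d) := `|G n (reflected 0 z.1) * G n (reflected (j - i) z.1)|.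
have bH : bmeas H.
  apply: bmeas_norm; apply: bmeasM.
    by apply: (bmeas_comp _ (bG n)); exact: measurableT_comp (measurable_reflected _) _.
  by apply: (bmeas_comp _ (bG n)); exact: measurableT_comp (measurable_reflected _) _.
have shiftK : cancel (fun s : lattice d => s + i) (fun s => s - i) by exact: addrK.
have := Ex_reindex meps meps' iid_eps copy shiftK bH.
rewrite /H /= => E.
have -> : Ex P (fun w => `|G n (reflected i (e w)) * G n (reflected j (e w))|) =
   Ex P (fun w => `|G n (reflected 0 (e w)) * G n (reflected (j - i) (e w))|).
  rewrite -E; apply: eq_Ex => w; congr (`|G n _ * G n _|); apply/funext => s.
    by rewrite /reflected /= sub0r addrC.
  by rewrite /reflected /= [in RHS]addrAC subrK.
exact: (Ex_kernel_sum_pair Lk0 lipK iK x a (mX 0) (mX (j - i)) (dXX ji0) (q_le ji0) kappa0 bn0).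
Qed.

Let EGv : (b n)^-1 * Ex P (fun w => G n (e w) ^+ 2) @[n --> \oo] --> v.
Proof.
have := cvg_Ex_kernel_sum_sqr f_ge0 fc f_le Lk0 lipK iK (mX 0) dX injx b_gt0 b_cvg0 iK2 (a := a).
suff -> : (fun n => (b n)^-1 * Ex P (fun w => G n (e w) ^+ 2)) =
  (fun n => (b n)^-1 * Ex P (fun w => kernel_sum K x a (b n) (X 0 w) ^+ 2)) by [].
apply/funext => n; rewrite (Ex_G (F := fun t => t ^+ 2))//; exact: bmeasX.
Qed.

Lemma kernel_field_sum_clt :
  (exists K2 : R, \forall n \near \oo, Ex P (fun w => kernel_field_sum n w ^+ 2) <= K2) /\
  forall beta, Ex P (fun w => cos (kernel_field_sum n w + beta)) @[n --> \oo] -->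
    cos beta * expR (- v / 2).
Proof.
have [M M0 hM] := kernel_sum_bounded Lk0 lipK iK x a.
(* One constant for all the moment bounds; the last summand comes from [G^2 <= M |G|], and the
   leading 1 ensures [1 <= C]. *)
pose C := 1 + A * (Mf * J) + A ^+ 2 * (kappa * J ^+ 2) + M * (A * (Mf * J)).
have c1 : 0 <= A * (Mf * J) by rewrite !mulr_ge0.
have c2 : 0 <= A ^+ 2 * (kappa * J ^+ 2) by rewrite !mulr_ge0 ?sqr_ge0// ltW.
have c3 : 0 <= M * (A * (Mf * J)) by rewrite mulr_ge0// ltW.
have C1 : 1 <= C by rewrite /C -!addrA lerDl !addr_ge0.
have H1 n : 0 < b n -> Ex P (fun w => `|G n (e w)|) <= C * b n.
  by move=> bn0; apply: (le_trans (EG1 bn0)); rewrite ler_pM2r// /C; lra.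
have H12 n : 0 < b n -> forall i j, i != j ->
  Ex P (fun w => `|G n (reflected i (e w)) * G n (reflected j (e w))|) <= C * b n ^+ 2.
  by move=> bn0 i j ij; apply: (le_trans (EG12 bn0 ij)); rewrite ler_pM2r ?exprn_gt0// /C; lra.
have H2 n : 0 < b n -> Ex P (fun w => G n (e w) ^+ 2) <= C * b n.
  move=> bn0; have bGe : bmeas (fun w => G n (e w)) by exact: bmeas_comp me_ (bG n).
  apply: (@le_trans _ _ (M * Ex P (fun w => `|G n (e w)|))).
    rewrite -ExZl; last exact: bmeas_norm.
    apply: Ex_le; [exact: bmeasX|by bm|move=> w].
    by rewrite -[leLHS]real_normK ?num_real// expr2 ler_wpM2r// hM.
  apply: (@le_trans _ _ (M * (A * (Mf * J) * b n))); first by rewrite ler_pM2l// EG1.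
  by rewrite mulrA ler_pM2r// /C; lra.
have l0 : 0 < A * Lk + 1 by rewrite ltr_wpDl// mulr_ge0// ltW.
have lip n : 0 < b n -> forall s t, `|kernel_sum K x a (b n) s - kernel_sum K x a (b n) t| <= (A * Lk + 1) / b n * `|s - t|.
  move=> bn0 s t; apply: (le_trans (kernel_sum_lipschitz lipK x a s t bn0)).
  by rewrite ler_wpM2r// ler_pM2r ?invr_gt0// lerDl.
have mks n : measurable_fun [set: R] (kernel_sum K x a (b n)) := (bks n).1.
split.
  exact: (normalized_sum_second_moment d0 meps meps' iid_eps copy mg hsum mks
   (fun n => hM (b n)) l0 lip C1 b_gt0 b_cvg0 uL Lb H1 H12 H2 EGv).
move=> beta; exact: (normalized_sum_cf d0 meps meps' iid_eps copy mg hsum mks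
   (fun n => hM (b n)) l0 lip C1 b_gt0 b_cvg0 uL Lb H1 H12 H2 EGv).
Qed.

End kernel_field.

(** * Kernel density estimators *)

(** [lipschitz] asserts the inequality for all constants above some [M]; [Num.max M 0 + 1] is one of
    them and is positive. *)
Lemma lipschitz_real (R : realType) (K : R -> R) : lipschitz K ->
  exists2 Lk, 0 < Lk & forall x y, `|K x - K y| <= Lk * `|x - y|.
Proof.
move=> [M [_ HM]]; exists (Num.max M 0 + 1) => [|x y].
  by rewrite ltr_wpDl// le_max lexx orbT.
apply: (HM (Num.max M 0 + 1) _ (x, y)) => //.
by rewrite (@le_lt_trans _ _ (Num.max M 0)) ?ltrDl// le_max lexx.
Qed.

(** Otherwise [K] would vanish almost everywhere, against its integral being 1. This makes all
    limiting variances positive. *)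
Lemma Rintegral_sqr_gt0 (R : realType) (K : R -> R) : continuous K ->
  (\int[lebesgue_measure]_u (K u)%:E = 1)%E ->
  (\int[lebesgue_measure]_u (K u ^+ 2)%:E < +oo)%E ->
  0 < Rintegral lebesgue_measure [set: R] (fun u => K u ^+ 2).
Proof.
move=> cK K1 K2; have mK : measurable_fun [set: R] K by exact: continuous_measurable_fun.
have mK2 : measurable_fun [set: measurableTypeR R] (fun u : measurableTypeR R => (K u ^+ 2)%:E).
  by apply/measurable_EFinP; exact: measurable_funX.
rewrite lt_neqAle eq_sym Rintegral_ge0 ?andbT => [|u _]; last exact: sqr_ge0.
apply/eqP => I0.
have {}I0 : (\int[lebesgue_measure]_u `|(K u ^+ 2)%:E| = 0)%E.
  under eq_integral do rewrite gee0_abs ?lee_fin ?sqr_ge0//.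
  have := congr1 EFin I0; rewrite /Rintegral fineK//.
  by rewrite ge0_fin_numE// integral_ge0// => u _; rewrite lee_fin sqr_ge0.
have ae := (ae_eq_integral_abs (@lebesgue_measure R) measurableT mK2).1 I0.
have : (\int[lebesgue_measure]_u (K u)%:E = \int[lebesgue_measure]_(u in [set: R]) cst 0 u)%E.
  apply: ae_eq_integral => //; first by apply/measurable_EFinP.
  apply: filterS ae => u h uT; have := h uT => /= -[/eqP].
  by rewrite sqrf_eq0 => /eqP ->.
by rewrite K1 integral_cst// mul0e => -[/eqP]; rewrite oner_eq0.
Qed.

(** Markov's inequality for the sum of the squared coordinates, which exceeds [l^2] as soon as one
    coordinate exceeds [l]. *)
Lemma chebyshev_tight (R : realType) (disp : measure_display) (T : measurableType disp)
    (P : probability T R) (k : nat) (Z : T -> 'cV[R]_k) (K2 l : R) :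
  (forall i, bmeas (fun w => Z w i ord0)) -> 0 < l ->
  (forall i, Ex P (fun w => Z w i ord0 ^+ 2) <= K2) ->
  fine (P [set w | exists i, l < `|Z w i ord0|]) <= k%:R * K2 / l ^+ 2.
Proof.
move=> bZ l0 HK.
have mZ : measurable_fun [set: T] (Z : T -> borel 'cV[R]_k).
  by apply: measurable_borel_cV => i; exact: (bZ i).1.
rewrite -(Ex_indic P mZ (@measurable_far R k l)).
have bi : bmeas (fun w => \1_(@far R k l) (Z w) : R).
  split; last by exists 1 => w; rewrite indicE; case: (_ \in _); rewrite ?normr0 ?normr1.
  apply: measurableT_comp mZ; exact: measurable_indic (@measurable_far R k l).
apply: (@le_trans _ _ (Ex P (fun w => (l ^+ 2)^-1 * \sum_i Z w i ord0 ^+ 2))).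
  apply: Ex_le => //; first by bm.
  move=> w; rewrite indicE; case: (boolP (_ \in _)) => [|_]; last first.
    by rewrite mulr_ge0 ?invr_ge0 ?sqr_ge0// sumr_ge0// => i _; exact: sqr_ge0.
  rewrite inE => -[i li]; rewrite ler_pdivlMl ?exprn_gt0// mulr1.
  rewrite (bigD1 i)//= ler_wpDr//; first by apply: sumr_ge0 => j _; exact: sqr_ge0.
  by rewrite -[leRHS]real_normK ?num_real// lerXn2r ?nnegrE ?(ltW l0)// ltW.
rewrite ExZl; last by bm.
rewrite Ex_sum => [|i]; last by bm.
rewrite mulrC ler_pM2r ?invr_gt0 ?exprn_gt0//.
apply: (@le_trans _ _ (\sum_(i < k) K2)); first by apply: ler_sum => i _; exact: HK.
by rewrite sumr_const card_ord mulr_natl.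
Qed.

Theorem theorem2 (R : realType) (disp : measure_display)
  (T : measurableType disp) (P : probability T R)
  (d : nat) (hd : (1 <= d)%N)
  (eps eps' : lattice d -> {RV P >-> R})
  (heps : iid P (fun j => eps j : T -> R))
  (heps' : independent_copy P (sample_path (fun j => eps j : T -> R))
                              (sample_path (fun j => eps' j : T -> R)))
  (g : configs R d -> R) (hg : measurable_fun [set: configs R d] g)
  (X : lattice d -> T -> R)
  (hX : X = shift_field g (fun j => eps j : T -> R))
  (f : R -> R) (hXf : forall i, has_density P lebesgue_measure (X i) f)
  (delta : lattice d -> \bar R)
  (hdelta : delta = phys_dep P g (fun j => eps j : T -> R)
                                 (fun j => eps' j : T -> R) 2)
  (hX2 : forall i, X i \in Lfun P 2%:E)
  (Lambda : nat -> {fset (lattice d)})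
  (hLambda : forall n, (1 <= n)%N -> Lambda n != fset0)
  (b : nat -> R) (hb : forall n, (1 <= n)%N -> 0 < b n)
  (K : R -> R)
  (fn : nat -> R -> T -> R)
  (hfn : fn = fun n => kernel_density X (Lambda n) (b n) K)
  (* (i) *)
  (hb0 : b n @[n --> \oo] --> (0 : R))
  (hLoo : (#|` Lambda n|%:R : R) @[n --> \oo] --> +oo)
  (hLboo : (#|` Lambda n|%:R * b n) @[n --> \oo] --> +oo)
  (* (ii) *)
  (hsum : (\esum_(i in [set: lattice d])
             (((lnorm i)%:R `^ ((5 * d)%:R / 2))%:E * delta i)%E < +oo)%E)
  (* (iii) *)
  (hf0 : forall x, 0 < f x) (hfc : continuous f) (hfb : bounded_fun f)
  (* (iv) *)
  (hKlip : lipschitz K)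
  (hK1 : (\int[lebesgue_measure]_u (K u)%:E = 1)%E)
  (hKint : (\int[lebesgue_measure]_u `|K u|%:E < +oo)%E)
  (hK2 : (\int[lebesgue_measure]_u (K u ^+ 2)%:E < +oo)%E)
  (* (v) *)
  (f0 : lattice d -> R * R -> R)
  (hf0i : forall i, i != 0 ->
     has_density P (lebesgue_measure \x lebesgue_measure)%E
       (fun w => (X 0 w, X i w)) (f0 i))
  (hkappa : exists2 kappa : R, 0 < kappa &
     forall i, i != 0 -> forall x y : R, f0 i (x, y) <= kappa) :
  forall (k : nat) (x : 'I_k -> R), (1 <= k)%N -> injective x ->
    exists2 nu : probability (borel 'cV[R]_k) R,
      is_multinormal nu 0
        (diag_mx (\row_i (f (x i) *
           Rintegral lebesgue_measure [set: R] (fun u => K u ^+ 2)))) &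
      cvg_in_law P
        (fun n w => \col_i (Num.sqrt (#|` Lambda n|%:R * b n) *
           (fn n (x i) w - fine 'E_P[fn n (x i)]%E)) : 'cV[R]_k) nu.
Proof.
move=> k x k1 injx.
pose ep j : T -> R := eps j; pose ep' j : T -> R := eps' j.
have mep j : measurable_fun [set: T] (ep j) by exact: measurable_funPT.
have mep' j : measurable_fun [set: T] (ep' j) by exact: measurable_funPT.
pose e w : conf R (lattice d) := fun j => ep j w.
pose e' w : conf R (lattice d) := fun j => ep' j w.
have iid_ep := iid_law_of_iid (0 : lattice d) heps.
(* Both halves of [independent_copy] at once: the second factor is expressed through the law of
   [e]. *)
have copy : forall A B : set (conf R (lattice d)), measurable A -> measurable B ->
    P (e @^-1` A `&` e' @^-1` B) = (P (e @^-1` A) * P (e @^-1` B))%E.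
  move=> A B mA mB; rewrite -[in RHS](heps'.1 B mB).
  exact: heps'.2 A B mA mB.
have mg : measurable_fun [set: conf R (lattice d)] g := hg.
have [Lk Lk0 lipK] := lipschitz_real hKlip.
have cK : continuous K := lipschitz_continuous Lk0 lipK.
(* f_n involves K ((x - X_i) / b_n) = K' ((X_i - x) / b_n) *)
pose K' u := K (- u).
have lipK' s t : `|K' s - K' t| <= Lk * `|s - t|.
  by apply: le_trans (lipK _ _) _; rewrite -opprD normrN.
have cK' : continuous K' := lipschitz_continuous Lk0 lipK'.
have mK' : measurable_fun [set: R] K' by exact: continuous_measurable_fun.
have iK' : lebesgue_measure.-integrable [set: R] (EFin \o K').
  apply/integrableP; split; first exact/measurable_EFinP.
  have cn : continuous (fun u => `|K u|) by exact: continuous_fun_comp cK (@norm_continuous _ _).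
  by have := ge0_integral_oppr cn (fun u => normr_ge0 _) => /= ->.
have c2 : continuous (fun u => K u ^+ 2) by exact: (@continuous_fun_mul R K K cK cK).
have I2 := ge0_integral_oppr c2 (fun u => sqr_ge0 _).
have iK2' : lebesgue_measure.-integrable [set: R] (fun u => (K' u ^+ 2)%:E).
  apply/integrableP; split; first by apply/measurable_EFinP; exact: measurable_funX.
  under eq_integral do rewrite gee0_abs ?lee_fin ?sqr_ge0//.
  by rewrite I2.
have RI2 : Rintegral lebesgue_measure [set: R] (fun u => K' u ^+ 2) =
    Rintegral lebesgue_measure [set: R] (fun u => K u ^+ 2) by congr fine.
have [MK MK0 hMK] := kernel_bounded Lk0 lipK' iK'.
have [M0 [_ HM0]] := hfb.
(* [bounded_fun] holds for every constant above some [M0], hence the [+ 1]. *)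
have f_le t : f t <= M0 + 1.
  by apply: le_trans (ler_norm _) _; apply: (HM0 (M0 + 1)) => //; rewrite ltrDl.
have [kappa kappa0 Hkappa] := hkappa.
have b_gt0 : \forall n \near \oo, 0 < b n.
  by near=> n; apply: hb; near: n; exact: nbhs_infty_gt.
pose L n : seq (lattice d) := Lambda n.
have uL n : uniq (L n) by exact: fset_uniq.
have Lb : ((size (L n))%:R * b n) @[n --> \oo] --> +oo by exact: hLboo.
have XE i w : X i w = g (reflected i (e w)) by rewrite hX.
have dX : has_density P lebesgue_measure (fun w => g (reflected 0 (e w))) f.
  by have := hXf 0; rewrite hX.
have dXX i : i != 0 -> has_density P (lebesgue_measure \x lebesgue_measure)%E
    (fun w => (g (reflected 0 (e w)), g (reflected i (e w)))) (f0 i).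
  by move=> i0; have := hf0i i i0; rewrite hX.
have hsum' : (\esum_(i in [set: lattice d])
    ((lnorm i)%:R `^ ((5 * d)%:R / 2))%:E * phys_dep P g ep ep' 2 i < +oo)%E.
  by move: hsum; rewrite hdelta.
have clt (a : 'I_k -> R) := kernel_field_sum_clt hd mep mep' iid_ep copy mg hsum'
  (fun t => ltW (hf0 t)) hfc f_le dX dXX kappa0 Hkappa Lk0 lipK' iK' iK2' b_gt0 hb0 uL Lb injx a.
pose gam l := f (x l) * Rintegral lebesgue_measure [set: R] (fun u => K u ^+ 2).
have gam0 l : 0 < gam l by rewrite mulr_gt0// Rintegral_sqr_gt0.
have [|nu Hnu0] := @gaussian_vector_exists R k (fun l => Num.sqrt (gam l)).
  by move=> l; rewrite sqrtr_gt0.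
have Hnu a c : Ex nu (fun z => cos (dot a z + c)) = cos c * expR (- (\sum_l (a l ord0) ^+ 2 * gam l) / 2).
  by rewrite Hnu0; under eq_bigr do rewrite sqr_sqrtr ?(ltW (gam0 _))//.
exists nu; first exact: multinormal_diag gam0 Hnu.
set Z := (fun n w => _).
pose kap n l i w := K' ((X i w - x l) / b n).
have me_ : measurable_fun [set: T] e by exact: measurable_conf.
have mX i : measurable_fun [set: T] (X i).
  rewrite (_ : X i = fun w => g (reflected i (e w))); last by apply/funext => w; exact: XE.
  by apply: measurableT_comp mg _; exact: measurableT_comp (measurable_reflected i) me_.
have bkap n l i : bmeas (kap n l i).
  split; last by exists MK => ?; exact: hMK.
  apply: measurableT_comp mK' _; apply: measurable_funM => //; exact: measurable_funB.
have fnE n l w : fn n (x l) w = (#|` Lambda n|%:R * b n)^-1 * \sum_(i <- L n) kap n l i w.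
  rewrite hfn /kernel_density; congr (_ * _); apply: eq_bigr => i _.
  by rewrite /kap /K' -mulNr opprB.
have bfn n l : bmeas (fn n (x l)).
  rewrite (_ : fn n (x l) = fun w => (#|` Lambda n|%:R * b n)^-1 * \sum_(i <- L n) kap n l i w); last first.
    by apply/funext => w; exact: fnE.
  by apply: bmeasM; [exact: bmeas_cst|apply: bmeas_sum => i; exact: bkap].
have ZE n l w : Z n w l ord0 = Num.sqrt (#|` Lambda n|%:R * b n) * (fn n (x l) w - Ex P (fn n (x l))).
  by rewrite /Z mxE unlock.
have bZ n l : bmeas (fun w => Z n w l ord0).
  rewrite (_ : (fun w => _) = fun w => Num.sqrt (#|` Lambda n|%:R * b n) * (fn n (x l) w - Ex P (fn n (x l)))); last first.
    by apply/funext => w; exact: ZE.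
  by apply: bmeasM; [exact: bmeas_cst|apply: bmeasB; [exact: bfn|exact: bmeas_cst]].
(* Linear forms of the vector are normalized sums of the field. Positivity, which only holds
   eventually, reduces the square root times the inverse to an inverse square root. *)
have linear a n w : 0 < #|` Lambda n|%:R * b n ->
    dot a (Z n w) = kernel_field_sum P ep g K' b L x (fun l => a l ord0) n w.
  move=> Nb0.
  have EX l i : Ex P (kap n l i) = Ex P (fun w => K' ((g (e w) - x l) / b n)).
    have bF : bmeas (fun c : conf R (lattice d) => K' ((g c - x l) / b n)).
      split; last by exists MK => ?; exact: hMK.
      by apply: measurableT_comp mK' _; apply: measurable_funM => //; exact: measurable_funB.
    rewrite -(Ex_reflected1 mep mep' iid_ep copy i bF); apply: eq_Ex => w'.
    by rewrite /kap XE.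
  have EfnE l : Ex P (fn n (x l)) = (#|` Lambda n|%:R * b n)^-1 *
      \sum_(i <- L n) Ex P (fun w => K' ((g (e w) - x l) / b n)).
    rewrite (@eq_Ex _ _ _ P _ _ (fnE n l)) ExZl; last by apply: bmeas_sum => i; exact: bkap.
    by rewrite Ex_sum//; congr (_ * _); apply: eq_bigr => i _; exact: EX.
  have EG : Ex P (fun w => kernel_sum K' x (fun l => a l ord0) (b n) (g (e w))) =
      \sum_l a l ord0 * Ex P (fun w => K' ((g (e w) - x l) / b n)).
    have bK l : bmeas (fun w => K' ((g (e w) - x l) / b n)).
      split; last by exists MK => ?; exact: hMK.
      apply: measurableT_comp mK' _; apply: measurable_funM => //; apply: measurable_funB => //.
      exact: measurableT_comp mg me_.
    rewrite /kernel_sum Ex_sum => [|l]; last by bm.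
    by apply: eq_bigr => l _; rewrite ExZl.
  have sq : Num.sqrt (#|` Lambda n|%:R * b n) * (#|` Lambda n|%:R * b n)^-1 =
      (Num.sqrt (#|` Lambda n|%:R * b n))^-1.
    rewrite -[X in _ * X^-1](sqr_sqrtr (ltW Nb0)) expr2 invfM mulrA divff ?mul1r//.
    by rewrite gt_eqF// sqrtr_gt0.
  rewrite dotE /kernel_field_sum /normalized_sum.
  transitivity (\sum_l \sum_(i <- L n) (Num.sqrt (#|` Lambda n|%:R * b n))^-1 *
      (a l ord0 * kap n l i w - a l ord0 * Ex P (fun w => K' ((g (e w) - x l) / b n)))).
    apply: eq_bigr => l _; rewrite ZE fnE EfnE -mulrBr -sumrB [X in _ * X]mulrA sq mulrCA !mulr_sumr.
    by apply: eq_bigr => i _; rewrite mulrBr.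
  rewrite exchange_big; apply: eq_bigr => i _; rewrite -mulr_sumr sumrB; congr (_ * (_ - _)).
    by apply: eq_bigr => l _; rewrite /kap XE.
  exact: esym EG.
have Nb_near : \forall n \near \oo, 0 < #|` Lambda n|%:R * b n.
  by move/cvgryPgt : hLboo; apply.
apply: cf_cvg_in_law.
- by move=> n l; exact: (bZ n l).1.
- move=> a c; rewrite Hnu.
  have := (clt (fun l => a l ord0)).2 c; rewrite RI2; apply: cvg_trans.
  apply: near_eq_cvg; near=> n; apply: eq_Ex => w; rewrite linear//.
  by near: n; exact: Nb_near.
- move=> eta eta0.
  (* The coordinate [l] is the linear form of a unit vector, so the second-moment half of [clt]
     applies to it. *)
  have bound l : exists K2 : R, \forall n \near \oo, Ex P (fun w => Z n w l ord0 ^+ 2) <= K2.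
    have [[K2 HK2] _] := clt (fun l' => (delta_mx l ord0 : 'cV[R]_k) l' ord0).
    exists K2; near=> n.
    have Nb0 : 0 < #|` Lambda n|%:R * b n by near: n; exact: Nb_near.
    rewrite (@eq_Ex _ _ _ P _ (fun w => kernel_field_sum P ep g K' b L x
      (fun l' => (delta_mx l ord0 : 'cV[R]_k) l' ord0) n w ^+ 2)) => [|w].
      by near: n; exact: HK2.
    rewrite -linear// dotE (bigD1 l)//= [X in X * _ + _]mxE !eqxx mul1r big1 ?addr0// => l' /negbTE l'l.
    by rewrite [X in X * _]mxE l'l mul0r.
  have /choice[K2 HK2] := bound.
  pose Ks := \sum_l `|K2 l|.
  have Ks0 : 0 <= Ks by exact: sumr_ge0.
  have K2Ks l : K2 l <= Ks.
    by rewrite /Ks (bigD1 l)//= (le_trans (ler_norm _))// lerDl sumr_ge0.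
  (* [A >= 1] gives [A <= A ^+ 2], and [eta * A = eta + k * Ks] then absorbs the Chebyshev bound. *)
  pose A := 1 + k%:R * Ks / eta.
  have A1 : 1 <= A by rewrite lerDl divr_ge0 ?mulr_ge0// ltW.
  exists A; first exact: lt_le_trans A1.
  have all_near : \forall n \near \oo, forall l, Ex P (fun w => Z n w l ord0 ^+ 2) <= K2 l.
    exact: filter_forall.
  apply: filterS all_near => n Hn.
  have HK l : Ex P (fun w => Z n w l ord0 ^+ 2) <= Ks by exact: le_trans (Hn l) (K2Ks l).
  apply: (le_trans (chebyshev_tight (bZ n) (lt_le_trans ltr01 A1) HK)).
  rewrite ler_pdivrMr ?exprn_gt0 ?(lt_le_trans ltr01 A1)//.
  apply: (@le_trans _ _ (eta * A)); last by rewrite ler_pM2l// ler_eXnr.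
  rewrite (_ : eta * A = eta + k%:R * Ks) ?lerDr ?(ltW eta0)//.
  by rewrite /A; field; rewrite gt_eqF.
Unshelve. all: by end_near. Qed.
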